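(* Let $\Lambda\subset\mathbb{R}^d$ be a lattice with dual lattice $\Lambda^*$. Let $c_0,c_1>0$ be constants, let $\mathcal{I}\subseteq\mathbb{N}$ be infinite, and for each $N\in\mathcal{I}$ let $\mathcal{D}_N\subset\mathbb{R}^d$ be an open set with boundary of measure zero such that $B(\mathbf{0},c_0N^{1/d})\subseteq\mathcal{D}_N\subseteq B(\mathbf{0},c_0N^{1/d}+c_1)$ and $\#(\mathcal{D}_N\cap\Lambda^* )=N$. Then the determinantal point process on $\Omega_\Lambda$ with kernel $$K_N(\mathbf{x},\mathbf{y})=\sum_{w\in\Lambda^*\cap\mathcal{D}_N}e^{2\pi i\langle\mathbf{x}-\mathbf{y},w\rangle}$$ with respect to $\mu$ is hyperuniform for large balls and hyperuniform for small balls. In the threshold regime the weaker property $$\limsup_{N\to\infty}V(X_N,tN^{-1/d})=\mathcal{O}\big(t^{d-1}\ln t\big)\quad\text{as }t\to\infty$$ holds. (All limits in $N$ are taken along $N\in\mathcal{I}$.)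
   Context: Let $\Lambda=A\mathbb{Z}^d$ be a lattice in $\mathbb{R}^d$, generated by a nonsingular matrix $A=[v_1,\dots,v_d]$, with fundamental domain $\Omega_\Lambda=\{\sum_{j=1}^d\alpha_jv_j:\alpha_j\in[0,1)\}$ of $\mathbb{R}^d/\Lambda$, co-volume $|\Lambda|=|\det A|$ and dual lattice $\Lambda^*=\{w\in\mathbb{R}^d:\langle w,v\rangle\in\mathbb{Z}\text{ for all }v\in\Lambda\}$. Let $\mu$ be Lebesgue measure on $\Omega_\Lambda$ normalized so that $\mu(\Omega_\Lambda)=1$, and let $\mathrm{diam}\,\Omega_\Lambda$ be the Euclidean diameter. $B(\mathbf{x},R)$ denotes the Euclidean ball with center $\mathbf{x}$ and radius $R$. Determinantal process: a random point process on $\Omega_\Lambda$ is determinantal with kernel $K:\Omega_\Lambda\times\Omega_\Lambda\to\mathbb{C}$ with respect to $\mu$ if it is simple and its joint intensities with respect to $\mu$ are $\rho(\mathbf{x}_1,\dots,\mathbf{x}_k)=\det(K(\mathbf{x}_i,\mathbf{x}_j))_{1\le i,j\le k}$ for every $k\ge1$ and $\mathbf{x}_1,\dots,\mathbf{x}_k\in\Omega_\Lambda$. Since $K_N$ is the kernel of an orthogonal projection in $L^2(\mu)$ onto an $N$-dimensional subspace, the process with kernel $K_N$ exists and has exactly $N$ points $X_N=\{\mathbf{x}_1,\dots,\mathbf{x}_N\}$ almost surely. Balls on the torus: in counting points, indicator functions of balls are $\Lambda$-periodized, i.e. for $\mathbf{x},\mathbf{y}\in\mathbb{R}^d$ and $R\ge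 0$ put $\mathbb{1}_{B(\mathbf{x},R)}(\mathbf{y})=\#\{v\in\Lambda:|\mathbf{y}+v-\mathbf{x}|\le R\}$, and $\mathrm{Vol}(B(\mathbf{x},R))=\frac{1}{|\Lambda|}\frac{\pi^{d/2}}{\Gamma(d/2+1)}R^d$. Number variance of the process: $$V(X_N,R)=\mathbb{E}\int_{\Omega_\Lambda}\Big(\sum_{j=1}^N\mathbb{1}_{B(\mathbf{x},R)}(\mathbf{x}_j)-N\,\mathrm{Vol}(B(\mathbf{x},R))\Big)^2d\mu(\mathbf{x}),$$ where the expectation is over the random points $\mathbf{x}_1,\dots,\mathbf{x}_N$ of the process. With this $V$, the process is: - hyperuniform for large balls if $V(X_N,R)=o(N)$ as $N\to\infty$ for every $R\in(0,\frac12\mathrm{diam}\,\Omega_\Lambda)$; - hyperuniform for small balls if $V(X_N,R_N)=o(N\,\mathrm{Vol}(B(\cdot,R_N)))$ as $N\to\infty$ for all sequences of positive radii $(R_N)$ with $R_N\to0$ and $N\,\mathrm{Vol}(B(\cdot,R_N))\to\infty$. *)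

(* Defs.v *)
From HB Require Import structures.
From mathcomp Require Import all_boot all_order all_algebra finmap.
From mathcomp Require Import all_classical all_reals all_analysis.
From mathcomp Require Import complex.

Set Implicit Arguments.
Unset Strict Implicit.
Unset Printing Implicit Defensive.

Import Order.TTheory GRing.Theory Num.Theory.
Import numFieldNormedType.Exports.

Local Open Scope classical_set_scope.
Local Open Scope ring_scope.

(* The sigma-algebra on column vectors generated by the coordinate maps; on
   R^d it is the Borel sigma-algebra, R being second countable. *)
Section measurable_cV.
Context {disp} {T : sigmaRingType disp}.
Variable n : nat.

Let coord (i : 'I_n) (x : 'cV[T]_n) : T := x i ord0.

Let cV_set0 : g_sigma_preimage coord set0.
Proof. exact: sigma_algebra0. Qed.

Let cV_setC B : g_sigma_preimage coord B -> g_sigma_preimage coord (~` B).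
Proof. exact: sigma_algebraC. Qed.

Let cV_bigcup (F : (set 'cV[T]_n)^nat) :
  (forall i, g_sigma_preimage coord (F i)) ->
  g_sigma_preimage coord (\bigcup_i (F i)).
Proof. exact: sigma_algebra_bigcup. Qed.

HB.instance Definition _ := @isMeasurable.Build (measure_tuple_display disp)
  'cV[T]_n (g_sigma_preimage coord) cV_set0 cV_setC cV_bigcup.
End measurable_cV.

(* n-fold product mu x ... x mu of a (sigma-finite) measure. *)
Fixpoint power_measure (disp : measure_display) (T : measurableType disp)
    (R : realType) (mu : set T -> \bar R) (n : nat) :
    set (n.-tuple T) -> \bar R :=
  match n with
  | 0 => dirac [tuple]
  | m.+1 => pushforward (product_measure1 mu (power_measure mu (n := m)))
              (fun p : T * m.-tuple T => [tuple of p.1 :: p.2])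
  end.
Arguments power_measure {disp T R} mu n.

Section lattice.
Context {R : realType} {d : nat}.
Implicit Types (A : 'M[R]_d) (x y : 'cV[R]_d) (r : R).

Definition lebesgue_cV : set 'cV[R]_d -> \bar R :=
  pushforward (power_measure (@lebesgue_measure R) d)
    (fun t : d.-tuple (measurableTypeR R) => \col_i tnth t i : 'cV[R]_d).

Definition dot x y : R := \sum_(i < d) x i ord0 * y i ord0.

(* The library norm on matrices is the sup norm. *)
Definition enorm x : R := Num.sqrt (dot x x).

(* The open ball: for an open set, inclusions between balls are implied by the
   corresponding inclusions between closed balls (of positive radius). *)
Definition eball x r : set 'cV[R]_d := [set y | enorm (y - x) < r].

Definition ediam (S : set 'cV[R]_d) : R :=
  sup [set enorm (p.1 - p.2) | p in S `*` S].

Definition lattice A : set 'cV[R]_d :=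
  [set A *m map_mx intr z | z in [set: 'cV[int]_d]].

Definition dual_lattice A : set 'cV[R]_d :=
  [set w | forall v, lattice A v -> dot w v \is a Num.int].

Definition covolume A : R := `|\det A|.

Definition fund_domain A : set 'cV[R]_d :=
  [set \sum_(j < d) a j ord0 *: col j A |
     a in [set a : 'cV[R]_d | forall j, 0 <= a j ord0 < 1]].

Definition torus_measure A : set 'cV[R]_d -> \bar R :=
  fun B => (((fine (lebesgue_cV (fund_domain A)))^-1)%:E
            * lebesgue_cV (B `&` fund_domain A))%E.

(* #{v in Lambda : |y + v - x| <= r}; this set is finite. *)
Definition ball_indicator A x r y : R :=
  (#|` fset_set [set v | lattice A v /\ enorm (y + v - x) <= r] |%fset)%:R.

Definition Gamma (s : R) : R :=
  \int[lebesgue_measure]_(t in `]0, +oo[) (t `^ (s - 1) * expR (- t)).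

Definition ball_volume A r : R :=
  (covolume A)^-1 * (pi `^ (d%:R / 2) / Gamma (d%:R / 2 + 1)) * r ^+ d.

End lattice.

Definition cexp_i {R : realType} (theta : R) : R[i] :=
  (cos theta +i* sin theta)%C.

Section point_process.
Context {R : realType} {d : nat}.
Context {disp : measure_display} {T : measurableType disp}.
Implicit Types (A : 'M[R]_d) (P : probability T R) (X : T -> seq 'cV[R]_d).

Definition npoints (s : seq 'cV[R]_d) (B : set 'cV[R]_d) : nat :=
  count (fun y => y \in B) s.

(* A configuration of points in the bounded set fund_domain A is a finite
   multiset, given as a list whose order carries no information: only the
   counting variables are required to be random variables. *)
Definition point_process A X : Prop :=
  (forall w y, y \in X w -> fund_domain A y) /\
  (forall B, measurable B ->
     measurable_fun [set: T] (fun w => npoints (X w) B)).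

Definition simple_process P X : Prop := {ae P, forall w, uniq (X w)}.

(* rho is the k-point joint intensity of X with respect to mu: for pairwise
   disjoint B_1, ..., B_k, the expectation of the product of the numbers of
   points in the B_i is the integral of rho over B_1 x ... x B_k. *)
Definition joint_intensity A P X (k : nat) (rho : k.-tuple 'cV[R]_d -> R) :
    Prop :=
  forall B : 'I_k -> set 'cV[R]_d,
    (forall i, measurable (B i)) -> (forall i, B i `<=` fund_domain A) ->
    trivIset [set: 'I_k] B ->
    (\int[P]_w (\prod_(i < k) (npoints (X w) (B i))%:R)%:E
     = \int[power_measure (torus_measure A) k]_(t in
         [set t : k.-tuple 'cV[R]_d | forall i, B i (tnth t i)]) (rho t)%:E)%E.

Definition determinantal A (K : 'cV[R]_d -> 'cV[R]_d -> R[i]) P X : Prop :=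
  [/\ point_process A X, simple_process P X &
      forall k : nat, (0 < k)%N ->
        exists rho : k.-tuple 'cV[R]_d -> R,
          (forall t : k.-tuple 'cV[R]_d,
             (forall i, fund_domain A (tnth t i)) ->
             ((rho t)%:C)%C = \det (\matrix_(i, j) K (tnth t i) (tnth t j))) /\
          joint_intensity A P X rho].

(* N is the (almost sure) number of points of the process. *)
Definition number_variance A P X (N : nat) (r : R) : \bar R :=
  (\int[P]_w \int[torus_measure A]_(x in fund_domain A)
     ((\sum_(y <- X w) ball_indicator A x r y
       - N%:R * ball_volume A r) ^+ 2)%:E)%E.

End point_process.

Definition dual_kernel {R : realType} {d : nat} (A : 'M[R]_d)
    (D : set 'cV[R]_d) (x y : 'cV[R]_d) : R[i] :=
  \sum_(w \in dual_lattice A `&` D) cexp_i (2 * pi * dot (x - y) w).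

Section hyperuniformity.
Context {R : realType} {d : nat}.
Variables (A : 'M[R]_d) (I : set nat) (V : nat -> R -> \bar R).

(* N tends to infinity along I: the filter within I \oo. *)
Definition hyperuniform_large : Prop :=
  forall r : R, 0 < r < ediam (fund_domain A) / 2 ->
    (V N r * ((N%:R : R)^-1)%:E)%E @[N --> within I \oo] --> 0%E.

Definition hyperuniform_small : Prop :=
  forall r : nat -> R, (forall N, I N -> 0 < r N) ->
    r N @[N --> within I \oo] --> (0 : R) ->
    N%:R * ball_volume A (r N) @[N --> within I \oo] --> +oo ->
    (V N (r N) * ((N%:R * ball_volume A (r N))^-1)%:E)%E
      @[N --> within I \oo] --> 0%E.

Definition threshold_bound : Prop :=
  exists C : R, \forall t \near +oo,
    (limf_esup (fun N => V N (t * N%:R `^ (- d%:R^-1))) (within I \oo)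
     <= (C * (t ^+ d.-1 * ln t))%:E)%E.

End hyperuniformity.
Arguments threshold_bound {R} d I V.

(* Main.v *)
(** In the coordinates x = A a, write p(x) for the number of lattice translates
    lying in the ball.  The second moment of the process and the identity
    int |K_N|^2 = N bound the number variance by
      1/2 int_h |k(h)|^2 H(h) dh,  H(h) = int_x (p(x - h) - p(x))^2 dx,
    where k is the trigonometric polynomial whose frequency set S is that of K_N.
    A ball and its translate differ only inside a thin shell, so that
    H(h) <= C r^(d-1) sum_i min(r, ||h_i||), with ||.|| the distance to the
    integers.  Majorize min(r, ||h_i||) by the dyadic sum of
    min(r, 2^-(j+1)) (1 - cos(2 pi 2^j h_i)); since int |k|^2 (1 - cos(2 pi m h_i))
    is the number of u in S with u + m e_i outside S, it is at most m times a
    boundary layer count O(N^((d-1)/d)).  Summing over j yields, uniformly for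
    bounded r, V(X_N, r) <= C t^(d-1) (1 + ln(1 + 2 t)) with t = r N^(1/d), which
    implies the three claims. *)
Require Import Defs.
From HB Require Import structures.
From mathcomp Require Import all_boot all_order all_algebra.
From mathcomp Require Import all_classical all_reals all_analysis.
From mathcomp Require Import complex measurable_realfun ring lra zify.

Set Implicit Arguments.
Unset Strict Implicit.
Unset Printing Implicit Defensive.

Import Order.TTheory GRing.Theory Num.Theory.
Import numFieldNormedType.Exports.

Local Open Scope classical_set_scope.
Local Open Scope ring_scope.

(** * Product measures and Lebesgue measure on column vectors *)

(** The set [D N] is only pinned between two balls, so its exponential sum has no usable pointwise
    asymptotics. What survives is arithmetic: int |k|^2 (1 - cos) is an exact lattice count, and the
    points counted lie in an annulus of bounded width around radius c0 N^(1/d); [c0] and [c1] enter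
    only there. The dyadic sum is cut at 2^J ~ N^(1/d), where the remainder 2^-(J+1) times int |k|^2
    = N has the boundary order N^((d-1)/d). Scales coarser than r form a geometric sum; each scale
    between N^(-1/d) and r contributes the same amount, and their number, about log2(r N^(1/d)), is
    the logarithm. The obstacles lie in measure theory. Joint intensities are prescribed on disjoint
    sets only, so the second moment is rebuilt from separated pairs, as an inequality, which
    suffices for an upper bound. The configuration is measurable only through its counts, so joint
    measurability in the sample and the centre has to be derived. Finiteness of moments is not known
    beforehand: identities are kept between nonnegative integrals, with terms added on both sides in
    place of subtractions. *)

Section sigma_finite_bundling.
Context d (T : measurableType d) (R : realType).
Variable mu : {measure set T -> \bar R}.
Hypothesis sfmu : sigma_finite [set: T] mu.
(** An alias carrying the proof of sigma-finiteness, to which the structure can be attached.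
    Tonelli's theorem is applied to bundled measures, while those of the statement are bare set
    functions; the [_bundle] lemmas bridge the gap by existence. *)
Definition sigma_finite_copy (_ : sigma_finite [set: T] mu) : set T -> \bar R := mu.
HB.instance Definition _ := Measure.copy (sigma_finite_copy sfmu) mu.
HB.instance Definition _ :=
  Measure_isSigmaFinite.Build _ _ _ (sigma_finite_copy sfmu) sfmu.

Lemma sigma_finite_bundle :
  exists m : {sigma_finite_measure set T -> \bar R},
    (m : set T -> \bar R) = mu.
Proof. by exists (sigma_finite_copy sfmu). Qed.

End sigma_finite_bundling.

(** A pushforward of a sigma-finite measure need not be sigma-finite. Here the measurable left
    inverse [g] transports a covering: the preimage of [F i] under [g] pulls back along [f] to [F i]
    itself. *)
Lemma sigma_finite_pushforward_can d1 d2 (T1 : measurableType d1)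
    (T2 : measurableType d2) (R : realType)
    (m : {sigma_finite_measure set T1 -> \bar R}) (f : T1 -> T2) (g : T2 -> T1) :
  measurable_fun [set: T1] f -> measurable_fun [set: T2] g -> cancel f g ->
  exists m' : {sigma_finite_measure set T2 -> \bar R},
    (m' : set T2 -> \bar R) = pushforward m f.
Proof.
move=> mf mg fK.
pose pf := [the {measure set T2 -> \bar R} of pushforward m f].
suff : sigma_finite [set: T2] (pf mf) by move/sigma_finite_bundle.
have [F FT mF] := sigma_finiteT m.
exists (fun i => g @^-1` F i).
  by rewrite -preimage_bigcup -FT preimage_setT.
move=> i; split; first by rewrite -[X in measurable X]setTI; apply: mg => //; case: (mF i).
rewrite /pf /= /pushforward -comp_preimage.
rewrite (_ : g \o f = id); first by have [] := mF i.
by apply/funext => x /=; rewrite fK.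
Qed.

(** The exhaustions are taken increasing, so that the rectangles with equal indices already cover
    the product. *)
Lemma product_measure_bundle d1 d2 (T1 : measurableType d1)
    (T2 : measurableType d2) (R : realType)
    (m1 : {sigma_finite_measure set T1 -> \bar R})
    (m2 : {sigma_finite_measure set T2 -> \bar R}) :
  exists m : {sigma_finite_measure set (T1 * T2)%type -> \bar R},
    (m : set (T1 * T2)%type -> \bar R) = (m1 \x m2)%E.
Proof.
apply: sigma_finite_bundle.
have /sigma_finiteP[F [TF ndF mF]] := sigma_finiteT m1.
have /sigma_finiteP[G [TG ndG mG]] := sigma_finiteT m2.
exists (fun n => F n `*` G n).
  apply/esym; rewrite -subTset => -[x y] _.
  have [i _ Fix] : (\bigcup_i F i) x by rewrite -TF.
  have [j _ Gjy] : (\bigcup_i G i) y by rewrite -TG.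
  exists (maxn i j) => //; split => /=.
    by move: Fix; exact/subsetPset/ndF/leq_maxl.
  by move: Gjy; exact/subsetPset/ndG/leq_maxr.
move=> n; have [mFn Fny] := mF n; have [mGn Gny] := mG n.
split; first exact: measurableX.
by rewrite /= product_measure1E// lte_mul_pinfty// ge0_fin_numE.
Qed.

Section power_measure_theory.
Context d (T : measurableType d) (R : realType).
Variable mu : {sigma_finite_measure set T -> \bar R}.

Lemma measurable_tuple_cons n :
  measurable_fun [set: T * n.-tuple T]
    (fun p : T * n.-tuple T => [tuple of p.1 :: p.2]).
Proof. exact: measurable_cons. Qed.

Lemma power_measure_bundle n :
  exists m : {sigma_finite_measure set (n.-tuple T) -> \bar R},
    (m : set (n.-tuple T) -> \bar R) = power_measure mu n.
Proof.
elim: n => [|n [m mE]]; first by exists (dirac [tuple]).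
have [mm mmE] := product_measure_bundle mu m.
have [|p|m' m'E] := @sigma_finite_pushforward_can _ _ _ (n.+1.-tuple T) R mm
  (fun p : T * n.-tuple T => [tuple of p.1 :: p.2])
  (fun t => (thead t, [tuple of behead t])) (@measurable_tuple_cons n).
- apply/measurable_fun_pairP; split; first exact: measurable_tnth.
  exact: measurable_behead.
- by case: p => x t/=; rewrite theadE; congr pair; apply/val_inj.
- by exists m'; rewrite m'E /= mmE mE.
Qed.

End power_measure_theory.

Section measurable_cV_theory.
Context d1 d2 (T : measurableType d1) (U : measurableType d2).

Lemma measurable_coord n (i : 'I_n) :
  measurable_fun [set: 'cV[T]_n] (fun x : 'cV[T]_n => x i ord0).
Proof.
move=> _ Y mY; rewrite setTI; apply: sub_sigma_algebra => /=.
rewrite -bigcup_seq/=; exists i => /=; first by rewrite mem_index_enum.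
by exists Y => //; rewrite setTI.
Qed.

Lemma measurable_cVP n (f : U -> 'cV[T]_n) :
  (forall i, measurable_fun [set: U] (fun x => f x i ord0)) ->
  measurable_fun [set: U] f.
Proof.
move=> mf.
have : g_sigma_preimage (fun i => (fun x : 'cV[T]_n => x i ord0) \o f)
    `<=` measurable.
  apply: smallest_sub; first exact: sigma_algebra_measurable.
  case: n => [|n] in f mf *; first by rewrite big_ord0.
  rewrite -bigcup_mkord_ord; apply: bigcup_sub => i Ii.
  by move=> A [B mB <-]; exact: mf.
by rewrite g_sigma_preimage_comp => + _ A mA; apply; exists A.
Qed.

End measurable_cV_theory.

Section lebesgue_affine.
Context {R : realType}.
Local Notation mu := (@lebesgue_measure R).

Lemma measurable_affine (c b : R) :
  measurable_fun [set: measurableTypeR R] (fun x => c * x + b : measurableTypeR R).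
Proof. by apply: measurable_realfun.measurable_funD => //; apply: measurable_funM. Qed.

(** Uniqueness of Lebesgue measure: the pushforward scaled by [c] gives half-open intervals their
    length. *)
Lemma lebesgue_measure_affine (c b : R) (A : set R) : 0 < c -> measurable A ->
  (c%:E * mu ((fun x => (c * x + b)%R) @^-1` A) = mu A)%E.
Proof.
move=> c0 mA; pose cn := NngNum (ltW c0).
pose f := (fun x => c * x + b : measurableTypeR R).
pose mf := measurable_affine c b.
pose pf := [the {measure set _ -> \bar R} of pushforward mu f].
apply/esym/(@lebesgue_measure_unique R (mscale cn (pf mf))) => // _ [[u v]] _ <-.
have E : f @^-1` `]u, v] = `](u - b) / c, (v - b) / c]%classic.
  apply/seteqP; split => x /=; rewrite !in_itv/= /f ltr_pdivrMr// ler_pdivlMr//;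
    by rewrite ltrBlDr lerBrDr (mulrC c).
transitivity (c%:E * mu (f @^-1` `]u, v]))%E; last by [].
rewrite E !lebesgue_measure_itv/= !lte_fin ltr_pM2r ?invr_gt0// ltrD2r.
case: ifPn => _; last by rewrite mule0.
by rewrite -EFinD -EFinM; congr EFin; field; rewrite gt_eqF.
Qed.

Lemma ge0_integral_affine (c b : R) (f : R -> \bar R) : c != 0 ->
  measurable_fun [set: R] f -> (forall x, 0 <= f x)%E ->
  (`|c|%:E * \int[mu]_x f (c * x + b)%R = \int[mu]_x f x)%E.
Proof.
have pos e (g : R -> \bar R) : 0 < e ->
    measurable_fun [set: R] g -> (forall x, 0 <= g x)%E ->
    (e%:E * \int[mu]_x g (e * x + b)%R = \int[mu]_x g x)%E.
  move=> e0 mg g0; pose en := NngNum (ltW e0).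
  pose h := (fun x => e * x + b : measurableTypeR R).
  pose ph := [the {measure set _ -> \bar R} of pushforward mu h].
  have -> : (\int[mu]_x g x = \int[mscale en (ph (measurable_affine e b))]_x g x)%E.
    apply: eq_measure_integral => A mA _; apply/esym.
    exact: lebesgue_measure_affine.
  rewrite ge0_integral_mscale//; congr (_ * _)%E.
  by rewrite ge0_integral_pushforward//; exact: measurable_affine.
move=> c0 mf f0.
have [c1|c1|/eqP] := ltgtP c 0; last by rewrite (negbTE c0).
  (* A negative factor is a positive one followed by the reflection, which preserves Lebesgue
     measure. *)
  rewrite -[in RHS](pos (- c))// ?oppr_gt0//; congr (_ * _)%E.
    by rewrite ltr0_norm.
  transitivity (\int[pushforward mu (-%R : _ -> measurableTypeR R)]_x f (- c * x + b)%R)%E.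
    rewrite ge0_integral_pushforward//.
      by apply: eq_integral => x _ /=; rewrite mulrNN.
    by apply: measurableT_comp => //; exact: measurable_affine.
  by apply: eq_measure_integral => A mA _; exact: lebesgue_measureN.
by rewrite -[in RHS](pos c)// gtr0_norm.
Qed.

Lemma ge0_integral_shift (b : R) (f : R -> \bar R) :
  measurable_fun [set: R] f -> (forall x, 0 <= f x)%E ->
  (\int[mu]_x f (x + b)%R = \int[mu]_x f x)%E.
Proof.
move=> mf f0; have := ge0_integral_affine b (oner_neq0 R) mf f0.
rewrite normr1 mul1e => <-.
by apply: eq_integral => x _; rewrite mul1r.
Qed.

End lebesgue_affine.

Section measurable_cV_ops.
Context {R : realType} d (U : measurableType d).

Lemma measurable_sumR (I : Type) (s : seq I) (h : I -> U -> R) :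
  (forall i, measurable_fun [set: U] (h i)) ->
  measurable_fun [set: U] (fun u => \sum_(i <- s) h i u).
Proof.
move=> mh; elim: s => [|i s IH].
  by under [X in measurable_fun _ X]eq_fun do rewrite big_nil; exact: measurable_cst.
under [X in measurable_fun _ X]eq_fun do rewrite big_cons.
exact: measurable_funD.
Qed.

Lemma measurable_cV_coord n (i : 'I_n) (f : U -> 'cV[R]_n) :
  measurable_fun [set: U] f -> measurable_fun [set: U] (fun u => f u i ord0).
Proof. by move=> mf; apply: (measurableT_comp (measurable_coord i) mf). Qed.

Lemma measurable_cVD n (f g : U -> 'cV[R]_n) :
  measurable_fun [set: U] f -> measurable_fun [set: U] g ->
  measurable_fun [set: U] (fun u => f u + g u).
Proof.
move=> mf mg; apply: measurable_cVP => i.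
under [X in measurable_fun _ X]eq_fun do rewrite mxE.
by apply: measurable_funD; exact: measurable_cV_coord.
Qed.

Lemma measurable_cVN n (f : U -> 'cV[R]_n) :
  measurable_fun [set: U] f -> measurable_fun [set: U] (fun u => - f u).
Proof.
move=> mf; apply: measurable_cVP => i.
under [X in measurable_fun _ X]eq_fun do rewrite mxE.
by apply: measurable_funN; exact: measurable_cV_coord.
Qed.

Lemma measurable_cVB n (f g : U -> 'cV[R]_n) :
  measurable_fun [set: U] f -> measurable_fun [set: U] g ->
  measurable_fun [set: U] (fun u => f u - g u).
Proof. by move=> mf mg; apply: measurable_cVD => //; exact: measurable_cVN. Qed.

Lemma measurable_mulmx_cV m n (B : 'M[R]_(m, n)) (f : U -> 'cV[R]_n) :
  measurable_fun [set: U] f -> measurable_fun [set: U] (fun u => B *m f u).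
Proof.
move=> mf; apply: measurable_cVP => i.
under [X in measurable_fun _ X]eq_fun do rewrite mxE.
apply: measurable_sumR => j; apply: measurable_funM => //.
exact: measurable_cV_coord.
Qed.

Lemma measurable_dot n (f g : U -> 'cV[R]_n) :
  measurable_fun [set: U] f -> measurable_fun [set: U] g ->
  measurable_fun [set: U] (fun u => dot (f u) (g u)).
Proof.
move=> mf mg; apply: measurable_sumR => j.
by apply: measurable_funM; exact: measurable_cV_coord.
Qed.

Lemma measurable_enorm n (f : U -> 'cV[R]_n) :
  measurable_fun [set: U] f -> measurable_fun [set: U] (fun u => enorm (f u)).
Proof.
move=> mf; rewrite /enorm.
apply: (@measurableT_comp _ _ _ _ _ _ (@Num.sqrt R)); last exact: measurable_dot.
by apply: continuous_measurable_fun; exact: sqrt_continuous.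
Qed.

End measurable_cV_ops.

Lemma ge0_integral_pushforwardT d1 d2 (T1 : measurableType d1)
    (T2 : measurableType d2) (R : realType) (phi : T1 -> T2)
    (mphi : measurable_fun [set: T1] phi) (m : {measure set T1 -> \bar R})
    (f : T2 -> \bar R) :
  measurable_fun [set: T2] f -> (forall y, 0 <= f y)%E ->
  (\int[pushforward m phi]_y f y = \int[m]_x f (phi x))%E.
Proof. by move=> mf f0; rewrite ge0_integral_pushforward. Qed.

Lemma tonelli d1 d2 (T1 : measurableType d1) (T2 : measurableType d2)
    (R : realType) (m1 : {sigma_finite_measure set T1 -> \bar R})
    (m2 : {sigma_finite_measure set T2 -> \bar R}) (f : T1 -> T2 -> \bar R) :
  measurable_fun [set: T1 * T2] (fun p => f p.1 p.2) ->
  (forall x y, 0 <= f x y)%E ->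
  (\int[m1]_x \int[m2]_y f x y = \int[m2]_y \int[m1]_x f x y)%E.
Proof. by move=> mf f0; apply: (fubini_tonelli _ mf) => -[x y] /=. Qed.

Section lebesgue_cV_theory.
Context {R : realType}.
Local Notation mu := (@lebesgue_measure R).

Lemma lebesgue_cV_bundle n : exists m : {sigma_finite_measure set 'cV[R]_n -> \bar R},
  (m : set 'cV[R]_n -> \bar R) = lebesgue_cV.
Proof.
have [m mE] := @power_measure_bundle _ (measurableTypeR R) R mu n.
have mt : measurable_fun [set: n.-tuple (measurableTypeR R)]
    (fun t : n.-tuple (measurableTypeR R) => \col_i tnth t i : 'cV[R]_n).
  apply: measurable_cVP => i; under [X in measurable_fun _ X]eq_fun do rewrite mxE.
  exact: measurable_tnth.
have [|t|m' m'E] := @sigma_finite_pushforward_can _ _ _ _ R m _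
  (fun x : 'cV[R]_n => [tuple x i ord0 | i < n] : n.-tuple (measurableTypeR R)) mt.
- apply/measurable_fun_tnthP => i.
  rewrite [X in measurable_fun _ X](_ : _ = fun x : 'cV[R]_n => x i ord0).
    exact: measurable_coord.
  by apply/funext => x /=; rewrite tnth_mktuple.
- by apply: eq_from_tnth => i; rewrite tnth_mktuple mxE.
- by exists m'; rewrite m'E /lebesgue_cV mE.
Qed.

Definition lam n : {sigma_finite_measure set 'cV[R]_n -> \bar R} :=
  projT1 (cid (lebesgue_cV_bundle n)).

Lemma lamE n : (lam n : set 'cV[R]_n -> \bar R) = lebesgue_cV.
Proof. exact: projT2 (cid (lebesgue_cV_bundle n)). Qed.

(** Built as a block column so that block matrices act on it directly ([block_cons]). *)
Definition cons_cV n (x : R) (y : 'cV[R]_n) : 'cV[R]_n.+1 := col_mx (x%:M : 'M[R]_1) y.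

Lemma cons_cVE n (x : R) (y : 'cV[R]_n) :
  cons_cV x y = \col_i (if unlift ord0 i is Some j then y j ord0 else x).
Proof.
apply/matrixP => i k; rewrite !ord1 mxE /cons_cV.
case: unliftP => [j ->|->].
  have -> : lift ord0 j = rshift 1 j by exact/val_inj.
  exact: (col_mxEd (x%:M : 'M[R]_1) y j ord0).
have {1}-> : ord0 = lshift n (ord0 : 'I_1) by exact/val_inj.
by apply: (etrans (col_mxEu (x%:M : 'M[R]_1) y ord0 ord0)); rewrite mxE eqxx mulr1n.
Qed.

Lemma measurable_cons_cV d (U : measurableType d) n (f : U -> R) (g : U -> 'cV[R]_n) :
  measurable_fun [set: U] f -> measurable_fun [set: U] g ->
  measurable_fun [set: U] (fun u => cons_cV (f u) (g u)).
Proof.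
move=> mf mg; apply: measurable_cVP => i.
under [X in measurable_fun _ X]eq_fun do rewrite cons_cVE mxE.
by case: unliftP => [j|] _ //; exact: measurable_cV_coord.
Qed.

(** Tonelli along the recursion of [power_measure]; every induction on the dimension goes through
    this splitting of the first coordinate. *)
Lemma ge0_integral_lam_recl n (f : 'cV[R]_n.+1 -> \bar R) :
  measurable_fun [set: 'cV[R]_n.+1] f -> (forall x, 0 <= f x)%E ->
  (\int[lam n.+1]_z f z = \int[mu]_x \int[lam n]_y f (cons_cV x y))%E.
Proof.
move=> mf f0; rewrite !lamE /lebesgue_cV.
have [m mE] := @power_measure_bundle _ (measurableTypeR R) R mu n.
have [m' m'E] := @power_measure_bundle _ (measurableTypeR R) R mu n.+1.
have mt k : measurable_fun [set: k.-tuple (measurableTypeR R)]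
    (fun t : k.-tuple (measurableTypeR R) => \col_i tnth t i : 'cV[R]_k).
  apply: measurable_cVP => i; under [X in measurable_fun _ X]eq_fun do rewrite mxE.
  exact: measurable_tnth.
rewrite -m'E (ge0_integral_pushforwardT (mt _))//= m'E /= -mE.
rewrite (ge0_integral_pushforwardT (@measurable_tuple_cons _ _ _))//; last first.
  by apply: measurableT_comp => //; exact: mt.
rewrite fubini_tonelli1//=; last first.
  exact: (measurableT_comp mf (measurableT_comp (mt _) (@measurable_tuple_cons _ _ _))).
apply: eq_integral => x _; rewrite /fubini_F/=.
rewrite (ge0_integral_pushforwardT (mt _))//; last first.
  apply: measurableT_comp => //.
  by apply: measurable_cons_cV => //.
apply: eq_integral => t _ /=; congr f.
apply/matrixP => i k; rewrite cons_cVE !mxE.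
by case: unliftP => [j ->|->]; rewrite ?mxE ?tnthS.
Qed.

Lemma integral_lam0 (f : 'cV[R]_0 -> \bar R) :
  measurable_fun [set: 'cV[R]_0] f -> (forall x, 0 <= f x)%E ->
  (\int[lam 0]_z f z = f 0%R)%E.
Proof.
move=> mf f0; rewrite lamE /lebesgue_cV /=.
have mc : measurable_fun [set: 0.-tuple (measurableTypeR R)]
    (fun t : 0.-tuple (measurableTypeR R) => \col_i tnth t i : 'cV[R]_0).
  by apply: measurable_cVP => -[].
rewrite (ge0_integral_pushforwardT mc)//.
rewrite integral_dirac// ?diracT ?mul1e; last exact: measurableT_comp.
by congr f; apply/matrixP => -[].
Qed.

End lebesgue_cV_theory.

(** * Linear change of variables *)

Section linear_change.
Context {R : realType}.
Local Notation mu := (@lebesgue_measure R).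

Lemma cons_cV_eta n (v : 'cV[R]_n.+1) :
  v = cons_cV (v ord0 ord0) (\col_j v (lift ord0 j) ord0).
Proof.
apply/matrixP => i k; rewrite ord1 cons_cVE mxE.
by case: unliftP => [j ->|->]; rewrite ?mxE.
Qed.

Lemma cons_cVD n (a b : R) (u v : 'cV[R]_n) :
  cons_cV a u + cons_cV b v = cons_cV (a + b) (u + v).
Proof.
apply/matrixP => i k; rewrite !cons_cVE !mxE.
by case: unliftP => [j _|_]; rewrite ?mxE.
Qed.

Lemma measurable_fun_cons_cV n (f : 'cV[R]_n.+1 -> \bar R) :
  measurable_fun setT f ->
  measurable_fun [set: measurableTypeR R * 'cV[R]_n] (fun p => f (cons_cV p.1 p.2)).
Proof. by move=> mf; apply: measurableT_comp => //; exact: measurable_cons_cV. Qed.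

Lemma measurable_fun_cons_cVr n (f : 'cV[R]_n.+1 -> \bar R) (x : R) :
  measurable_fun setT f ->
  measurable_fun [set: 'cV[R]_n] (fun y => f (cons_cV x y)).
Proof.
move=> mf; apply: (@measurableT_comp _ _ _ _ _ _ f _ (fun y => cons_cV x y)) => //.
exact: measurable_cons_cV.
Qed.

Lemma measurable_fun_cons_cVl n (f : 'cV[R]_n.+1 -> \bar R) (y : 'cV[R]_n) :
  measurable_fun setT f ->
  measurable_fun [set: measurableTypeR R] (fun x => f (cons_cV x y)).
Proof.
move=> mf; apply: (@measurableT_comp _ _ _ _ _ _ f _ (fun x => cons_cV x y)) => //.
exact: measurable_cons_cV.
Qed.

Lemma measurable_fun_mulmx n (f : 'cV[R]_n -> \bar R) (B : 'M[R]_n) :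
  measurable_fun setT f -> measurable_fun [set: 'cV[R]_n] (fun x => f (B *m x)).
Proof.
move=> mf; apply: (@measurableT_comp _ _ _ _ _ _ f _ (fun x => B *m x)) => //.
exact: measurable_mulmx_cV.
Qed.

Lemma measurable_section_lam n (f : 'cV[R]_n.+1 -> \bar R) :
  measurable_fun setT f -> (forall x, 0 <= f x)%E ->
  measurable_fun [set: measurableTypeR R] (fun x => \int[lam n]_y f (cons_cV x y))%E.
Proof.
move=> mf f0.
by apply: (measurable_fun_fubini_tonelli_F (fun p : measurableTypeR R * 'cV[R]_n =>
  f (cons_cV p.1 p.2))) => //; exact: measurable_fun_cons_cV.
Qed.

Lemma ge0_integral_lam_shift n (v : 'cV[R]_n) (f : 'cV[R]_n -> \bar R) :
  measurable_fun setT f -> (forall x, 0 <= f x)%E ->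
  (\int[lam n]_x f (x + v)%R = \int[lam n]_x f x)%E.
Proof.
elim: n v f => [|n IH] v f mf f0.
  by apply: eq_integral => x _; congr f; apply/matrixP => -[].
have mfv : measurable_fun setT (fun x : 'cV[R]_n.+1 => f (x + v)).
  by apply: measurableT_comp => //; exact: measurable_cVD.
rewrite !ge0_integral_lam_recl// (cons_cV_eta v).
set a := v ord0 ord0; set w := \col_j _.
pose g x := (\int[lam n]_y f (cons_cV x y))%E.
transitivity (\int[mu]_x g (x + a)%R)%E.
  apply: eq_integral => x _; rewrite /g -(IH w (fun y => f (cons_cV ((x : R) + a) y)))//; last first.
    exact: (measurable_fun_cons_cVr _ mf).
  by apply: eq_integral => y _; rewrite cons_cVD.
apply: ge0_integral_shift; first exact: measurable_section_lam.
by move=> x; exact: integral_ge0.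
Qed.

(** A predicate on matrices, so that it can be propagated through a factorization: products, two
    kinds of shears and block diagonal factors suffice. *)
Definition change_of_variable n (B : 'M[R]_n) :=
  forall f : 'cV[R]_n -> \bar R, measurable_fun setT f -> (forall x, 0 <= f x)%E ->
  (`|\det B|%:E * \int[lam n]_x f (B *m x) = \int[lam n]_x f x)%E.

Lemma change_of_variableM n (B C : 'M[R]_n) :
  change_of_variable B -> change_of_variable C -> change_of_variable (B *m C).
Proof.
move=> hB hC f mf f0; rewrite -(hB f)// -(hC (fun x => f (B *m x)))//.
  by rewrite det_mulmx normrM EFinM muleA; under eq_integral do rewrite -mulmxA.
exact: (measurable_fun_mulmx _ mf).
Qed.

Lemma block_cons n (a : R) (b : 'rV[R]_n) (c : 'cV[R]_n) (B : 'M[R]_n) x y :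
  block_mx (a%:M : 'M[R]_1) b c B *m cons_cV x y =
  cons_cV (a * x + (b *m y) ord0 ord0) (x *: c + B *m y).
Proof.
rewrite /cons_cV mul_block_col; congr col_mx.
  by rewrite -scalar_mxM [b *m y]mx11_scalar -raddfD /= [in RHS]mxE.
by rewrite mul_mx_scalar.
Qed.

(** For a fixed first coordinate x, the other coordinates undergo the translation by [x *: c]. *)
Lemma change_of_variable_lower n (c : 'cV[R]_n) :
  change_of_variable (block_mx (1%:M : 'M[R]_1) 0 c 1%:M : 'M[R]_n.+1).
Proof.
move=> f mf f0; rewrite (@det_lblock _ 1 n) !det1 mulr1 normr1 mul1e.
rewrite !ge0_integral_lam_recl//; last first.
  exact: (measurable_fun_mulmx _ mf).
apply: eq_integral => x _.
rewrite -(@ge0_integral_lam_shift _ ((x : R) *: c) (fun y => f (cons_cV (x : R) y)))//; last first.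
  exact: (measurable_fun_cons_cVr _ mf).
apply: eq_integral => y _.
by rewrite block_cons mul0mx mxE addr0 mul1r mul1mx addrC.
Qed.

(** Now the first coordinate is translated by an amount depending on the others, so Tonelli first
    moves its integral inside. *)
Lemma change_of_variable_upper n (b : 'rV[R]_n) :
  change_of_variable (block_mx (1%:M : 'M[R]_1) b 0 1%:M : 'M[R]_n.+1).
Proof.
move=> f mf f0; rewrite (@det_ublock _ 1 n) !det1 mulr1 normr1 mul1e.
have mfB : measurable_fun setT (fun x : 'cV[R]_n.+1 => f ((block_mx (1%:M : 'M[R]_1) b 0 1%:M : 'M[R]_n.+1) *m x)).
  exact: (measurable_fun_mulmx _ mf).
rewrite !ge0_integral_lam_recl//.
rewrite tonelli//; last exact: (measurable_fun_cons_cV mfB).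
rewrite [RHS]tonelli//; last exact: (measurable_fun_cons_cV mf).
apply: eq_integral => y _ /=.
rewrite -(ge0_integral_shift ((b *m y) ord0 ord0) (f := fun x => f (cons_cV x y)))//; last first.
  exact: (measurable_fun_cons_cVl _ mf).
by apply: eq_integral => x _; rewrite block_cons scaler0 add0r mul1mx mul1r.
Qed.

Lemma change_of_variable_diag n (a : R) (B : 'M[R]_n) : a != 0 ->
  change_of_variable B -> change_of_variable (block_mx (a%:M : 'M[R]_1) 0 0 B : 'M[R]_n.+1).
Proof.
move=> a0 hB f mf f0; rewrite (@det_ublock _ 1 n) det_scalar1 normrM EFinM -muleA.
rewrite !ge0_integral_lam_recl//; last first.
  exact: (measurable_fun_mulmx _ mf).
rewrite -(@ge0_integral_affine R a 0 (fun x => \int[lam n]_y f (cons_cV x y))%E)//;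
  [|exact: measurable_section_lam|by move=> x; exact: integral_ge0].
congr (_ * _)%E; rewrite -ge0_integralZl_EFin//; last 2 first.
- by move=> x _; exact: integral_ge0.
- apply: (@measurable_section_lam n (fun x : 'cV[R]_n.+1 => f ((block_mx (a%:M : 'M[R]_1) 0 0 B : 'M[R]_n.+1) *m x)))=> //.
  exact: (measurable_fun_mulmx _ mf).
apply: eq_integral => x _; rewrite -[RHS]hB//; last first.
  exact: (measurable_fun_cons_cVr _ mf).
congr (_ * _)%E; apply: eq_integral => y _.
by rewrite block_cons mul0mx mxE scaler0 add0r.
Qed.

Lemma block_upper_entry n (e : 'rV[R]_n) (j : 'I_n) :
  (block_mx (1%:M : 'M[R]_1) e 0 1%:M : 'M[R]_n.+1) ord0 (lift ord0 j) = e ord0 j.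
Proof.
transitivity ((block_mx (1%:M : 'M[R]_1) e 0 1%:M : 'M[R]_(1 + n))
  (lshift n ord0) (rshift 1 j)); last exact: block_mxEur.
by congr (fun_of_matrix _ _ _); exact/val_inj.
Qed.

(* A matrix with nonzero corner entry is a lower shear times a block diagonal
   matrix times an upper shear, and one upper shear makes the corner nonzero. *)
Lemma ge0_integral_lam_mulmx n (B : 'M[R]_n) : B \in unitmx -> change_of_variable B.
Proof.
elim: n B => [|n IH] B; first by move=> _ f mf f0; rewrite det_mx00 normr1 mul1e;
  apply: eq_integral => x _; congr f; apply/matrixP => -[].
wlog B00 : B / B ord0 ord0 != 0.
  move=> H uB; have [B0|] := eqVneq (B ord0 ord0) 0; last by move/H; exact.
  have [i Bi0] : exists i, B i ord0 != 0.
    apply/existsP; rewrite -negb_forall; apply: contraL uB => /forallP Bi.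
    rewrite unitmxE (expand_det_col B ord0) big1 ?unitr0// => i _.
    by move/eqP : (Bi i) => ->; rewrite mul0r.
  case: (unliftP ord0 i) => [j ij|i0]; last by rewrite i0 B0 eqxx in Bi0.
  pose U b : 'M[R]_n.+1 := block_mx (1%:M : 'M[R]_1) b 0 (1%:M : 'M[R]_n).
  pose e : 'rV[R]_n := delta_mx ord0 j.
  have UU : U (- e) *m U e = 1%:M.
    rewrite /U (@mulmx_block _ 1 n 1 n 1 n) !mul1mx !mulmx1 !mul0mx !mulmx0 !addr0 !add0r.
    by rewrite subrr -scalar_mx_block.
  (* Left multiplication by [U e] adds row [i] to the first row, which replaces the zero corner by
     [B i ord0]. *)
  rewrite -[B]mul1mx -UU -mulmxA; apply: change_of_variableM.
    exact: change_of_variable_upper.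
  apply: H; last first.
    rewrite unitmx_mul uB andbT unitmxE /U (@det_ublock _ 1 n) !det1 mulr1.
    exact: unitr1.
  rewrite mxE big_ord_recl B0 mulr0 add0r (bigD1 j)//= big1 ?addr0.
    by rewrite block_upper_entry mxE !eqxx mul1r -ij.
  by move=> k kj; rewrite block_upper_entry mxE (negbTE kj) andbF mul0r.
move=> uB.
set a := B ord0 ord0 in B00.
pose b : 'rV[R]_n := ursubmx (B : 'M[R]_(1 + n)).
pose c : 'cV[R]_n := dlsubmx (B : 'M[R]_(1 + n)).
pose B' : 'M[R]_n := drsubmx (B : 'M[R]_(1 + n)).
(* Gaussian elimination; the lower diagonal block is the Schur complement of the corner [a]. *)
have BE : B = (block_mx (1%:M : 'M[R]_1) 0 (a^-1 *: c) 1%:M : 'M[R]_n.+1) *m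
    ((block_mx (a%:M : 'M[R]_1) 0 0 (B' - a^-1 *: (c *m b)) : 'M[R]_n.+1) *m
    (block_mx (1%:M : 'M[R]_1) (a^-1 *: b) 0 1%:M : 'M[R]_n.+1)).
  rewrite !(@mulmx_block _ 1 n 1 n 1 n) !mul1mx !mulmx1 !mul0mx !mulmx0 !addr0 !add0r.
  rewrite -[LHS](@submxK _ 1 n 1 n) -/b -/c -/B'.
  have -> : ulsubmx (B : 'M[R]_(1 + n)) = a%:M.
    apply/matrixP => i j; rewrite !ord1 !mxE eqxx mulr1n.
    by congr (fun_of_matrix B _ _); exact/val_inj.
  rewrite mul_scalar_mx mul_mx_scalar !scalerA divff// !scale1r.
  by rewrite -scalemxAl addrC subrK.
rewrite BE; apply: change_of_variableM; first exact: change_of_variable_lower.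
apply: change_of_variableM; last exact: change_of_variable_upper.
apply: change_of_variable_diag => //; apply: IH.
move: uB; rewrite BE !unitmx_mul => /and3P[_ + _].
by rewrite !unitmxE (@det_ublock _ 1 n) unitrM => /andP[].
Qed.

End linear_change.

(** * Volumes of cubes and ellipsoids *)

Section measurable_comparison_sets.
Context {R : realType} d (U : measurableType d).
Implicit Types f g : U -> R.

Lemma measurable_set_bool (b : U -> bool) :
  measurable_fun [set: U] b -> measurable [set u | b u].
Proof.
move=> mb; have -> : [set u | b u] = b @^-1` [set true].
  by apply/seteqP; split => u /=; case: (b u).
by rewrite -[X in measurable X]setTI; exact: mb.
Qed.

Lemma measurable_set_le f g : measurable_fun [set: U] f ->
  measurable_fun [set: U] g -> measurable [set u | f u <= g u].
Proof. by move=> mf mg; apply: measurable_set_bool; exact: measurable_fun_ler. Qed.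

Lemma measurable_set_lt f g : measurable_fun [set: U] f ->
  measurable_fun [set: U] g -> measurable [set u | f u < g u].
Proof. by move=> mf mg; apply: measurable_set_bool; exact: measurable_fun_ltr. Qed.

Lemma measurable_indicE (S : set U) : measurable S ->
  measurable_fun [set: U] (fun u => (\1_S u : R)%:E).
Proof. by move=> mS; apply/measurable_EFinP; exact: measurable_indic. Qed.

Lemma measurable_prodR (I : Type) (s : seq I) (h : I -> U -> R) :
  (forall i, measurable_fun [set: U] (h i)) ->
  measurable_fun [set: U] (fun u => \prod_(i <- s) h i u).
Proof.
move=> mh; elim: s => [|i s IH].
  by under [X in measurable_fun _ X]eq_fun do rewrite big_nil; exact: measurable_cst.
under [X in measurable_fun _ X]eq_fun do rewrite big_cons.
exact: measurable_funM.
Qed.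

End measurable_comparison_sets.

Section volume.
Context {R : realType}.
Local Notation mu := (@lebesgue_measure R).

Lemma lam_indic n (S : set 'cV[R]_n) : measurable S ->
  (lam n S = \int[lam n]_x (\1_S x : R)%:E)%E.
Proof. by move=> mS; rewrite integral_indic// setIT. Qed.

Lemma ge0_integral_lam_prod n (h : R -> R) : measurable_fun [set: R] h ->
  (forall x, 0 <= h x) ->
  (\int[lam n]_x (\prod_i h (x i ord0))%:E = (\int[mu]_t (h t)%:E) ^+ n)%E.
Proof.
move=> mh h0.
have mhE : measurable_fun [set: R] (fun t => (h t)%:E) by exact/measurable_EFinP.
have mH k : measurable_fun [set: 'cV[R]_k] (fun x : 'cV[R]_k => (\prod_i h (x i ord0))%:E).
  apply/measurable_EFinP; apply: measurable_prodR => i.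
  by apply: measurableT_comp => //; exact: measurable_coord.
have H0 k (x : 'cV[R]_k) : (0 <= (\prod_i h (x i ord0))%:E)%E.
  by rewrite lee_fin; apply: prodr_ge0.
elim: n => [|n IH]; first by rewrite integral_lam0// big_ord0.
rewrite ge0_integral_lam_recl// expeS -IH.
rewrite -ge0_integralZr//; last 2 first.
- by move=> x _; rewrite lee_fin.
- by apply: integral_ge0.
apply: eq_integral => x _; rewrite -ge0_integralZl_EFin//; last exact: mH.
apply: eq_integral => y _; rewrite big_ord_recl -EFinM.
congr (_ * _)%:E; first by rewrite cons_cVE mxE unlift_none.
by apply: eq_bigr => i _; rewrite cons_cVE mxE liftK.
Qed.

Definition cube n (s t : R) : set 'cV[R]_n := [set x | forall j, s <= x j ord0 < t].

Lemma measurable_cube n s t : measurable (@cube n s t).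
Proof.
rewrite (_ : cube _ _ = \bigcap_(j : 'I_n) ((fun x : 'cV[R]_n => x j ord0) @^-1` `[s, t[)).
  apply: fin_bigcap_measurable => // j _; rewrite -[X in measurable X]setTI.
  exact: measurable_coord.
apply/seteqP; split => x /=; first by move=> h j _ /=; rewrite in_itv/=.
by move=> h j; have := h j Logic.I; rewrite /= in_itv/=.
Qed.

Lemma lam_cube n s t : s <= t -> (lam n (cube s t) = ((t - s) ^+ n)%:E)%E.
Proof.
move=> st; rewrite lam_indic; last exact: measurable_cube.
transitivity (\int[lam n]_x (\prod_i \1_(`[s, t[%classic : set R) (x i ord0) : R)%:E)%E.
  apply: eq_integral => x _; congr EFin; rewrite indicE.
  have [xc|xc] := boolP (x \in _).
    rewrite big1// => i _; rewrite indicE mem_set//= in_itv/=.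
    by move: xc; rewrite inE; exact.
  apply/esym/eqP; apply: contraNT xc => /prodf_neq0 h; rewrite inE => i.
  have := h i isT; rewrite indicE; case: (boolP (_ \in _)); rewrite ?eqxx//.
  by rewrite inE/= in_itv.
rewrite (@ge0_integral_lam_prod _ (\1_(`[s, t[%classic : set R)))//.
rewrite EFin_expe; congr (_ ^+ n)%E.
transitivity (mu (`[s, t[%classic : set R)); first by rewrite integral_indic// setIT.
rewrite lebesgue_measure_itv/= lte_fin.
by move: st; rewrite le_eqVlt => /orP[/eqP ->|->]//; rewrite ltxx subrr.
Qed.

Lemma lam_mulmx_preimage n (B : 'M[R]_n) (S : set 'cV[R]_n) : B \in unitmx ->
  measurable S -> (`|\det B|%:E * lam n [set x | S (B *m x)] = lam n S)%E.
Proof.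
move=> uB mS.
rewrite [in RHS]lam_indic// -(ge0_integral_lam_mulmx uB)//; last exact: measurable_indicE.
congr (_ * _)%E; rewrite lam_indic//.
rewrite -[X in measurable X]setTI; exact: (measurable_mulmx_cV B (@measurable_id _ _ _)).
Qed.

Lemma lam_shift_preimage n (v : 'cV[R]_n) (S : set 'cV[R]_n) :
  measurable S -> lam n [set x | S (x + v)] = lam n S.
Proof.
move=> mS.
rewrite [in RHS]lam_indic// -(ge0_integral_lam_shift v)//; last exact: measurable_indicE.
rewrite lam_indic// -[X in measurable X]setTI.
exact: (measurable_cVD (@measurable_id _ _ _) (measurable_cst _)).
Qed.

End volume.

Lemma eq_indic (R : realType) (U V : Type) (S : set U) (S' : set V) u v :
  (S u <-> S' v) -> \1_S u = \1_S' v :> R.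
Proof.
move=> h; rewrite !indicE; congr (_%:R).
by have -> : (u \in S) = (v \in S') by apply/idP/idP; rewrite !inE => /h.
Qed.

Section ball_volume.
Context {R : realType}.
Local Notation mu := (@lebesgue_measure R).

Lemma dotZ n (c : R) (x : 'cV[R]_n) : dot (c *: x) (c *: x) = c ^+ 2 * dot x x.
Proof.
by rewrite /dot mulr_sumr; apply: eq_bigr => i _; rewrite !mxE; ring.
Qed.

Lemma dot_ge0 n (x : 'cV[R]_n) : 0 <= dot x x.
Proof. by apply: sumr_ge0 => i _; rewrite -expr2 sqr_ge0. Qed.

Lemma enorm_le n (x : 'cV[R]_n) s : 0 <= s -> (enorm x <= s) = (dot x x <= s ^+ 2).
Proof.
by move=> s0; rewrite /enorm -[X in _ <= X](ger0_norm s0) -sqrtr_sqr ler_sqrt// sqr_ge0.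
Qed.

Definition unit_ball n : set 'cV[R]_n := [set x | dot x x <= 1].

Lemma measurable_unit_ball n : measurable (@unit_ball n).
Proof. by apply: measurable_set_le => //; exact: measurable_dot. Qed.

Definition kappa n : R := fine (lam n (@unit_ball n)).

Lemma kappaE n : lam n (@unit_ball n) = (kappa n)%:E.
Proof.
rewrite fineK// ge0_fin_numE//.
(* The cube is half-open and a coordinate may equal 1, hence an upper end beyond 1. *)
have sub : unit_ball (n := n) `<=` cube (-1) 2.
  move=> x /= x1 j; have : x j ord0 ^+ 2 <= 1.
    apply: le_trans x1; rewrite /dot (bigD1 j)//= -expr2 lerDl.
    by apply: sumr_ge0 => i _; rewrite -expr2 sqr_ge0.
  by move=> ?; apply/andP; split; nra.
apply: (@le_lt_trans _ _ (lam n (cube (-1) 2))).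
  by apply: le_measure => //; rewrite inE;
    [exact: measurable_unit_ball|exact: measurable_cube].
by rewrite lam_cube ?ltry//; lra.
Qed.

Lemma kappa_ge0 n : 0 <= kappa n.
Proof. by rewrite fine_ge0. Qed.

Lemma measurable_enorm_le n (B : 'M[R]_n) s :
  measurable [set x : 'cV[R]_n | enorm (B *m x) <= s].
Proof.
apply: measurable_set_le => //; apply: measurable_enorm.
exact: measurable_mulmx_cV.
Qed.

(** The ellipsoid is the preimage of the unit ball under [s^-1 *: B]. *)
Lemma lam_ellipsoid n (B : 'M[R]_n) s : B \in unitmx -> 0 < s ->
  lam n [set x | enorm (B *m x) <= s] = (`|\det B|^-1 * kappa n * s ^+ n)%:E.
Proof.
move=> uB s0.
have dB : 0 < `|\det B| by rewrite normr_gt0 -unitfE -unitmxE.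
have uC : (s^-1 *: B) \in unitmx.
  by rewrite unitmxZ// unitfE invr_eq0 gt_eqF.
have := lam_mulmx_preimage uC (@measurable_unit_ball n).
rewrite kappaE detZ normrM normrX ger0_norm ?invr_ge0 ?ltW//.
have -> : [set x | @unit_ball n ((s^-1 *: B) *m x)] = [set x | enorm (B *m x) <= s].
  have E x : (dot ((s^-1 *: B) *m x) ((s^-1 *: B) *m x) <= 1) = (enorm (B *m x) <= s).
    rewrite (enorm_le _ (ltW s0)) -scalemxAl dotZ.
    by rewrite exprVn ler_pdivrMl ?exprn_gt0// mulr1.
  by apply/seteqP; split => x /=; rewrite /unit_ball/= E.
move=> h.
have : lam n [set x | enorm (B *m x) <= s] \is a fin_num.
  rewrite ge0_fin_numE// ltey; apply/eqP => hy; move: h; rewrite hy.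
  by rewrite gt0_muley// lte_fin mulr_gt0// exprn_gt0// invr_gt0.
move: h; set v := lam n _ => h vf; move: h; rewrite -(fineK vf) -EFinM => -[h].
congr EFin; rewrite -h exprVn.
have : s ^+ n != 0 by rewrite expf_neq0// gt_eqF.
move: (s ^+ n) => y y0; field.
by rewrite y0 gt_eqF.
Qed.

(** The integrand is exp(-s) times the standard exponential density translated by [s], whose
    integral is 1. *)
Lemma integral_expRN_ge (s : R) :
  (\int[mu]_t ((expR (- t))%:E * (\1_[set t : R | s <= t] t : R)%:E) = (expR (- s))%:E)%E.
Proof.
have mp : measurable_fun [set: R] (fun x => (exponential_pdf 1 x)%:E).
  by apply/measurable_EFinP; exact: measurable_exponential_pdf.
have p0 (x : R) : (0 <= (exponential_pdf 1 x)%:E)%E by rewrite lee_fin exponential_pdf_ge0.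
transitivity (\int[mu]_t ((expR (- s))%:E * (exponential_pdf 1 (t - s))%:E))%E.
  apply: eq_integral => t _; rewrite indicE /exponential_pdf patchE.
  have -> : (t \in [set t | s <= t]) = (t - s \in `[(0 : R), +oo[%classic).
    by apply/idP/idP; rewrite !inE/= in_itv/= andbT subr_ge0.
  case: ifP => _; rewrite ?mule0// mule1 -EFinM; congr EFin.
  by rewrite mul1r -expRD; congr expR; ring.
rewrite ge0_integralZl_EFin ?expR_ge0//; last first.
  apply: (measurableT_comp mp); exact: measurable_funB.
by rewrite (ge0_integral_shift (- s) mp)// integral_exponential_pdf// mule1.
Qed.

(** The Gaussian integral computed twice. As a product of one-dimensional integrals it is pi^(n/2).
    Writing exp(-|x|^2) as the integral of exp(-t) over t >= |x|^2 and exchanging the integrals, it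
    is the integral of exp(-t) times the volume of the ball of radius sqrt(t), that is [kappa n]
    t^(n/2). *)
Lemma kappa_Gamma n : kappa n * Gamma (n%:R / 2 + 1) = pi `^ (n%:R / 2).
Proof.
have E1 : (\int[@lam R n]_x (\prod_i gauss_fun (x i ord0))%:E = (pi `^ (n%:R / 2))%:E)%E.
  apply: (etrans (ge0_integral_lam_prod n (@measurable_gauss_fun R) (@gauss_fun_ge0 R))).
  rewrite integralT_gauss -EFin_expe; congr EFin.
  by rewrite mulrC powRrM powR12_sqrt ?pi_ge0// powR_mulrn// sqrtr_ge0.
have mE : measurable_fun [set: R] (fun t => (expR (- t))%:E).
  by apply/measurable_EFinP; apply: measurableT_comp.
have ms : measurable_fun [set: 'cV[R]_n * measurableTypeR R]
    (fun p => ((expR (- p.2))%:E * (\1_[set t : R | dot p.1 p.1 <= t] p.2 : R)%:E)%E).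
  apply: emeasurable_funM; first exact: (measurableT_comp mE).
  rewrite [X in measurable_fun _ X](_ : _ = fun p => (\1_[set p : 'cV[R]_n * measurableTypeR R | dot p.1 p.1 <= p.2] p : R)%:E).
    apply: measurable_indicE; apply: measurable_set_le => //.
    by apply: measurable_dot.
  by apply/funext => p; congr EFin; exact: eq_indic.
pose L t := lam n [set x : 'cV[R]_n | dot x x <= t].
have E0 (t : R) : (\int[@lam R n]_x ((expR (- t))%:E * (\1_[set t : R | dot x x <= t] t : R)%:E) =
    (expR (- t))%:E * L t)%E.
  rewrite ge0_integralZl_EFin ?expR_ge0//; last first.
    rewrite [X in measurable_fun _ X](_ : _ = fun x : 'cV[R]_n => (\1_[set x : 'cV[R]_n | dot x x <= t] x : R)%:E).
      by apply: measurable_indicE; apply: measurable_set_le => //; exact: measurable_dot.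
    by apply/funext => p; congr EFin; exact: eq_indic.
  congr (_ * _)%E.
  rewrite /L lam_indic; last by apply: measurable_set_le => //; exact: measurable_dot.
  by apply: eq_integral => x _; congr EFin; exact: eq_indic.
have mg : measurable_fun [set: measurableTypeR R] (fun t => (expR (- t))%:E * L t)%E.
  under [X in measurable_fun _ X]eq_fun do rewrite -E0.
  apply: (measurable_fun_fubini_tonelli_G (fun p : 'cV[R]_n * measurableTypeR R =>
      ((expR (- p.2))%:E * (\1_[set t : R | (dot p.1 p.1 <= t)%R] p.2 : R)%:E)%E)) => // p; rewrite mule_ge0// lee_fin ?expR_ge0.
have E2 : (\int[@lam R n]_x (\prod_i gauss_fun (x i ord0))%:E =
   \int[mu]_t ((expR (- t))%:E * L t))%E.
  transitivity (\int[@lam R n]_x \int[mu]_t ((expR (- t))%:E * (\1_[set t : R | (dot x x <= t)%R] t : R)%:E))%E.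
    apply: eq_integral => x _; rewrite integral_expRN_ge; congr EFin.
    rewrite /dot -sumrN expR_sum; apply: eq_bigr => i _.
    by rewrite /gauss_fun expr2.
  rewrite tonelli//.
  by apply: eq_integral => t _; rewrite E0.
have mpow : measurable_fun [set: R] (fun t : R => (t `^ (n%:R / 2 + 1 - 1) * expR (- t))%:E).
  apply/measurable_EFinP; apply: measurable_funM; first exact: measurable_powR.
  by apply: measurableT_comp.
have E3 : (\int[mu]_t ((expR (- t))%:E * L t) =
    (kappa n)%:E * \int[mu]_(t in `]0%R, +oo[) (t `^ (n%:R / 2 + 1 - 1) * expR (- t))%:E)%E.
  rewrite -(setUv `[(0:R), +oo[%classic) ge0_integral_setU//=; last 4 first.
  - exact: measurableC.
  - by rewrite setUv.
  - by move=> t _; rewrite mule_ge0// lee_fin expR_ge0.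
  - exact/disj_setPCl.
  rewrite [X in (_ + X)%E]integral0_eq ?adde0; last first.
    (* The ball of squared radius t < 0 is empty, so only positive t contribute. *)
    move=> t /=; rewrite in_itv/= andbT => /negP; rewrite -ltNge => t0.
    rewrite /L (_ : [set x | _] = set0) ?measure0 ?mule0//.
    rewrite -subset0 => x /= xt; have := le_lt_trans xt t0.
    by rewrite ltNge dot_ge0.
  rewrite -integral_itv_obnd_cbnd//; last exact: measurable_funTS.
  rewrite -ge0_integralZl_EFin ?kappa_ge0//; last 2 first.
  - by move=> t _; rewrite lee_fin mulr_ge0// ?powR_ge0 ?expR_ge0.
  - exact: measurable_funTS.
  apply: eq_integral => t; rewrite inE/= in_itv/= andbT => t0.
  have -> : L t = (kappa n * t `^ (n%:R / 2))%:E.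
    have -> : L t = lam n [set x : 'cV[R]_n | enorm (1%:M *m x) <= Num.sqrt t].
      rewrite /L; congr (lam n _); apply/seteqP; split => x /=;
        by rewrite mul1mx enorm_le ?sqrtr_ge0// sqr_sqrtr// ltW.
    rewrite lam_ellipsoid ?unitmx1 ?sqrtr_gt0// det1 normr1 invr1 mul1r.
    congr (_ * _)%:E.
    by rewrite mulrC powRrM powR12_sqrt ?ltW// powR_mulrn// sqrtr_ge0.
  by rewrite addrK -!EFinM; congr EFin; ring.
have pi0 : 0 < pi `^ (n%:R / 2) :> R by rewrite powR_gt0// pi_gt0.
have : ((pi `^ (n%:R / 2))%:E = (kappa n)%:E * \int[mu]_(t in `]0%R, +oo[) (t `^ (n%:R / 2 + 1 - 1) * expR (- t))%:E)%E.
  by rewrite -E1 E2 E3.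
rewrite /Gamma /Rintegral.
have : (0 <= \int[mu]_(t in `]0%R, +oo[) (t `^ (n%:R / 2 + 1 - 1) * expR (- t))%:E)%E.
  by apply: integral_ge0 => t _; rewrite lee_fin mulr_ge0// ?powR_ge0 ?expR_ge0.
(* [Gamma] is the finite part of an extended integral, so the value +oo has to be excluded: its
   product with [kappa n] would be 0 or +oo, never the positive real pi^(n/2). *)
case: integral => [v|_|//] /=; first by move=> _; rewrite -EFinM => -[].
have := kappa_ge0 n; rewrite le_eqVlt => /orP[/eqP <-|k0].
  by rewrite mul0e => -[h]; rewrite h ltxx in pi0.
by rewrite gt0_muley.
Qed.
End ball_volume.

(** * Integration over the unit cube and periodization *)

Lemma ge0_integral_mrestr d (T : measurableType d) (R : realType)
    (m : {measure set T -> \bar R}) (D : set T) (mD : measurable D)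
    (f : T -> \bar R) : measurable_fun [set: T] f -> (forall x, 0 <= f x)%E ->
  (\int[mrestr m mD]_x f x = \int[m]_(x in D) f x)%E.
Proof.
move=> mf f0; have mDC : measurable (~` D) by exact: measurableC.
have dD : [disjoint D & ~` D] by exact/disj_setPCl.
rewrite -(setUv D) (ge0_integral_setU _ mD mDC)//; last by rewrite setUv.
rewrite [X in (_ + X)%E](_ : _ = 0%E) ?adde0.
  by apply: eq_measure_integral => A mA AD; rewrite /= /mrestr setIidl.
rewrite (@eq_measure_integral _ _ _ (~` D) mzero) ?integral_measure_zero//.
move=> A mA AD; rewrite /mzero/= /mrestr (_ : A `&` D = set0) ?measure0//.
by rewrite -subset0 => x [/AD].
Qed.

Section torus.
Context {R : realType}.

Lemma nu_bundle n : exists m : {sigma_finite_measure set 'cV[R]_n -> \bar R},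
  (m : set 'cV[R]_n -> \bar R) = mrestr (lam n) (@measurable_cube R n 0 1).
Proof.
apply: sigma_finite_bundle; apply: fin_num_fun_sigma_finite; first by rewrite measure0.
move=> S mS; rewrite /= ge0_fin_numE//.
apply: (@le_lt_trans _ _ (lam n (cube 0 1))); last by rewrite lam_cube ?ltry.
by apply: le_measure => //; rewrite inE;
  [apply: measurableI => //; exact: measurable_cube|exact: measurable_cube].
Qed.

(** Lebesgue measure on the unit cube, that is the Haar probability measure of R^n / Z^n; in lattice
    coordinates it is the normalized measure of the fundamental domain. *)
Definition nu n : {sigma_finite_measure set 'cV[R]_n -> \bar R} :=
  projT1 (cid (nu_bundle n)).

Lemma nuE n : (nu n : set 'cV[R]_n -> \bar R) = mrestr (lam n) (@measurable_cube R n 0 1).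
Proof. exact: projT2 (cid (nu_bundle n)). Qed.

Lemma nu_setT n : nu n setT = 1%E.
Proof. by rewrite nuE /mrestr setTI lam_cube// subr0 expr1n. Qed.

Lemma integral_nu_cst n (z : \bar R) : (\int[nu n]_x z = z)%E.
Proof.
rewrite integral_cst// [X in (_ * X)%E](_ : _ = 1%E) ?mule1//.
exact: nu_setT.
Qed.

Lemma ge0_integral_nu n (f : 'cV[R]_n -> \bar R) :
  measurable_fun setT f -> (forall x, 0 <= f x)%E ->
  (\int[nu n]_x f x = \int[lam n]_x ((\1_(cube 0 1) x : R)%:E * f x))%E.
Proof.
move=> mf f0; rewrite nuE ge0_integral_mrestr// integral_mkcond.
by apply: eq_integral => x _; rewrite patchE indicE; case: ifP; rewrite ?mul1e ?mul0e.
Qed.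

Definition intv n (z : 'cV[int]_n) : 'cV[R]_n := map_mx intr z.

Definition floorv n (x : 'cV[R]_n) : 'cV[int]_n := \col_i Num.floor (x i ord0).

Lemma cube_floorv n (x : 'cV[R]_n) z : cube 0 1 (x - intv z) <-> z = floorv x.
Proof.
split=> [h|-> j].
  apply/matrixP => i k; rewrite ord1 mxE; apply/esym/floor_def.
  by have := h i; rewrite !mxE intrD => /andP[h1 h2]; apply/andP; split; lra.
have := floor_itv (x j ord0); rewrite !mxE intrD => /andP[h1 h2].
by apply/andP; split; lra.
Qed.

Lemma sum_indic_cube n (s : seq 'cV[int]_n) (x : 'cV[R]_n) : uniq s ->
  \sum_(z <- s) \1_(cube 0 1) (x - intv z) = (floorv x \in s)%:R :> R.
Proof.
move=> us; have E z : \1_(cube 0 1) (x - intv z) = (z == floorv x)%:R :> R.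
  by rewrite indicE; congr (_%:R); have -> : (x - intv z \in cube 0 1) = (z == floorv x)
    by apply/idP/eqP; rewrite inE => /cube_floorv.
under eq_bigr do rewrite E.
have [xs|xs] := boolP (_ \in _).
  rewrite (bigD1_seq (floorv x))//= eqxx big1 ?addr0// => z /negbTE ->//.
rewrite big_seq big1// => z zs; case: eqP => // zx; by rewrite -zx zs in xs.
Qed.

Lemma finite_int_box n (M : nat) :
  finite_set [set z : 'cV[int]_n | forall i, `|z i ord0| <= M%:Z].
Proof.
apply: (@sub_finite_set _ _ [set \col_i ((f i : nat)%:Z - M%:Z) | f in [set: {ffun 'I_n -> 'I_(M.*2.+1)}]]);
  last by apply: finite_image; exact: finite_finset.
move=> z /= zM; exists [ffun i => inord (absz (z i ord0 + M%:Z))] => //.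
apply/matrixP => i k; rewrite (ord1 k) mxE ffunE.
have := zM i; rewrite ler_norml => /andP[].
move: (z i ord0) => t; rewrite -{1}sub0r lerBlDr => z0 z2.
have [u tE] : exists u : nat, t + M%:Z = u%:Z by case: (t + M%:Z) z0 => // u _; exists u.
rewrite tE inordK/= -?tE ?addrK// ltnS -lez_nat -tE -addnn PoszD lerD2r//.
Qed.

(** Sums over Z^n are always replaced by sums over such a box, taken large enough to contain all
    nonzero terms. *)
Definition int_box n (M : nat) : seq 'cV[int]_n :=
  finmap.enum_fset (fset_set [set z : 'cV[int]_n | forall i, `|z i ord0| <= M%:Z]).

Lemma uniq_int_box n M : uniq (int_box n M).
Proof. exact: finmap.fset_uniq. Qed.

Lemma mem_int_box n M (z : 'cV[int]_n) :
  reflect (forall i, `|z i ord0| <= M%:Z) (z \in int_box n M).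
Proof.
have h : (z \in int_box n M) = (z \in [set z : 'cV[int]_n | forall i, `|z i ord0| <= M%:Z])
  := in_fset_set (finite_int_box n M) z.
by apply: (equivP idP); rewrite h inE.
Qed.

Lemma measurable_fun_shiftr n (f : 'cV[R]_n -> \bar R) (v : 'cV[R]_n) :
  measurable_fun setT f -> measurable_fun [set: 'cV[R]_n] (fun x => f (x + v)).
Proof.
move=> mf; apply: (@measurableT_comp _ _ _ _ _ _ f _ (fun x : 'cV[R]_n => x + v)) => //.
exact: measurable_cVD.
Qed.

(** Translating by [- intv z] turns the term of index [z] into an integral over the unit cube with
    corner [z]; the weight on the right counts the chosen cubes containing x. *)
Lemma tiling_sum n (s : seq 'cV[int]_n) (g : 'cV[R]_n -> \bar R) : uniq s ->
  measurable_fun setT g -> (forall x, 0 <= g x)%E ->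
  (\int[nu n]_a (\sum_(z <- s) g (a + intv z)%R) =
   \int[lam n]_x ((\sum_(z <- s) \1_(cube 0 1) (x - intv z)%R : R)%:E * g x))%E.
Proof.
move=> us mg g0.
have mgz z : measurable_fun setT (fun a : 'cV[R]_n => g (a + intv z)) by exact: measurable_fun_shiftr.
have mc : measurable_fun setT (fun x : 'cV[R]_n => (\1_(cube 0 1) x : R)%:E).
  by apply: measurable_indicE; exact: measurable_cube.
have mcz z : measurable_fun setT (fun x : 'cV[R]_n => (\1_(cube 0 1) (x - intv z) : R)%:E).
  exact: (measurable_fun_shiftr (- intv z) mc).
rewrite ge0_integral_sum//.
transitivity (\sum_(z <- s) \int[lam n]_x ((\1_(cube 0 1) (x - intv z) : R)%:E * g x))%E.
  apply: eq_bigr => z _; rewrite ge0_integral_nu//.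
  rewrite -(ge0_integral_lam_shift (- intv z))//; first last.
  - by move=> x; rewrite mule_ge0.
  - exact: emeasurable_funM.
  by apply: eq_integral => x _; rewrite subrK.
rewrite -ge0_integral_sum//; first last.
- by move=> z x _; rewrite mule_ge0// lee_fin.
- by move=> z; apply: emeasurable_funM.
apply: eq_integral => x _.
rewrite -ge0_sume_distrl; last by move=> z _; rewrite lee_fin.
by rewrite sumEFin.
Qed.

Lemma tiling n (s : seq 'cV[int]_n) (g : 'cV[R]_n -> \bar R) : uniq s ->
  measurable_fun setT g -> (forall x, 0 <= g x)%E ->
  (forall x, floorv x \notin s -> g x = 0)%E ->
  (\int[nu n]_a (\sum_(z <- s) g (a + intv z)%R) = \int[lam n]_x g x)%E.
Proof.
move=> us mg g0 gs; rewrite tiling_sum//; apply: eq_integral => x _.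
rewrite sum_indic_cube//; case: (boolP (_ \in _)) => [_|/gs ->].
  by rewrite mul1e.
by rewrite mule0.
Qed.

(** For arbitrary [g] the cubes of [s] cover only part of the support. The inequality is all that an
    upper bound needs. *)
Lemma tiling_le n (s : seq 'cV[int]_n) (g : 'cV[R]_n -> \bar R) : uniq s ->
  measurable_fun setT g -> (forall x, 0 <= g x)%E ->
  (\int[nu n]_a (\sum_(z <- s) g (a + intv z)%R) <= \int[lam n]_x g x)%E.
Proof.
move=> us mg g0; rewrite tiling_sum//.
have mc : measurable_fun setT (fun x : 'cV[R]_n => (\1_(cube 0 1) x : R)%:E).
  by apply: measurable_indicE; exact: measurable_cube.
apply: ge0_le_integral => //.
- by move=> x _; rewrite mule_ge0// lee_fin sumr_ge0.
- apply: emeasurable_funM => //.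
  apply/measurable_EFinP; apply: measurable_sumR => z.
  by apply/measurable_EFinP; exact: (measurable_fun_shiftr (- intv z) mc).
- move=> x _; rewrite sum_indic_cube//; case: (_ \in _); first by rewrite mul1e.
  by rewrite mul0e.
Qed.

Lemma ge0_le_integral_nu n (f g : 'cV[R]_n -> \bar R) :
  measurable_fun setT f -> measurable_fun setT g -> (forall x, 0 <= f x)%E ->
  (forall x, 0 <= g x)%E -> (forall x, cube 0 1 x -> f x <= g x)%E ->
  (\int[nu n]_x f x <= \int[nu n]_x g x)%E.
Proof.
move=> mf mg f0 g0 fg; rewrite !ge0_integral_nu//.
have mc : measurable_fun setT (fun x : 'cV[R]_n => (\1_(cube 0 1) x : R)%:E).
  by apply: measurable_indicE; exact: measurable_cube.
apply: ge0_le_integral => //.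
- by move=> x _; rewrite mule_ge0// lee_fin.
- exact: emeasurable_funM.
- exact: emeasurable_funM.
- move=> x _; rewrite indicE; case: (boolP (_ \in _)); last by rewrite !mul0e.
  by rewrite inE !mul1e => /fg.
Qed.

Lemma ge0_eq_integral_nu n (f g : 'cV[R]_n -> \bar R) :
  measurable_fun setT f -> measurable_fun setT g -> (forall x, 0 <= f x)%E ->
  (forall x, 0 <= g x)%E -> (forall x, cube 0 1 x -> f x = g x) ->
  (\int[nu n]_x f x = \int[nu n]_x g x)%E.
Proof.
move=> mf mg f0 g0 fg; apply/le_anti/andP; split;
  by apply: ge0_le_integral_nu => // x /fg ->.
Qed.

Lemma floorv_bound n (x : 'cV[R]_n) (M : nat) :
  (forall i, `|x i ord0| <= M%:R) -> floorv x \in int_box n M.+1.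
Proof.
move=> h; apply/mem_int_box => i; rewrite mxE.
have := h i; rewrite ler_norml => /andP[h1 h2].
have /andP[f1 f2] := floor_itv (x i ord0).
rewrite ler_norml; apply/andP; split.
  have : (- M.+1%:Z)%:~R < (Num.floor (x i ord0) + 1)%:~R :> R.
    by apply: le_lt_trans f2; rewrite mulrNz -pmulrn -natr1; lra.
  by rewrite ltr_int; lia.
have : (Num.floor (x i ord0))%:~R <= M%:Z%:~R :> R by rewrite -pmulrn; lra.
by rewrite ler_int; lia.
Qed.

Lemma exists_nat_bound n (x : 'cV[R]_n) : exists M : nat, forall i, `|x i ord0| <= M%:R.
Proof.
exists (\max_(i < n) Num.truncn `|x i ord0|).+1 => i.
apply: ltW; apply: (lt_le_trans (truncnS_gt _)).
by rewrite ler_nat ltnS leq_bigmax.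
Qed.

Definition periodic (T : Type) n (F : 'cV[R]_n -> T) :=
  forall x z, F (x + intv z) = F x.

(** Translation invariance on the torus. The left side is the integral of [F] over the cube
    translated by [b]; folding that cube back onto the unit cube, each point is met by exactly one
    integer translate, and [F] does not see the translation. *)
Lemma periodic_shift n (F : 'cV[R]_n -> \bar R) (b : 'cV[R]_n) :
  measurable_fun setT F -> (forall x, 0 <= F x)%E -> periodic F ->
  (\int[nu n]_a F (a + b)%R = \int[nu n]_a F a)%E.
Proof.
move=> mF F0 pF.
have mc : measurable_fun setT (fun x : 'cV[R]_n => (\1_(cube 0 1) x : R)%:E).
  by apply: measurable_indicE; exact: measurable_cube.
have mcb : measurable_fun setT (fun x : 'cV[R]_n => (\1_(cube 0 1) (x - b) : R)%:E).
  exact: (measurable_fun_shiftr (- b) mc).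
have mg : measurable_fun setT (fun x : 'cV[R]_n => ((\1_(cube 0 1) (x - b) : R)%:E * F x)%E).
  exact: emeasurable_funM.
have g0 (x : 'cV[R]_n) : (0 <= (\1_(cube 0 1) (x - b) : R)%:E * F x)%E.
  by rewrite mule_ge0// lee_fin.
have mFb : measurable_fun setT (fun x : 'cV[R]_n => F (x + b)) by exact: measurable_fun_shiftr.
have [M bM] := exists_nat_bound b.
rewrite [LHS]ge0_integral_nu//.
transitivity (\int[lam n]_x ((\1_(cube 0 1) (x - b) : R)%:E * F x))%E.
  rewrite -[RHS](ge0_integral_lam_shift b)//.
  by apply: eq_integral => x _; rewrite addrK.
(* [M] bounds the coordinates of [b]; the cube adds one unit and rounding down another one. *)
rewrite -(tiling (uniq_int_box n M.+2))//; last first.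
  move=> x; apply: contraNeq; rewrite indicE; case: (boolP (_ \in _)); last by rewrite mul0e eqxx.
  rewrite inE => xb _; apply: floorv_bound => i; have := xb i; have := bM i.
  rewrite !mxE !ler_norml -natr1 => /andP[b1 b2] /andP[x1 x2]; apply/andP; split; lra.
rewrite [RHS]ge0_integral_nu// ge0_integral_nu//; first last.
- by move=> x; apply: sume_ge0.
- by apply: emeasurable_sum => z; exact: (measurable_fun_shiftr _ mg).
apply: eq_integral => a _; rewrite indicE.
case: (boolP (_ \in _)); last by rewrite !mul0e.
rewrite inE => ac; rewrite !mul1e.
under eq_bigr do rewrite pF.
rewrite -ge0_sume_distrl; last by move=> z _; rewrite lee_fin.
rewrite sumEFin.
rewrite (_ : \sum_(z <- _) _ = 1) ?mul1e//.
(* The translates occur as [+ intv z] here and as [- intv z] in [sum_indic_cube], hence the negated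
   list. *)
transitivity (\sum_(z <- [seq - z | z <- int_box n M.+2]) \1_(cube 0 1) ((a - b) - intv z) : R).
  rewrite big_map; apply: eq_bigr => z _; congr (\1_ _ _).
  by apply/matrixP => i k; rewrite !mxE intrN; ring.
rewrite sum_indic_cube; last by rewrite map_inj_uniq ?uniq_int_box//; exact: oppr_inj.
rewrite (_ : floorv (a - b) \in _)//; apply/mapP; exists (- floorv (a - b)); rewrite ?opprK//.
have : floorv (a - b) \in int_box n M.+2.
  apply: floorv_bound => i; have := ac i; have := bM i.
  rewrite !mxE !ler_norml -natr1 => /andP[b1 b2] /andP[x1 x2]; apply/andP; split; lra.
by move=> /mem_int_box h; apply/mem_int_box => i; rewrite mxE normrN.
Qed.

End torus.

(** * Trigonometric integrals and shells *)

Section trigonometric_integrals.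
Context {R : realType} {n : nat}.
Implicit Types (m : 'cV[int]_n) (a : 'cV[R]_n).

Definition wave m a : R := cos (2 * pi * dot (intv m) a).

Lemma dotDr (x y z : 'cV[R]_n) : dot x (y + z) = dot x y + dot x z.
Proof. by rewrite /dot -big_split/=; apply: eq_bigr => i _; rewrite !mxE mulrDr. Qed.

Lemma dotDl (x y z : 'cV[R]_n) : dot (x + y) z = dot x z + dot y z.
Proof. by rewrite /dot -big_split/=; apply: eq_bigr => i _; rewrite !mxE mulrDl. Qed.

Lemma dotNl (x y : 'cV[R]_n) : dot (- x) y = - dot x y.
Proof. by rewrite /dot -sumrN; apply: eq_bigr => i _; rewrite !mxE mulNr. Qed.

Lemma dotC (x y : 'cV[R]_n) : dot x y = dot y x.
Proof. by apply: eq_bigr => i _; rewrite mulrC. Qed.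

Lemma intvD m1 m2 : intv (m1 + m2) = intv m1 + intv m2 :> 'cV[R]_n.
Proof. by apply/matrixP => i j; rewrite !mxE intrD. Qed.

Lemma intvN m : intv (- m) = - intv m :> 'cV[R]_n.
Proof. by apply/matrixP => i j; rewrite !mxE intrN. Qed.

Lemma dot_intv m1 m2 :
  dot (intv m1) (intv m2) = (\sum_i m1 i ord0 * m2 i ord0)%:~R :> R.
Proof. by rewrite /dot rmorph_sum; apply: eq_bigr => i _; rewrite !mxE rmorphM. Qed.

Lemma cosD2piZ (x : R) (k : int) : cos (x + 2 * pi * k%:~R) = cos x.
Proof.
have E (y : R) (j : nat) : cos (y + 2 * pi * j%:R) = cos y.
  elim: j => [|j IH]; first by rewrite mulr0 addr0.
  rewrite -natr1 (_ : _ + _ = y + 2 * pi * j%:R + pi + pi); last by ring.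
  by rewrite !cosDpi opprK.
case: k => j; first by rewrite -pmulrn E.
by rewrite NegzE mulrNz -pmulrn -(E _ j.+1); congr cos; ring.
Qed.

Lemma wave_periodic m : periodic (wave m).
Proof. by move=> x z; rewrite /wave dotDr dot_intv mulrDr cosD2piZ. Qed.

Lemma measurable_wave m : measurable_fun setT (wave m).
Proof.
apply: measurableT_comp; first by apply: continuous_measurable_fun; exact: continuous_cos.
apply: measurable_funM => //; exact: measurable_dot.
Qed.

Lemma wave0 a : wave 0 a = 1.
Proof.
rewrite /wave (_ : intv 0 = 0) /dot ?big1 ?mulr0 ?cos0//.
  by move=> i _; rewrite mxE mul0r.
by apply/matrixP => i j; rewrite !mxE.
Qed.

Lemma wave_ge m a : 0 <= 1 + wave m a.
Proof. by have := cos_geN1 (2 * pi * dot (intv m) a); rewrite /wave; lra. Qed.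

Lemma wave_le m a : 0 <= 1 - wave m a.
Proof. by have := cos_le1 (2 * pi * dot (intv m) a); rewrite /wave; lra. Qed.

(** The constant [|c|] makes the integrand nonnegative. For m != 0 a half-period translation
    exchanges [1 + wave m] and [1 - wave m]; their integrals are therefore equal and, having sum 2,
    both are 1. *)
Lemma integral_wave m (c : R) :
  (\int[nu n]_a (`|c| + c * wave m a)%:E = (`|c| + c * (m == 0)%:R)%:E)%E.
Proof.
have mp : measurable_fun setT (fun a => (1 + wave m a)%:E).
  by apply/measurable_EFinP; apply: measurable_funD => //; exact: measurable_wave.
have mn : measurable_fun setT (fun a => (1 - wave m a)%:E).
  by apply/measurable_EFinP; apply: measurable_funB => //; exact: measurable_wave.
have sum2 : (\int[nu n]_a (1 + wave m a)%:E + \int[nu n]_a (1 - wave m a)%:E = 2%:E)%E.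
  rewrite -ge0_integralD//; first last.
  - by move=> a _; rewrite lee_fin wave_le.
  - by move=> a _; rewrite lee_fin wave_ge.
  rewrite -[RHS](integral_nu_cst n 2%:E); apply: eq_integral => a _; rewrite -EFinD; congr EFin; lra.
have key : (\int[nu n]_a (1 + wave m a)%:E = (1 + (m == 0)%:R)%:E /\
    \int[nu n]_a (1 - wave m a)%:E = (1 - (m == 0)%:R)%:E)%E.
  have [->|m0] := eqVneq m 0.
    split; under eq_integral do rewrite wave0; rewrite integral_nu_cst; congr EFin; rewrite /=; lra.
  have [j mj] : exists j, m j ord0 != 0.
    apply/existsP; rewrite -negb_forall; apply: contraNN m0 => /forallP h.
    by apply/eqP/matrixP => i k; rewrite ord1 mxE; exact/eqP.
  (* Half a period along a coordinate [j] in which [m] is nonzero: the pairing of [m] with [b] is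
     1/2. *)
  pose b : 'cV[R]_n := \col_i (if i == j then (2 * (m j ord0)%:~R)^-1 else 0).
  have mb : dot (intv m) b = 2^-1.
    rewrite /dot (bigD1 j)//= big1 ?addr0; last first.
      by move=> i /negbTE ij; rewrite !mxE ij mulr0.
    by rewrite !mxE eqxx; field; rewrite intr_eq0 mj.
  have E : (\int[nu n]_a (1 + wave m a)%:E = \int[nu n]_a (1 - wave m a)%:E)%E.
    rewrite -(periodic_shift b mp); first last.
    - by move=> x z; rewrite wave_periodic.
    - by move=> x; rewrite lee_fin wave_ge.
    apply: eq_integral => a _; congr EFin.
    rewrite /wave dotDr mb mulrDr (_ : 2 * pi * 2^-1 = pi); last by field.
    by rewrite cosDpi.
  move: sum2; rewrite E.
  have : (0 <= \int[nu n]_a (1 - wave m a)%:E)%E.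
    by apply: integral_ge0 => a _; rewrite lee_fin wave_le.
  case: (integral _ _ _) => [x|//|//] _; rewrite -EFinD => -[x2].
  by split; congr EFin; rewrite /=; lra.
have [c0|c0] := leP 0 c.
  transitivity (\int[nu n]_a (c%:E * (1 + wave m a)%:E))%E.
    by apply: eq_integral => a _; rewrite -EFinM; congr EFin; rewrite (ger0_norm c0); ring.
  rewrite ge0_integralZl_EFin//; last by move=> a _; rewrite lee_fin wave_ge.
  by rewrite key.1 -EFinM; congr EFin; rewrite (ger0_norm c0); ring.
transitivity (\int[nu n]_a ((- c)%:E * (1 - wave m a)%:E))%E.
  by apply: eq_integral => a _; rewrite -EFinM; congr EFin; rewrite (ltr0_norm c0); ring.
rewrite ge0_integralZl_EFin ?oppr_ge0 ?(ltW c0)//; last by move=> a _; rewrite lee_fin wave_le.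
by rewrite key.2 -EFinM; congr EFin; rewrite (ltr0_norm c0); ring.
Qed.

(** Orthogonality of characters for a nonnegative trigonometric polynomial. Its single terms change
    sign, so the finite constant sum of the [|c i|] is added first and cancelled at the end. *)
Lemma trig_integral (I : Type) (s : seq I) (c : I -> R) (m : I -> 'cV[int]_n)
    (f : 'cV[R]_n -> R) :
  (forall a, f a = \sum_(i <- s) c i * wave (m i) a) -> (forall a, 0 <= f a) ->
  (\int[nu n]_a (f a)%:E = (\sum_(i <- s) c i * (m i == 0)%:R)%:E)%E.
Proof.
move=> fE f0.
have mw i : measurable_fun setT (fun a => (`|c i| + c i * wave (m i) a)%:E).
  apply/measurable_EFinP; apply: measurable_funD => //.
  by apply: measurable_funM => //; exact: measurable_wave.
have w0 i a : 0 <= `|c i| + c i * wave (m i) a.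
  have := wave_ge (m i) a; have := wave_le (m i) a.
  by have [c0|c0] := leP 0 (c i); [rewrite ger0_norm//|rewrite ltr0_norm//]; nra.
have nf : (\int[nu n]_a (f a + \sum_(i <- s) `|c i|)%:E =
    (\sum_(i <- s) c i * (m i == 0)%:R + \sum_(i <- s) `|c i|)%:E)%E.
  transitivity (\int[nu n]_a (\sum_(i <- s) (`|c i| + c i * wave (m i) a)%:E))%E.
    by apply: eq_integral => a _; rewrite sumEFin big_split/= -fE addrC.
  rewrite ge0_integral_sum//; last by move=> i a _; rewrite lee_fin.
  under eq_bigr do rewrite integral_wave.
  by rewrite sumEFin big_split/= addrC.
have mf : measurable_fun setT (fun a => (f a)%:E).
  apply/measurable_EFinP; under [X in measurable_fun _ X]eq_fun do rewrite fE.
  apply: measurable_sumR => i; apply: measurable_funM => //; exact: measurable_wave.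
have S0 : 0 <= \sum_(i <- s) `|c i| by apply: sumr_ge0.
move: nf; under eq_integral do rewrite EFinD.
rewrite ge0_integralD//; last by move=> a _; rewrite lee_fin.
rewrite integral_nu_cst.
have : (0 <= \int[nu n]_a (f a)%:E)%E by apply: integral_ge0 => a _; rewrite lee_fin.
case: (integral _ _ _) => [x|//|//] _; rewrite -EFinD => -[h].
by congr EFin; apply: (addIr _ h).
Qed.

End trigonometric_integrals.

(** * Euclidean norm and volumes of shells *)

Section euclidean.
Context {R : realType} {n : nat}.
Implicit Types x y : 'cV[R]_n.

Lemma enorm_ge0 x : 0 <= enorm x.
Proof. exact: sqrtr_ge0. Qed.

Lemma sqr_enorm x : enorm x ^+ 2 = dot x x.
Proof. by rewrite sqr_sqrtr// dot_ge0. Qed.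

Lemma cauchy_schwarz x y : dot x y <= enorm x * enorm y.
Proof.
have [y0|y0] := eqVneq (dot y y) 0.
  have {}y0 : y = 0.
    apply/matrixP => i j; rewrite ord1 mxE; apply/eqP; rewrite -sqrf_eq0 eq_le sqr_ge0 andbT.
    rewrite -y0 /dot (bigD1 i)//= -expr2 lerDl.
    by apply: sumr_ge0 => k _; rewrite -expr2 sqr_ge0.
  rewrite y0 /dot big1; first by rewrite mulr_ge0 ?enorm_ge0.
  by move=> i _; rewrite mxE mulr0.
have yp : 0 < dot y y by rewrite lt_neqAle eq_sym y0 dot_ge0.
(* Up to the factor [dot y y], this is the squared length of the component of [x] orthogonal to
   [y]. *)
have : 0 <= dot (dot y y *: x - dot x y *: y) (dot y y *: x - dot x y *: y) by exact: dot_ge0.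
have -> : dot (dot y y *: x - dot x y *: y) (dot y y *: x - dot x y *: y)
    = dot y y * (dot x x * dot y y - dot x y ^+ 2).
  have E (a b : R) : dot (a *: x - b *: y) (a *: x - b *: y) =
      a ^+ 2 * dot x x - 2 * a * b * dot x y + b ^+ 2 * dot y y.
    rewrite /dot !mulr_sumr -sumrB -big_split/=; apply: eq_bigr => i _.
    by rewrite !mxE; ring.
  by rewrite E; ring.
rewrite pmulr_rge0// subr_ge0 => h.
apply: le_trans (ler_norm _) _.
rewrite -sqrtr_sqr -sqrtrM ?dot_ge0//.
by rewrite ler_sqrt// mulr_ge0 ?dot_ge0.
Qed.

Lemma enormD x y : enorm (x + y) <= enorm x + enorm y.
Proof.
rewrite enorm_le ?addr_ge0 ?enorm_ge0// dotDl !dotDr (dotC y x) sqrrD !sqr_enorm.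
have := cauchy_schwarz x y; lra.
Qed.

Lemma enormN x : enorm (- x) = enorm x.
Proof. by rewrite /enorm; congr Num.sqrt; apply: eq_bigr => i _; rewrite mxE mulrNN. Qed.

Lemma coord_le_enorm x i : `|x i ord0| <= enorm x.
Proof.
rewrite -sqrtr_sqr ler_sqrt ?dot_ge0// /dot (bigD1 i)//= -expr2 lerDl.
by apply: sumr_ge0 => k _; rewrite -expr2 sqr_ge0.
Qed.

Lemma enorm_le_sum x : enorm x <= \sum_i `|x i ord0|.
Proof.
have S0 : 0 <= \sum_i `|x i ord0| by apply: sumr_ge0.
rewrite enorm_le// expr2 mulr_suml; apply: ler_sum => i _.
rewrite -[leLHS]ger0_norm -?expr2 ?sqr_ge0// normrX expr2 ler_wpM2l//.
by rewrite (bigD1 i)//= lerDl sumr_ge0.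
Qed.

Lemma mulmx_bounded (B : 'M[R]_n) : exists2 C : R, 0 <= C &
  forall x, enorm (B *m x) <= C * \sum_i `|x i ord0|.
Proof.
exists (\sum_i \sum_j `|B i j|); first by do 2 (apply: sumr_ge0 => ? _).
move=> x; apply: le_trans (enorm_le_sum _) _.
rewrite mulr_suml; apply: ler_sum => i _; rewrite mxE mulr_suml.
apply: le_trans (ler_norm_sum _ _ _) _; apply: ler_sum => j _.
by rewrite normrM ler_wpM2l// (bigD1 j)//= lerDl sumr_ge0.
Qed.

Lemma coord_bounded (B : 'M[R]_n) : B \in unitmx -> exists2 C : R, 0 <= C &
  forall x i, `|x i ord0| <= C * enorm (B *m x).
Proof.
move=> uB; have [C C0 hC] := mulmx_bounded (invmx B).
exists (C * n%:R); first by rewrite mulr_ge0.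
move=> x i; rewrite -{1}[x](mulKmx uB).
apply: le_trans (coord_le_enorm _ i) _; apply: le_trans (hC _) _.
rewrite -mulrA ler_wpM2l//.
apply: (@le_trans _ _ (\sum_(i < n) enorm (B *m x))).
  by apply: ler_sum => j _; exact: coord_le_enorm.
by rewrite sumr_const card_ord mulr_natl.
Qed.

End euclidean.

(** For h < s the shell is a difference of two ellipsoids, and a^(n+1) - b^(n+1) factors as (a - b)
    times n + 1 terms, each at most (s + h)^n. For s <= h the full ellipsoid is small enough,
    because s + h <= 2 h. *)
Lemma shell_volume (R : realType) n (B : 'M[R]_n.+1) (s h : R) : B \in unitmx ->
  0 <= s -> 0 <= h -> 0 < s + h ->
  (lam n.+1 [set x | (s - h < enorm (B *m x) <= s + h)%R] <=
   (`|\det B|^-1 * kappa n.+1 * (2 * h * n.+1%:R * (s + h) ^+ n))%:E)%E.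
Proof.
move=> uB s0 h0 sh.
pose c : R := `|\det B|^-1 * kappa n.+1.
have c0 : 0 <= c by rewrite mulr_ge0 ?invr_ge0// kappa_ge0.
have mb t : measurable [set x : 'cV[R]_n.+1 | enorm (B *m x) <= t] by exact: measurable_enorm_le.
have shellE : [set x : 'cV[R]_n.+1 | s - h < enorm (B *m x) <= s + h] =
    [set x | enorm (B *m x) <= s + h] `\` [set x | enorm (B *m x) <= s - h].
  apply/seteqP; split => x /=; first by move=> /andP[h1 h2]; split => //; apply/negP; rewrite -ltNge.
  by move=> [h1 /negP]; rewrite -ltNge => h2; apply/andP.
have [hs|sh'] := ltP h s; last first.
  apply: (@le_trans _ _ (lam n.+1 [set x : 'cV[R]_n.+1 | enorm (B *m x) <= s + h])).
    apply: le_measure; rewrite ?inE//; first by rewrite shellE; exact: measurableD.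
    by move=> x /= /andP[].
  rewrite lam_ellipsoid// lee_fin -/c ler_wpM2l// exprS ler_wpM2r ?exprn_ge0 ?(ltW sh)//.
  have : 1 <= n.+1%:R :> R by rewrite ler1n.
  nra.
set S1 := [set x : 'cV[R]_n.+1 | enorm (B *m x) <= s + h] in shellE.
set S2 := [set x : 'cV[R]_n.+1 | enorm (B *m x) <= s - h] in shellE.
have S1y : (lam n.+1 S1 < +oo)%E by rewrite lam_ellipsoid// ltry.
have -> : (lam n.+1 [set x | (s - h < enorm (B *m x) <= s + h)%R] = lam n.+1 S1 - lam n.+1 S2)%E.
  rewrite shellE [LHS]measureD//; try exact: mb.
  by rewrite setIidr// => x; rewrite /S1 /S2/=; lra.
rewrite !lam_ellipsoid ?subr_gt0// -EFinD lee_fin -/c -mulrBr ler_wpM2l//.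
rewrite subrXX (_ : s + h - (s - h) = 2 * h); last by ring.
rewrite -mulrA ler_wpM2l ?mulr_ge0//.
apply: (@le_trans _ _ (\sum_(i < n.+1) (s + h) ^+ n)); last by rewrite sumr_const card_ord mulr_natl.
apply: ler_sum => i _; rewrite /=.
have -> : (s + h) ^+ n = (s + h) ^+ (n - i) * (s + h) ^+ i.
  by rewrite -exprD subnK// -ltnS.
by rewrite ler_wpM2l ?exprn_ge0 ?(ltW sh)// lerXn2r ?nnegrE; lra.
Qed.

Lemma card_fset_set_seq (T : choiceType) (S : set T) (s : seq T) :
  uniq s -> (forall x, S x <-> x \in s) ->
  size (finmap.enum_fset (fset_set S)) = size s.
Proof.
move=> us Ss; apply: perm_size; apply: uniq_perm; [exact: finmap.fset_uniq|exact: us|].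
have fS : finite_set S.
  apply: (@sub_finite_set _ _ [set` s]); last exact: finite_seq.
  by move=> x /Ss.
move=> x; have h : (x \in finmap.enum_fset (fset_set S)) = (x \in S) := in_fset_set fS x.
by rewrite h; apply/idP/idP; rewrite inE => /Ss.
Qed.

(** * Periodized balls *)

Section lattice_ball_count.
Context {R : realType} {n : nat}.
Variable A : 'M[R]_n.+1.
Hypothesis uA : A \in unitmx.
Local Notation V := 'cV[R]_n.+1.

Definition ellipsoid (r : R) : set V := [set y | enorm (A *m y) <= r].

Definition pcount (r : R) (a : V) : R :=
  (size (finmap.enum_fset (fset_set [set z : 'cV[int]_n.+1 | ellipsoid r (a + intv z)])))%:R.

Lemma measurable_ellipsoid r : measurable (ellipsoid r).
Proof. exact: measurable_enorm_le. Qed.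

Lemma pcountE (s : seq 'cV[int]_n.+1) r a : uniq s ->
  (forall z, ellipsoid r (a + intv z) -> z \in s) ->
  pcount r a = \sum_(z <- s) \1_(ellipsoid r) (a + intv z).
Proof.
move=> us hs; rewrite /pcount.
rewrite (@card_fset_set_seq _ _ [seq z <- s | a + intv z \in ellipsoid r]).
- rewrite size_filter -sum1_count natr_sum big_mkcond/=; apply: eq_bigr => z _.
  by rewrite indicE; case: ifP.
- exact: filter_uniq.
- move=> z; rewrite mem_filter; split=> [h|/andP[+ _]]; last by move/set_mem.
  by apply/andP; split; [exact/mem_set|exact: hs].
Qed.

(** The same box serves all radii up to [r0] and all centres in a bounded set; this uniformity makes
    the later constants depend on [r0] alone. Larger boxes are allowed too, for limits over growing
    boxes. *)
Lemma box_covers (r0 b : R) : exists M : nat, forall (k : nat) r (a : V), (M <= k)%N -> r <= r0 ->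
  (forall i, `|a i ord0| <= b) ->
  forall z, ellipsoid r (a + intv z) -> z \in int_box n.+1 k.
Proof.
have [C C0 hC] := coord_bounded uA.
exists (Num.truncn (C * r0 + b)).+1 => k r a Mk rr ab z za; apply/mem_int_box => i.
rewrite -(ler_int R); apply: (@le_trans _ _ (C * r0 + b)); last first.
  by apply: ltW; apply: (lt_le_trans (truncnS_gt _)); rewrite -pmulrn ler_nat.
have := hC (a + intv z) i; have := ab i; rewrite !mxE intr_norm => h1 h2.
have h3 : `|a i ord0 + (z i ord0)%:~R| <= C * r0.
  apply: le_trans h2 _; rewrite ler_wpM2l//; exact: le_trans za rr.
have -> : (z i ord0)%:~R = (a i ord0 + (z i ord0)%:~R) - a i ord0 :> R by ring.
apply: le_trans (ler_normB _ _) _; exact: lerD.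
Qed.

Lemma pcount_box r a : exists M : nat, forall k : nat, (M <= k)%N ->
  pcount r a = \sum_(z <- int_box n.+1 k) \1_(ellipsoid r) (a + intv z).
Proof.
have [b bP] := exists_nat_bound a.
have [M hM] := box_covers r b%:R.
exists M => k Mk; apply: pcountE; first exact: uniq_int_box.
exact: hM.
Qed.

Lemma pcount_periodic r : periodic (pcount r).
Proof.
move=> a z0; have [b bP] := exists_nat_bound a.
have [M hk] := box_covers r b%:R.
have {}hk k : (M <= k)%N -> forall z, ellipsoid r (a + intv z) -> z \in int_box n.+1 k.
  by move=> Mk; exact: hk.
rewrite (@pcountE (int_box n.+1 M) r a); [|exact: uniq_int_box|exact: hk].
rewrite (@pcountE [seq z - z0 | z <- int_box n.+1 M]).
- rewrite big_map; apply: eq_bigr => z _; congr (\1_ _ _).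
  by rewrite intvD intvN; apply/matrixP => i j; rewrite !mxE; ring.
- by rewrite map_inj_uniq ?uniq_int_box//; exact: addIr.
- move=> z hz; apply/mapP; exists (z + z0); last by rewrite addrK.
  by apply: (hk M) => //; move: hz; rewrite intvD (addrC (intv z)) addrA.
Qed.

Lemma measurable_indic_shift r v :
  measurable_fun setT (fun x : V => \1_(ellipsoid r) (x + v) : R).
Proof.
apply/measurable_EFinP.
apply: (@measurable_fun_shiftr _ _ (fun x : V => (\1_(ellipsoid r) x : R)%:E)).
by apply: measurable_indicE; exact: measurable_ellipsoid.
Qed.

Lemma measurable_pcount r : measurable_fun setT (pcount r).
Proof.
pose f k a : R := \sum_(z <- int_box n.+1 k) \1_(ellipsoid r) (a + intv z).
apply: (@measurable_fun_cvg _ _ _ _ f).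
  move=> k; apply: measurable_sumR => z.
  exact: measurable_indic_shift.
move=> a _; have [M hM] := pcount_box r a.
by apply: cvg_near_cst; exists M => // k /= Mk; apply/esym/hM.
Qed.

(** Distance to the nearest integer, which is the floor of t + 1/2. *)
Definition tau (t : R) : R := `|t - (Num.floor (t + 2^-1))%:~R|.

Lemma tau_le t : tau t <= 2^-1.
Proof.
have /andP[h1 h2] := floor_itv (t + 2^-1).
by rewrite /tau ler_norml; move: h2; rewrite intrD => h2; apply/andP; split; lra.
Qed.

(** If |A h| <= r, the two indicators agree outside the shell of half-width |A h| around the
    boundary. If |A h| > r, the sum of the two volumes is already of order r^(n+1). The minimum
    records both cases. *)
Lemma integral_ellipsoid_diff (r : R) (h : V) : 0 < r ->
  (\int[@lam R n.+1]_x `|\1_(ellipsoid r) (x - h) - \1_(ellipsoid r) x : R|%:E <=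
    (`|\det A|^-1 * kappa n.+1 * (2 ^+ n.+1 * n.+1%:R * Num.min r (enorm (A *m h)) * r ^+ n))%:E)%E.
Proof.
move=> r0; pose dl := enorm (A *m h).
have dl0 : 0 <= dl by exact: enorm_ge0.
pose c : R := `|\det A|^-1 * kappa n.+1.
have c0 : 0 <= c by rewrite mulr_ge0 ?invr_ge0// kappa_ge0.
have n1 : 1 <= n.+1%:R :> R by rewrite ler1n.
have mi : measurable_fun setT (\1_(ellipsoid r) : V -> R).
  by apply: measurable_indic; exact: measurable_ellipsoid.
have mih : measurable_fun setT (fun x : V => \1_(ellipsoid r) (x - h) : R).
  exact: measurable_indic_shift.
have md : measurable_fun setT (fun x : V => `|\1_(ellipsoid r) (x - h) - \1_(ellipsoid r) x : R|%:E).
  apply/measurable_EFinP; apply: measurableT_comp => //; exact: measurable_funB.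
have [dr|] := boolP (dl <= r); last rewrite -ltNge => dr.
  rewrite -/dl min_r//.
  apply: (@le_trans _ _ (lam n.+1 [set x : V | (r - dl < enorm (A *m x) <= r + dl)%R])); last first.
    apply: le_trans (shell_volume uA (ltW r0) dl0 _) _; first by lra.
    rewrite lee_fin -/c ler_wpM2l//.
    (* Since [dl <= r], the outer radius is at most [2 * r], which is the origin of the powers of
       2. *)
    have -> : 2 ^+ n.+1 * n.+1%:R * dl * r ^+ n = 2 * dl * n.+1%:R * (2 * r) ^+ n.
      by rewrite exprMn exprS; ring.
    apply: ler_wpM2l; first by rewrite !mulr_ge0.
    by rewrite lerXn2r ?nnegrE; lra.
  have mS : measurable [set x : V | r - dl < enorm (A *m x) <= r + dl].
    rewrite (_ : [set x | _] = [set x : V | r - dl < enorm (A *m x)] `&` [set x | enorm (A *m x) <= r + dl]).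
      have me : measurable_fun setT (fun x : V => enorm (A *m x)).
        by apply: measurable_enorm; exact: measurable_mulmx_cV.
      by apply: measurableI; [exact: measurable_set_lt|exact: measurable_set_le].
    by apply/seteqP; split => x /= /andP.
  rewrite lam_indic//; apply: ge0_le_integral => //; first exact: measurable_indicE.
  move=> x _; rewrite lee_fin !indicE.
  have t1 : enorm (A *m (x - h)) <= enorm (A *m x) + dl.
    by rewrite mulmxBr; apply: le_trans (enormD _ _) _; rewrite enormN.
  have t2 : enorm (A *m x) <= enorm (A *m (x - h)) + dl.
    by rewrite -{1}(subrK h x) mulmxDr; exact: enormD.
  case: (boolP (x \in [set x : V | r - dl < enorm (A *m x) <= r + dl])) => [_|].
    case: (x - h \in _); case: (x \in _); rewrite ?subrr ?normr0 ?subr0 ?normr1 ?sub0r ?normrN ?normr1//.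
  move=> /negP hx0; have : ~~ (r - dl < enorm (A *m x) <= r + dl).
    by apply/negP => hx1; apply: hx0; exact/mem_set.
  rewrite negb_and -leNgt -ltNge => hx.
  suff -> : (x - h \in ellipsoid r) = (x \in ellipsoid r) by rewrite subrr normr0.
  apply/idP/idP; rewrite !inE /ellipsoid/= => hh; case/orP: hx => hx; lra.
apply: (@le_trans _ _ (\int[lam n.+1]_x ((\1_(ellipsoid r) (x - h) : R)%:E + (\1_(ellipsoid r) x : R)%:E))%E).
  apply: ge0_le_integral => //.
    by apply: emeasurable_funD; exact/measurable_EFinP.
  move=> x _; rewrite -EFinD lee_fin; apply: le_trans (ler_normB _ _) _.
  by rewrite !ger0_norm.
rewrite ge0_integralD//; try (by exact/measurable_EFinP).
rewrite (ge0_integral_lam_shift (- h) (f := fun x => (\1_(ellipsoid r) x : R)%:E))//; last exact/measurable_EFinP.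
rewrite -lam_indic; last exact: measurable_ellipsoid.
rewrite /ellipsoid lam_ellipsoid// -EFinD lee_fin -/c -/dl min_l ?(ltW dr)//.
have -> : c * r ^+ n.+1 + c * r ^+ n.+1 = c * (2 * (r * r ^+ n)) by rewrite exprS; ring.
rewrite ler_wpM2l//.
rewrite -[X in _ <= X]mulrA ler_wpM2r ?mulr_ge0 ?exprn_ge0 ?(ltW r0)//.
rewrite exprS -mulrA; have : 1 <= 2 ^+ n :> R by rewrite exprn_ege1// ler1n.
nra.
Qed.

End lattice_ball_count.

(** * Translation defect of the periodized ball *)

Section translation_defect.
Context {R : realType} {n : nat}.
Variable A : 'M[R]_n.+1.
Hypothesis uA : A \in unitmx.
Local Notation V := 'cV[R]_n.+1.

Lemma min_sum_le (I : Type) (s : seq I) (r : R) (t : I -> R) : 0 <= r ->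
  (forall i, 0 <= t i) ->
  Num.min r (\sum_(i <- s) t i) <= \sum_(i <- s) Num.min r (t i).
Proof.
move=> r0 t0; elim: s => [|i s IH]; first by rewrite !big_nil ge_min lexx orbT.
rewrite !big_cons.
have S0 : 0 <= \sum_(j <- s) t j by apply: sumr_ge0.
have := IH; have := t0 i.
by rewrite !minEle; case: ifP => ?; case: ifP => ?; case: ifP => ?; lra.
Qed.

Lemma ger_min_scale (r c S : R) : 0 <= r -> 0 <= S -> 0 <= c ->
  Num.min r (c * S) <= (1 + c) * Num.min r S.
Proof.
by move=> r0 S0 c0; rewrite !minEle; case: ifPn => ?; case: ifPn => ?; nra.
Qed.

(** By periodicity [h] may be replaced by the representative [h'] whose coordinates have absolute
    values [tau (h i ord0)]. On the unit cube both counts are sums over one common box, and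
    unfolding the box bounds the integral by the one over R^n in [integral_ellipsoid_diff]. *)
Lemma translation_defect (r0 : R) : exists2 C : R, 0 <= C &
  forall r (h : V), 0 < r -> r <= r0 ->
  (\int[nu n.+1]_x ((pcount A r (x - h)%R - pcount A r x) ^+ 2)%:E <=
    (C * r ^+ n * \sum_i Num.min r (tau (h i ord0)))%:E)%E.
Proof.
(* A coordinate of [x - h'] is at most 1 + 1/2 in absolute value. *)
have [M hM] := box_covers uA r0 2.
have [Cm Cm0 hCm] := mulmx_bounded A.
pose K := size (int_box n.+1 M).
pose c : R := `|\det A|^-1 * kappa n.+1 * (2 ^+ n.+1 * n.+1%:R).
have c0 : 0 <= c by rewrite !mulr_ge0 ?invr_ge0 ?exprn_ge0// kappa_ge0.
exists (K%:R * c * (1 + Cm)); first by apply: mulr_ge0; [exact: mulr_ge0|exact: addr_ge0].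
move=> r h rp rr0.
pose z0 := floorv (h + \col_i 2^-1 : V).
pose h' := h - intv z0.
have h'E i : `|h' i ord0| = tau (h i ord0) by rewrite /tau !mxE.
have h'2 i : `|h' i ord0| <= 2^-1 by rewrite h'E tau_le.
pose d y : R := `|\1_(ellipsoid A r) (y - h') - \1_(ellipsoid A r) y|.
have d0 y : 0 <= d y by rewrite /d.
have mi : measurable_fun setT (\1_(ellipsoid A r) : V -> R).
  by apply: measurable_indic; exact: measurable_ellipsoid.
have md : measurable_fun setT (fun y => (d y)%:E).
  apply/measurable_EFinP; apply: measurableT_comp => //; apply: measurable_funB => //.
  exact: measurable_indic_shift.
have mp : measurable_fun setT (pcount A r) by exact: measurable_pcount.
have mph : measurable_fun setT (fun x : V => pcount A r (x - h)).
  apply/measurable_EFinP; apply: (@measurable_fun_shiftr _ _ (fun x : V => (pcount A r x)%:E)).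
  exact/measurable_EFinP.
apply: (@le_trans _ _ (\int[nu n.+1]_x (K%:R%:E * \sum_(z <- int_box n.+1 M) (d (x + intv z)%R)%:E))%E).
  apply: ge0_le_integral_nu.
  - apply/measurable_EFinP; apply: measurable_funX; exact: measurable_funB.
  - apply: emeasurable_funM => //; apply: emeasurable_sum => z.
    exact: (measurable_fun_shiftr (intv z) md).
  - by move=> x; rewrite lee_fin sqr_ge0.
  - by move=> x; apply: mule_ge0 => //; apply: sume_ge0 => z _; rewrite lee_fin.
  move=> x xc; rewrite sumEFin -EFinM lee_fin.
  have -> : pcount A r (x - h) = pcount A r (x - h').
    rewrite -(pcount_periodic uA r (x - h) z0); congr (pcount A r _).
    by rewrite /h' opprB addrA addrAC.
  have xb i : 0 <= x i ord0 < 1 by exact: xc.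
  rewrite (@pcountE _ _ A (int_box n.+1 M) r (x - h')); first last.
  - apply: hM => // i; rewrite !mxE; have := h'2 i; have := xb i.
    rewrite !mxE !ler_norml => /andP[x1 x2] /andP[h1 h2]; apply/andP; split; lra.
  - exact: uniq_int_box.
  rewrite (@pcountE _ _ A (int_box n.+1 M) r x); first last.
  - apply: hM => // i; have := xb i.
    rewrite !ler_norml => /andP[x1 x2]; apply/andP; split; lra.
  - exact: uniq_int_box.
  rewrite -sumrB.
  set S := \sum_(z <- _) _.
  have S1 : `|S| <= \sum_(z <- int_box n.+1 M) d (x + intv z).
    apply: le_trans (ler_norm_sum _ _ _) _; apply: ler_sum => z _.
    by rewrite /d addrAC.
  have S2 : \sum_(z <- int_box n.+1 M) d (x + intv z) <= K%:R.
    rewrite /K -sum1_size natr_sum; apply: ler_sum => z _.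
    by rewrite /d !indicE; do 2 case: (_ \in _); rewrite ?subrr ?normr0 ?subr0 ?normr1 ?sub0r ?normrN ?normr1.
  (* The difference of the counts is at most the number [K] of box points, so squaring it costs only
     a factor [K]. *)
  have -> : S ^+ 2 = `|S| * `|S| by rewrite -normrM -expr2 ger0_norm ?sqr_ge0.
  by apply: ler_pM => //; exact: le_trans S1 S2.
rewrite ge0_integralZl_EFin//; first last.
- by apply: emeasurable_sum => z; exact: (measurable_fun_shiftr (intv z) md).
- by move=> x _; apply: sume_ge0 => z _; rewrite lee_fin.
apply: (@le_trans _ _ (K%:R%:E * \int[lam n.+1]_x (d x)%:E)%E).
  apply: lee_wpmul2l; first by rewrite lee_fin.
  by apply: (tiling_le (uniq_int_box n.+1 M) md) => x; rewrite lee_fin.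
set T := \sum_i Num.min r _.
have -> : K%:R * c * (1 + Cm) * r ^+ n * T = K%:R * (c * ((1 + Cm) * (r ^+ n * T))).
  by rewrite !mulrA.
rewrite EFinM; apply: lee_wpmul2l; first by rewrite lee_fin.
apply: le_trans (integral_ellipsoid_diff uA h' rp) _.
rewrite lee_fin.
have -> : `|\det A|^-1 * kappa n.+1 *
    (2 ^+ n.+1 * n.+1%:R * Num.min r (enorm (A *m h')) * r ^+ n) =
    c * (Num.min r (enorm (A *m h')) * r ^+ n) by rewrite /c; ring.
apply: ler_wpM2l => //; rewrite [leRHS]mulrCA [leLHS]mulrC.
apply: ler_wpM2l; first by rewrite exprn_ge0// ltW.
apply: (@le_trans _ _ (Num.min r (Cm * \sum_i `|h' i ord0|))).
  by have := hCm h'; rewrite !minEle; case: ifPn => ?; case: ifPn => ?; lra.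
apply: le_trans (ger_min_scale (ltW rp) _ Cm0) _; first by apply: sumr_ge0.
apply: ler_wpM2l; first by rewrite addr_ge0.
rewrite /T; under [X in _ <= X]eq_bigr do rewrite -h'E.
by apply: min_sum_le => //; exact: ltW.
Qed.

End translation_defect.

(** * Dyadic majorants and the frequency set *)

Section dyadic_bound.
Context {R : realType}.

Lemma dyadic_scale (x : R) J : x <= 2^-1 -> 2^-1 ^+ J.+1 < x ->
  exists2 j, (j < J)%N & 2^-1 ^+ j.+2 < x <= 2^-1 ^+ j.+1.
Proof.
move=> x1; elim: J => [|J IH] Jx; first by rewrite expr1 ltNge x1 in Jx.
have [h|h] := ltP (2^-1 ^+ J.+1) x; last by exists J => //; apply/andP.
by have [j jJ jx] := IH h; exists j => //; exact: ltnW.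
Qed.

(** 2^j times an integer is an integer, so the rounding of [t] is invisible, and evenness of the
    cosine absorbs the absolute value in [tau]. *)
Lemma cos_tau (t : R) j : cos (2 * pi * 2 ^+ j * t) = cos (2 * pi * 2 ^+ j * tau t).
Proof.
set f := Num.floor (t + 2^-1).
have -> : 2 * pi * 2 ^+ j * t = 2 * pi * 2 ^+ j * (t - f%:~R) + 2 * pi * (2 ^+ j * f)%:~R.
  by rewrite intrM rmorphXn/=; ring.
rewrite cosD2piZ /tau -/f.
by have [h|h] := ger0P (t - f%:~R); rewrite // mulrN cosN.
Qed.

(* If 2^-(j+2) < ||t|| <= 2^-(j+1), then 2^j ||t|| is in ]1/4, 1/2], where
   1 - cos(2 pi x) >= 1, so that the term of index j alone is large enough. *)
Definition trig_majorant (r : R) (J : nat) (t : R) : R :=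
  \sum_(j < J) Num.min r (2^-1 ^+ j.+1) * (1 - cos (2 * pi * 2 ^+ j * t)) + 2^-1 ^+ J.+1.

Lemma trig_majorant_ge0 r J t : 0 <= r -> 0 <= trig_majorant r J t.
Proof.
move=> r0; rewrite addr_ge0 ?exprn_ge0// sumr_ge0// => j _.
by rewrite mulr_ge0 ?subr_ge0 ?cos_le1// le_min r0 exprn_ge0.
Qed.

Lemma measurable_trig_majorant r J : measurable_fun setT (trig_majorant r J).
Proof.
apply: measurable_funD => //; apply: measurable_sumR => j; apply: measurable_funM => //.
apply: measurable_funB => //; apply: measurableT_comp; last exact: measurable_funM.
by apply: continuous_measurable_fun; exact: continuous_cos.
Qed.

Lemma min_tau_le (r t : R) J : 0 <= r -> Num.min r (tau t) <= trig_majorant r J t.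
Proof.
move=> r0; rewrite /trig_majorant; set x := tau t.
have x2 : x <= 2^-1 by exact: tau_le.
have x0 : 0 <= x by exact: normr_ge0.
have p0 k : 0 <= 2^-1 ^+ k :> R by rewrite exprn_ge0.
have m0 k : 0 <= Num.min r (2^-1 ^+ k) by rewrite le_min r0 p0.
have t0 k : 0 <= Num.min r (2^-1 ^+ k.+1) * (1 - cos (2 * pi * 2 ^+ k * t)).
  by rewrite mulr_ge0// subr_ge0 cos_le1.
(* Below the finest scale the constant term of the majorant is enough; above it, one dyadic index
   is. *)
have [h|h] := leP x (2^-1 ^+ J.+1).
  apply: le_trans (_ : x <= _); first by rewrite ge_min lexx orbT.
  by apply: le_trans h _; rewrite lerDr sumr_ge0.
have [j jJ /andP[j1 j2]] := dyadic_scale x2 h.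
rewrite (bigD1 (Ordinal jJ))//= -addrA; apply: ler_wpDr.
  by rewrite addr_ge0// sumr_ge0.
apply: (@le_trans _ _ (Num.min r (2^-1 ^+ j.+1))).
  by rewrite le_min !ge_min lexx/= j2 orbT.
rewrite -[leLHS]mulr1 ler_wpM2l// cos_tau -/x.
suff : cos (2 * pi * 2 ^+ j * x) <= 0 by lra.
(* The angle lies between pi/2 and pi; after subtracting pi, it falls where the cosine is
   nonnegative. *)
rewrite -[2 * pi * _ * _](subrK pi) cosDpi oppr_le0 cos_ge0_pihalf//.
have pi0 := @pi_gt0 R.
have e j' : 2 ^+ j' * 2^-1 ^+ j' = 1 :> R by rewrite -exprMn mulfV ?expr1n.
have h1 : 2^-1 ^+ 2 < 2 ^+ j * x.
  have -> : 2^-1 ^+ 2 = 2 ^+ j * 2^-1 ^+ j.+2 :> R by rewrite -[j.+2]addn2 exprD mulrA e mul1r.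
  by rewrite ltr_pM2l// exprn_gt0.
have h2 : 2 ^+ j * x <= 2^-1.
  have -> : 2^-1 = 2 ^+ j * 2^-1 ^+ j.+1 :> R by rewrite exprSr mulrA e mul1r.
  by rewrite ler_pM2l// exprn_gt0.
have -> : 2 * pi * 2 ^+ j * x = 2 * pi * (2 ^+ j * x) by ring.
move: h1 h2; set y := 2 ^+ j * x => h1 h2.
by apply/andP; split; nra.
Qed.

End dyadic_bound.

Section defect.
Context {R : realType} {n : nat}.
Implicit Types (S : seq 'cV[int]_n) (v : 'cV[int]_n).

(** The boundary layer of [S] in direction [v]; for a repetition-free list it is half the size of
    the symmetric difference of [S] and its translate by [v]. *)
Definition defect S v : nat := count (fun u => u + v \notin S) S.

(** If u + (m + 1) v is outside [S], then either u + m v is outside already, or the last step leaves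
    [S]; in the second case u + m v is itself counted in [defect S v], and u is determined by it. *)
Lemma defect_mulrn S v m : uniq S -> (defect S (v *+ m) <= m * defect S v)%N.
Proof.
move=> uS; elim: m => [|m IH].
  rewrite mul0n leqn0 /defect mulr0n; apply/eqP; apply: (etrans _ (count_pred0 S)).
  by apply: eq_in_count => u uS'; rewrite addr0 uS'.
pose a1 := fun u => u + v *+ m \notin S.
pose a2 := fun u => (u + v *+ m \in S) && (u + v *+ m + v \notin S).
apply: (@leq_trans (count (predU a1 a2) S)).
  apply: sub_count => u /=; rewrite /a1 /a2 mulrSr addrA.
  by case: (u + v *+ m \in S).
rewrite mulSn addnC; apply: (@leq_trans (count a1 S + count a2 S)).
  by rewrite -count_predUI leq_addr.
apply: leq_add; first exact: IH.
rewrite /defect -!size_filter -(size_map (fun u => u + v *+ m)).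
apply: uniq_leq_size.
  by rewrite map_inj_uniq ?filter_uniq//; exact: addIr.
by move=> w /mapP[u]; rewrite mem_filter => /andP[/andP[h1 h2] _] ->; rewrite mem_filter h2.
Qed.

(* This is |sum_(u <- S) exp(2 i pi <u, a>)|^2. *)
Definition ksq S (a : 'cV[R]_n) : R := \sum_(u <- S) \sum_(w <- S) wave (u - w) a.

Lemma wave_prod (u v : 'cV[int]_n) (a : 'cV[R]_n) :
  2^-1 * (wave (u + v) a + wave (u - v) a) = wave u a * wave v a.
Proof.
rewrite /wave !intvD intvN !dotDl dotNl (mulrDr (2 * pi)) (mulrBr (2 * pi)).
by rewrite cosD cosB; field.
Qed.

Lemma ksqE S a : ksq S a = (\sum_(u <- S) cos (2 * pi * dot (intv u) a)) ^+ 2 +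
  (\sum_(u <- S) sin (2 * pi * dot (intv u) a)) ^+ 2.
Proof.
rewrite !expr2 !mulr_suml -big_split/=; apply: eq_bigr => u _.
rewrite [X in _ = X + _]mulr_sumr [X in _ = _ + X]mulr_sumr -big_split/=; apply: eq_bigr => w _.
by rewrite /wave intvD intvN dotDl dotNl mulrBr cosB.
Qed.

Lemma ksq_ge0 S a : 0 <= ksq S a.
Proof. by rewrite ksqE addr_ge0// sqr_ge0. Qed.

Lemma ksq_le S a : ksq S a <= (size S)%:R ^+ 2.
Proof.
rewrite expr2 -sum1_size natr_sum /ksq mulr_suml; apply: ler_sum => u _.
rewrite mul1r; apply: ler_sum => w _; exact: cos_le1.
Qed.

Lemma measurable_ksq S : measurable_fun setT (ksq S).
Proof. by do 2 (apply: measurable_sumR => ?); exact: measurable_wave. Qed.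

Lemma ksq_periodic S : periodic (ksq S).
Proof.
by move=> a z; do 2 (apply: eq_bigr => ? _); rewrite wave_periodic.
Qed.

Lemma sum_eq_mem S u : uniq S -> \sum_(w <- S) (u == w)%:R = (u \in S)%:R :> R.
Proof.
move=> uS; have [h|h] := boolP (u \in S).
  rewrite (bigD1_seq u)//= eqxx big1 ?addr0// => w /negbTE; rewrite eq_sym => ->//.
by rewrite big_seq big1// => w wS; case: eqP => // uw; rewrite uw wS in h.
Qed.

(** The product expands into frequencies u - w and u - w +- v. Only the zero frequencies survive:
    the size of [S] minus the number of u with u + v in [S], the signs +v and -v giving one half
    each. *)
Lemma integral_ksq_wave S v : uniq S ->
  (\int[nu n]_a (ksq S a * (1 - wave v a))%:E = (defect S v)%:R%:E)%E.
Proof.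
move=> uS.
(* Coefficients of [1 - wave v] once the product of cosines is split by [wave_prod]. *)
pose q3 : seq (R * 'cV[int]_n) := [:: (1, 0); (- 2^-1, v); (- 2^-1, - v)].
pose s := [seq (p, q) | p <- [seq (u, w) | u <- S, w <- S], q <- q3].
rewrite (@trig_integral _ _ _ s (fun i => i.2.1) (fun i => i.1.1 - i.1.2 + i.2.2)); first last.
- by move=> a; rewrite mulr_ge0 ?ksq_ge0// wave_le.
- move=> a; rewrite big_allpairs_dep/= big_allpairs_dep/= /ksq mulr_suml.
  apply: eq_bigr => u _; rewrite mulr_suml; apply: eq_bigr => w _.
  rewrite /q3 !big_cons big_nil/= !addr0.
  by rewrite mulrBr mulr1 -wave_prod; field.
congr EFin; rewrite big_allpairs_dep/= big_allpairs_dep/=.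
have h1 : \sum_(u <- S) \sum_(w <- S) (u == w)%:R = (size S)%:R :> R.
  rewrite -sum1_size natr_sum big_seq [RHS]big_seq; apply: eq_bigr => u us.
  by rewrite sum_eq_mem// us.
have h2 : \sum_(u <- S) \sum_(w <- S) (u + v == w)%:R = \sum_(u <- S) (u + v \in S)%:R :> R.
  by apply: eq_bigr => u _; rewrite sum_eq_mem.
have h3 : \sum_(u <- S) \sum_(w <- S) (w + v == u)%:R = \sum_(u <- S) (u + v \in S)%:R :> R.
  by rewrite exchange_big.
have -> : (defect S v)%:R = (size S)%:R - \sum_(u <- S) (u + v \in S)%:R :> R.
  rewrite /defect -sum1_count natr_sum -sum1_size natr_sum -sumrB big_mkcond/=.
  by apply: eq_bigr => u _; case: (_ \in _); rewrite /= ?subr0 ?subrr.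
rewrite -h1.
transitivity (\sum_(u <- S) \sum_(w <- S) (u == w)%:R
  - 2^-1 * (\sum_(u <- S) \sum_(w <- S) (u + v == w)%:R)
  - 2^-1 * (\sum_(u <- S) \sum_(w <- S) (w + v == u)%:R) : R); last first.
  by rewrite h2 h3; field.
rewrite !mulr_sumr -!sumrB; apply: eq_bigr => u _.
rewrite !mulr_sumr -!sumrB; apply: eq_bigr => w _.
rewrite /q3 !big_cons big_nil/= !addr0 mul1r subr_eq0 !mulNr addrA.
congr (_ - _ * _%:R - _ * _%:R); congr (nat_of_bool _).
  by rewrite addrAC subr_eq0.
by rewrite -addrA -opprD subr_eq0 eq_sym.
Qed.

Lemma integral_ksq S : uniq S -> (\int[nu n]_a (ksq S a)%:E = (size S)%:R%:E)%E.
Proof.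
move=> uS.
rewrite (@trig_integral _ _ _ [seq (u, w) | u <- S, w <- S] (fun=> 1) (fun i => i.1 - i.2)).
- rewrite big_allpairs_dep/=; congr EFin; rewrite -sum1_size natr_sum big_seq [RHS]big_seq.
  apply: eq_bigr => u us.
  rewrite -[RHS](_ : (u \in S)%:R = _); last by rewrite us.
  by rewrite -sum_eq_mem//; apply: eq_bigr => w _; rewrite mul1r subr_eq0.
- by move=> a; rewrite big_allpairs_dep/=; do 2 (apply: eq_bigr => ? _); rewrite mul1r.
- exact: ksq_ge0.
Qed.

(** Term j of the majorant is [1 - wave] at 2^j times the i-th unit vector, whose integral is a
    defect of at most 2^j [B]; the constant term multiplies int |k|^2 = [size S]. *)
Lemma integral_ksq_majorant S (i : 'I_n) (B : nat) (r : R) (J : nat) : uniq S -> 0 <= r ->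
  (defect S (delta_mx i ord0) <= B)%N ->
  (\int[nu n]_a (ksq S a * trig_majorant r J (a i ord0))%:E <=
   (\sum_(j < J) Num.min r (2^-1 ^+ j.+1) * (2 ^+ j * B%:R) + 2^-1 ^+ J.+1 * (size S)%:R)%:E)%E.
Proof.
move=> uS r0 dB.
pose e : 'cV[int]_n := delta_mx i ord0.
have m0 k : 0 <= Num.min r (2^-1 ^+ k) by rewrite le_min r0 exprn_ge0.
have waveE (j : nat) (a : 'cV[R]_n) : cos (2 * pi * 2 ^+ j * a i ord0) = wave (e *+ (2 ^ j)) a.
  rewrite /wave; congr cos; rewrite -mulrA; congr (_ * _).
  rewrite /dot (bigD1 i)//= big1 ?addr0; last first.
    by move=> k /negbTE ki; rewrite !(mxE, mulmxnE) ki mul0rn mul0r.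
  by rewrite !(mxE, mulmxnE) !eqxx/= rmorphMn/= natrX.
have mk : measurable_fun setT (ksq S) by exact: measurable_ksq.
have mw j : measurable_fun setT (fun a : 'cV[R]_n => (ksq S a * (1 - wave (e *+ (2 ^ j)) a))%:E).
  apply/measurable_EFinP; apply: measurable_funM => //.
  by apply: measurable_funB => //; exact: measurable_wave.
have w0 j a : 0 <= ksq S a * (1 - wave (e *+ (2 ^ j)) a).
  by rewrite mulr_ge0 ?ksq_ge0 ?wave_le.
have mks : measurable_fun setT (fun a => ((2^-1 ^+ J.+1)%:E * (ksq S a)%:E)%E).
  by apply: emeasurable_funM => //; exact/measurable_EFinP.
have ms : measurable_fun setT (fun a => \sum_(j < J) ((Num.min r (2^-1 ^+ j.+1))%:E *
    (ksq S a * (1 - wave (e *+ (2 ^ j)) a))%:E))%E.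
  by apply: emeasurable_sum => j; exact: emeasurable_funM.
have -> : (\int[nu n]_a (ksq S a * trig_majorant r J (a i ord0))%:E =
    \int[nu n]_a (\sum_(j < J) ((Num.min r (2^-1 ^+ j.+1))%:E *
    (ksq S a * (1 - wave (e *+ (2 ^ j)) a))%:E) + (2^-1 ^+ J.+1)%:E * (ksq S a)%:E))%E.
  apply: eq_integral => a _; under eq_bigr do rewrite -EFinM.
  rewrite sumEFin -EFinM -EFinD; congr EFin.
  rewrite mulrDr mulr_sumr [2^-1 ^+ _ * _]mulrC; congr (_ + _); apply: eq_bigr => j _.
  by rewrite waveE mulrCA.
rewrite ge0_integralD//; first last.
- by move=> a _; rewrite -EFinM lee_fin mulr_ge0 ?ksq_ge0 ?exprn_ge0.
- by move=> a _; apply: sume_ge0 => j _; rewrite -EFinM lee_fin mulr_ge0.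
rewrite ge0_integral_sum//; last 2 first.
- by move=> j; exact: emeasurable_funM.
- by move=> j a _; rewrite -EFinM lee_fin mulr_ge0.
rewrite ge0_integralZl_EFin ?exprn_ge0//; first last.
- exact/measurable_EFinP.
- by move=> a _; rewrite lee_fin ksq_ge0.
rewrite integral_ksq// EFinD EFinM leeD2rE//.
rewrite -sumEFin; apply: lee_sum => j _.
rewrite ge0_integralZl_EFin//; last by move=> a _; rewrite lee_fin.
rewrite integral_ksq_wave// -EFinM lee_fin ler_wpM2l//.
rewrite -natrX -natrM ler_nat.
by apply: leq_trans (defect_mulrn _ _ uS) _; rewrite leq_mul2l dB orbT.
Qed.

End defect.

(** * Lattice points near a large sphere *)

Section lattice_points.
Context {R : realType} {n : nat}.
Variable W : 'M[R]_n.+1.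
Hypothesis uW : W \in unitmx.
Local Notation V := 'cV[R]_n.+1.

(** The unit cubes at the points of [s] are disjoint and have volume 1, and all of them lie in a
    slightly thicker shell; its volume is O(rho^n) because [rho] stays above [c0]. *)
Lemma annulus_count (c0 k0 : R) : 0 < c0 -> 0 <= k0 -> exists2 C : R, 0 <= C &
  forall rho (s : seq 'cV[int]_n.+1), c0 <= rho -> uniq s ->
  (forall m, m \in s -> rho - k0 <= enorm (W *m intv m) <= rho + k0) ->
  (size s)%:R <= C * rho ^+ n.
Proof.
move=> c00 k00; have [Cm Cm0 hCm] := mulmx_bounded W.
(* Thickening by a bound for |W x| on the unit cube; the extra 1 gives the strict inequality of the
   shell and the positivity of [k]. *)
pose k := k0 + Cm * n.+1%:R + 1.
have kp : 0 < k by rewrite /k ltr_wpDl// addr_ge0// mulr_ge0.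
pose c : R := `|\det W|^-1 * kappa n.+1.
have cp : 0 <= c by rewrite mulr_ge0 ?invr_ge0// kappa_ge0.
(* The factor [1 + k / c0] turns the outer radius rho + k into a multiple of rho, using rho >=
   c0. *)
exists (c * (2 * k * n.+1%:R * (1 + k / c0) ^+ n)).
  rewrite mulr_ge0// mulr_ge0 ?exprn_ge0//; first by rewrite !mulr_ge0// ltW.
  by rewrite addr_ge0// divr_ge0// ltW.
move=> rho s crho us hs.
have rp : 0 < rho by exact: lt_le_trans crho.
pose sh := [set x : V | rho - k < enorm (W *m x) <= rho + k].
have msh : measurable sh.
  rewrite (_ : sh = [set x : V | rho - k < enorm (W *m x)] `&` [set x | enorm (W *m x) <= rho + k]).
    have me : measurable_fun setT (fun x : V => enorm (W *m x)).
      by apply: measurable_enorm; exact: measurable_mulmx_cV.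
    by apply: measurableI; [exact: measurable_set_lt|exact: measurable_set_le].
  by apply/seteqP; split => x /= /andP.
have mc : measurable_fun setT (fun x : V => (\1_(cube 0 1) x : R)%:E).
  by apply: measurable_indicE; exact: measurable_cube.
have mcz z : measurable_fun setT (fun x : V => (\1_(cube 0 1) (x - intv z) : R)%:E).
  exact: (measurable_fun_shiftr (- intv z) mc).
have key : ((size s)%:R%:E <= lam n.+1 sh)%E.
  have -> : ((size s)%:R%:E = \int[lam n.+1]_x (\sum_(z <- s) (\1_(cube 0 1) (x - intv z) : R)%:E))%E.
    rewrite ge0_integral_sum//.
    have e z : (\int[lam n.+1]_x (\1_(cube 0 1) (x - intv z) : R)%:E = 1)%E.
      rewrite (ge0_integral_lam_shift (- intv z) (f := fun x => (\1_(cube 0 1) x : R)%:E))//.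
      by rewrite -lam_indic ?lam_cube ?subr0 ?expr1n//; exact: measurable_cube.
    by under eq_bigr do rewrite e; rewrite sumEFin -sum1_size natr_sum.
  rewrite lam_indic//; apply: ge0_le_integral => //.
  - by move=> x _; apply: sume_ge0 => z _; rewrite lee_fin.
  - exact: emeasurable_sum.
  - exact: measurable_indicE.
  move=> x _; rewrite sumEFin lee_fin sum_indic_cube// indicE.
  case: (boolP (floorv x \in s)) => // xs.
  suff : sh x by move=> /mem_set ->.
  have /cube_floorv xc := erefl (floorv x).
  have /andP[h1 h2] := hs _ xs.
  have h3 : enorm (W *m (x - intv (floorv x))) <= Cm * n.+1%:R.
    apply: le_trans (hCm _) _; rewrite ler_wpM2l//.
    apply: (@le_trans _ _ (\sum_(i < n.+1) 1)); last by rewrite sumr_const card_ord.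
    apply: ler_sum => i _; have /andP[x1 x2] := xc i.
    by rewrite ger0_norm// ltW.
  have t1 : enorm (W *m x) <= enorm (W *m intv (floorv x)) + enorm (W *m (x - intv (floorv x))).
    by rewrite -[in leLHS](subrK (intv (floorv x)) x) addrC mulmxDr; exact: enormD.
  have t2 : enorm (W *m intv (floorv x)) <= enorm (W *m x) + enorm (W *m (x - intv (floorv x))).
    rewrite -[in leLHS](subKr x (intv (floorv x))) mulmxBr.
    by apply: le_trans (enormD _ _) _; rewrite enormN.
  by rewrite /sh/= /k; apply/andP; split; lra.
rewrite -lee_fin; apply: le_trans key _.
apply: le_trans (shell_volume uW (ltW rp) (ltW kp) _) _; first by rewrite addr_gt0.
rewrite lee_fin -/c -[leRHS]mulrA; apply: ler_wpM2l => //.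
rewrite -[leRHS]mulrA; apply: ler_wpM2l; first by rewrite !mulr_ge0// ltW.
have kc0 : 0 <= k / c0 by rewrite divr_ge0// ltW.
have le1 : rho + k <= (1 + k / c0) * rho.
  by rewrite mulrDl mul1r lerD2l mulrAC ler_pdivlMr// ler_pM2l.
rewrite -exprMn; apply: lerXn2r => //; rewrite nnegrE; first by lra.
by rewrite mulr_ge0// ?addr_ge0// ltW.
Qed.

(** A frequency m counted in the defect satisfies |W m| < rho + c1, being in [D], while its
    neighbour m + e_i is outside [D], hence outside the inner ball, so that |W m| >= rho - |W e_i|.
    These are the points of an annulus whose width does not depend on rho. *)
Lemma defect_bound (c0 c1 : R) : 0 < c0 -> 0 <= c1 -> exists2 C : R, 0 <= C &
  forall rho (D : set V) (S : seq 'cV[int]_n.+1), c0 <= rho ->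
  eball 0 rho `<=` D -> D `<=` eball 0 (rho + c1) -> uniq S ->
  (forall m, m \in S <-> D (W *m intv m)) ->
  forall i, (defect S (delta_mx i ord0))%:R <= C * rho ^+ n.
Proof.
move=> c00 c10; pose We i := enorm (W *m intv (delta_mx i ord0)).
have We0 i : 0 <= We i by exact: enorm_ge0.
have k00 : 0 <= c1 + \sum_i We i by rewrite addr_ge0// sumr_ge0.
have [C C0 hC] := annulus_count c00 k00.
exists C => // rho D S crho sub1 sub2 uS SD i.
rewrite /defect -size_filter; apply: hC => //; first exact: filter_uniq.
move=> m; rewrite mem_filter => /andP[mS' /SD mD].
have /= m1 := sub2 _ mD; rewrite /eball/= subr0 in m1.
have S0 : 0 <= \sum_i We i by rewrite sumr_ge0.
have m2 : rho <= enorm (W *m intv (m + delta_mx i ord0)).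
  rewrite leNgt; apply/negP => h; move/negP: mS'; apply; apply/SD; apply: sub1.
  by rewrite /eball/= subr0.
have m3 : enorm (W *m intv (m + delta_mx i ord0)) <= enorm (W *m intv m) + We i.
  by rewrite intvD mulmxDr; exact: enormD.
have m4 : We i <= \sum_i We i by rewrite (bigD1 i)//= lerDl sumr_ge0.
by apply/andP; split; lra.
Qed.

End lattice_points.

(** * Summation over the dyadic scales *)

Section dyadic_sum.
Context {R : realType}.

(* The right-hand side telescopes along x = r 2^(j+1). *)
Lemma min_le_ln (x : R) : 0 <= x -> Num.min x 1 <= 3 * (ln (1 + 2 * x) - ln (1 + x)).
Proof.
move=> x0.
have p1 : 0 < 1 + x by lra.
have p2 : 0 < 1 + 2 * x by lra.
(* The difference of logarithms is -ln(1 - y) >= y with y = x / (1 + 2 x). The factor 3 then comes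
   from min(x, 1) <= 3 x / (1 + 2 x), checked separately for x <= 1 and x > 1. *)
have h : x / (1 + 2 * x) <= ln (1 + 2 * x) - ln (1 + x).
  rewrite -lerN2 opprB -ln_div ?posrE//.
  have -> : (1 + x) / (1 + 2 * x) = 1 + (- (x / (1 + 2 * x))) by field; rewrite gt_eqF.
  apply: le_ln1Dx; rewrite ltrN2 ltr_pdivrMr//; lra.
apply: le_trans (_ : 3 * (x / (1 + 2 * x)) <= _); last by rewrite ler_pM2l.
rewrite mulrA ler_pdivlMr// minEle; case: ifPn => [?|]; first by nra.
by rewrite -ltNge => ?; lra.
Qed.

(** Each summand is one half of min(x, 1) at x = r 2^(j+1), so [min_le_ln] telescopes with constant
    3/2, rounded up to 2. *)
Lemma dyadic_sum_le (r : R) J : 0 <= r ->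
  \sum_(j < J) Num.min r (2^-1 ^+ j.+1) * 2 ^+ j <= 2 * ln (1 + r * 2 ^+ J.+1).
Proof.
move=> r0.
have e (j : nat) : Num.min r (2^-1 ^+ j.+1) * 2 ^+ j = 2^-1 * Num.min (r * 2 ^+ j.+1) 1.
  have p : 0 < 2 ^+ j.+1 :> R by rewrite exprn_gt0.
  have e1 : 2^-1 ^+ j.+1 * 2 ^+ j.+1 = 1 :> R by rewrite -exprMn mulVf ?expr1n.
  rewrite -[X in Num.min (r * _) X]e1 -minr_pMl ?(ltW p)// [RHS]mulrCA.
  by congr (_ * _); rewrite [in RHS]exprS mulrA mulVf ?mul1r.
have p (k : nat) : 0 <= r * 2 ^+ k by rewrite mulr_ge0// exprn_ge0.
have : \sum_(j < J) Num.min (r * 2 ^+ j.+1) 1 <= 3 * (ln (1 + r * 2 ^+ J.+1) - ln (1 + r * 2)).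
  elim: J => [|J IH]; first by rewrite big_ord0 expr1 subrr mulr0.
  rewrite big_ord_recr/=; have := min_le_ln (p J.+1).
  by rewrite mulrCA -exprS; lra.
under [X in _ -> X <= _]eq_bigr do rewrite e.
rewrite -mulr_sumr.
have : 0 <= ln (1 + r * 2) by rewrite ln_ge0//; nra.
have : 0 <= ln (1 + r * 2 ^+ J.+1) by rewrite ln_ge0//; have := p J.+1; lra.
lra.
Qed.

Lemma dyadic_exponent (x : R) : 1 <= x -> exists J, 2 ^+ J <= x < 2 ^+ J.+1.
Proof.
move=> x1; have h : (0 < Num.truncn x)%N by rewrite truncn_gt0.
have x0 : 0 <= x by lra.
have /andP[h1 h2] := trunc_log_bounds (isT : (1 < 2)%N) h.
have /andP[t1 t2] := truncn_itv x0.
exists (trunc_log 2 (Num.truncn x)); apply/andP; split.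
  by apply: le_trans t1; rewrite -natrX ler_nat.
by apply: lt_le_trans t2 _; rewrite -natrX ler_nat.
Qed.

End dyadic_sum.

(** * Second moments of a point process *)

Lemma ge0_integralD4 d (T : measurableType d) (R : realType)
    (m : {measure set T -> \bar R}) (f1 f2 f3 f4 : T -> \bar R) :
  measurable_fun [set: T] f1 -> measurable_fun [set: T] f2 ->
  measurable_fun [set: T] f3 -> measurable_fun [set: T] f4 ->
  (forall x, 0 <= f1 x)%E -> (forall x, 0 <= f2 x)%E ->
  (forall x, 0 <= f3 x)%E -> (forall x, 0 <= f4 x)%E ->
  (\int[m]_x (f1 x + f2 x + (f3 x + f4 x)) =
   \int[m]_x f1 x + \int[m]_x f2 x + (\int[m]_x f3 x + \int[m]_x f4 x))%E.
Proof.
move=> mf1 mf2 mf3 mf4 f10 f20 f30 f40.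
rewrite ge0_integralD//; first last.
- exact: emeasurable_funD.
- by move=> x _; rewrite adde_ge0.
- exact: emeasurable_funD.
- by move=> x _; rewrite adde_ge0.
by rewrite !ge0_integralD.
Qed.

Lemma adde_rearrange (R : realDomainType) (a b c e c' e' : \bar R) :
  (c' <= c -> e' <= e -> a + b + (c' + e') <= (c + a) + (b + e))%E.
Proof. by move=> cc ee; rewrite (addeC c) [leRHS]addeACA; apply: leeD2l; exact: leeD. Qed.

Section second_moment.
Context {R : realType} {d : nat} {disp : measure_display} {T : measurableType disp}.
Variables (P : probability T R) (Y : T -> seq 'cV[R]_d).
Variables (m : {sigma_finite_measure set 'cV[R]_d -> \bar R}).
Variables (N : R) (rho : 'cV[R]_d -> 'cV[R]_d -> R).
Local Notation V := 'cV[R]_d.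
Hypothesis N0 : 0 <= N.
Hypothesis mrho : measurable_fun [set: V * V] (fun p => rho p.1 p.2).
Hypothesis rho0 : forall a b, 0 <= rho a b.
Hypothesis mY : forall B, measurable B -> measurable_fun [set: T] (fun w => npoints (Y w) B).
Hypothesis uY : {ae P, forall w, uniq (Y w)}.
Hypothesis Y1 : forall B, measurable B ->
  (\int[P]_w (npoints (Y w) B)%:R%:E = N%:E * m B)%E.
Hypothesis Y2 : forall B B', measurable B -> measurable B' -> B `&` B' = set0 ->
  (\int[P]_w ((npoints (Y w) B)%:R * (npoints (Y w) B')%:R)%:E =
   \int[m]_a \int[m]_b (\1_B a * \1_B' b * rho a b)%:E)%E.

Lemma npointsE (s : seq V) (B : set V) : (npoints s B)%:R = \sum_(y <- s) \1_B y :> R.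
Proof.
rewrite /npoints -sum1_count natr_sum big_mkcond/=; apply: eq_bigr => y _.
by rewrite indicE; case: ifP.
Qed.

Lemma measurable_npoints B : measurable B ->
  measurable_fun [set: T] (fun w => (npoints (Y w) B)%:R : R).
Proof.
move=> mB; apply: (@measurableT_comp _ _ _ _ _ _ (fun k : nat => k%:R : R)) => //.
exact: mY.
Qed.

(* The intensity hypothesis [Y2] only covers disjoint sets.  Pairs of distinct
   points are exhausted by pairs separated by one of the first k half spaces
   with rational threshold; splitting B and B' along E 0 reduces k + 1 to k. *)
Fixpoint separated (E : nat -> set V) (k : nat) (y z : V) : bool :=
  if k is k'.+1 then ((y \in E 0%N) != (z \in E 0%N)) || separated (E \o succn) k' y z
  else false.

Lemma separatedP E k y z : reflect (exists2 i, (i < k)%N & (y \in E i) != (z \in E i))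
  (separated E k y z).
Proof.
elim: k E => [|k IH] E /=; first by constructor => -[].
apply: (iffP orP) => [[h|/IH[i ik h]]|[[|i] ik h]]; first by exists 0%N.
- by exists i.+1.
- by left.
- by right; apply/IH; exists i.
Qed.

Definition pair_sum (B B' : set V) (E : nat -> set V) (k : nat) (s : seq V) : R :=
  \sum_(y <- s) \sum_(z <- s) \1_B y * \1_B' z * (separated E k y z)%:R.

Definition pair_mass (B B' : set V) : \bar R :=
  (\int[m]_a \int[m]_b (\1_B a * \1_B' b * rho a b)%:E)%E.

Lemma measurable_pair (B B' : set V) : measurable B -> measurable B' ->
  measurable_fun [set: V * V] (fun p => (\1_B p.1 * \1_B' p.2 * rho p.1 p.2)%:E).
Proof.
move=> mB mB'; apply/measurable_EFinP; apply: measurable_funM => //.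
apply: measurable_funM.
  by apply: (@measurableT_comp _ _ _ _ _ _ (\1_B : V -> R)) => //; exact: measurable_indic.
by apply: (@measurableT_comp _ _ _ _ _ _ (\1_B' : V -> R)) => //; exact: measurable_indic.
Qed.

Lemma pair_mass_splitl B B' F : measurable B -> measurable B' -> measurable F ->
  (pair_mass B B' = pair_mass (B `&` F) B' + pair_mass (B `&` ~` F) B')%E.
Proof.
move=> mB mB' mF; have mFC : measurable (~` F) by exact: measurableC.
have mBF : measurable (B `&` F) by exact: measurableI.
have mBFC : measurable (B `&` ~` F) by exact: measurableI.
have p0 (B1 B2 : set V) a b : (0 <= (\1_B1 a * \1_B2 b * rho a b)%:E :> \bar R)%E.
  by rewrite lee_fin !mulr_ge0.
rewrite /pair_mass -ge0_integralD//; first last.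
- exact: (measurable_fun_fubini_tonelli_F (fun p : V * V => _) (measurable_pair mBFC mB')).
- by move=> a _; exact: integral_ge0.
- exact: (measurable_fun_fubini_tonelli_F (fun p : V * V => _) (measurable_pair mBF mB')).
- by move=> a _; exact: integral_ge0.
apply: eq_integral => a _; rewrite -ge0_integralD//; first last.
- exact: (measurable_fun_pair2 a (measurable_pair mBFC mB')).
- exact: (measurable_fun_pair2 a (measurable_pair mBF mB')).
apply: eq_integral => b _; rewrite -EFinD; congr EFin.
rewrite !indicE !in_setI in_setC; case: (a \in B); case: (a \in F);
  by rewrite /= ?mul0r ?mul1r ?addr0 ?add0r.
Qed.

Lemma pair_mass_splitr B B' F : measurable B -> measurable B' -> measurable F ->
  (pair_mass B B' = pair_mass B (B' `&` F) + pair_mass B (B' `&` ~` F))%E.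
Proof.
move=> mB mB' mF; have mFC : measurable (~` F) by exact: measurableC.
have mBF : measurable (B' `&` F) by exact: measurableI.
have mBFC : measurable (B' `&` ~` F) by exact: measurableI.
have p0 (B1 B2 : set V) a b : (0 <= (\1_B1 a * \1_B2 b * rho a b)%:E :> \bar R)%E.
  by rewrite lee_fin !mulr_ge0.
rewrite /pair_mass -ge0_integralD//; first last.
- exact: (measurable_fun_fubini_tonelli_F (fun p : V * V => _) (measurable_pair mB mBFC)).
- by move=> a _; exact: integral_ge0.
- exact: (measurable_fun_fubini_tonelli_F (fun p : V * V => _) (measurable_pair mB mBF)).
- by move=> a _; exact: integral_ge0.
apply: eq_integral => a _; rewrite -ge0_integralD//; first last.
- exact: (measurable_fun_pair2 a (measurable_pair mB mBFC)).
- exact: (measurable_fun_pair2 a (measurable_pair mB mBF)).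
apply: eq_integral => b _; rewrite -EFinD; congr EFin.
rewrite !indicE !in_setI in_setC; case: (b \in B'); case: (b \in F);
  by rewrite /= ?mulr0 ?mulr1 ?mul0r ?addr0 ?add0r.
Qed.

Lemma pair_sum_ge0 B B' E k s : 0 <= pair_sum B B' E k s.
Proof. by do 2 (apply: sumr_ge0 => ? _); rewrite !mulr_ge0. Qed.

Lemma pair_sumS B B' E k s : pair_sum B B' E k.+1 s =
  (npoints s (B `&` E 0%N))%:R * (npoints s (B' `&` ~` E 0%N))%:R +
  (npoints s (B `&` ~` E 0%N))%:R * (npoints s (B' `&` E 0%N))%:R +
  (pair_sum (B `&` E 0%N) (B' `&` E 0%N) (E \o succn) k s +
   pair_sum (B `&` ~` E 0%N) (B' `&` ~` E 0%N) (E \o succn) k s).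
Proof.
rewrite !npointsE !mulr_suml /pair_sum -!big_split/=; apply: eq_bigr => y _.
rewrite !mulr_sumr -!big_split/=; apply: eq_bigr => z _.
rewrite !indicE !in_setI !in_setC.
by case: (y \in B); case: (z \in B'); case: (y \in E 0%N); case: (z \in E 0%N);
  rewrite /= ?(mul0r, mulr0, mul1r, mulr1, addr0, add0r).
Qed.

(** By [pair_sumS], pairs split by [E 0] give products of counts of disjoint sets, for which [Y2] is
    exact; the remaining pairs lie on one side of [E 0] and fall under the induction. The result is
    an inequality because the mass of pairs never separated is discarded. *)
Lemma pair_sum_expect k : forall B B' E, measurable B -> measurable B' ->
  (forall i, measurable (E i)) ->
  measurable_fun [set: T] (fun w => (pair_sum B B' E k (Y w))%:E) /\
  (\int[P]_w (pair_sum B B' E k (Y w))%:E <= pair_mass B B')%E.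
Proof.
elim: k => [|k IH] B B' E mB mB' mE.
  have e w : pair_sum B B' E 0 (Y w) = 0.
    by rewrite /pair_sum big1// => y _; rewrite big1// => z _; rewrite /= mulr0.
  split; first by under [X in measurable_fun _ X]eq_fun do rewrite e; exact: measurable_cst.
  under eq_integral do rewrite e; rewrite integral0.
  by apply: integral_ge0 => a _; apply: integral_ge0 => b _; rewrite lee_fin !mulr_ge0.
have mEC : measurable (~` E 0%N) by exact: measurableC.
have m1 : measurable (B `&` E 0%N) by exact: measurableI.
have m2 : measurable (B `&` ~` E 0%N) by exact: measurableI.
have m3 : measurable (B' `&` E 0%N) by exact: measurableI.
have m4 : measurable (B' `&` ~` E 0%N) by exact: measurableI.
have mES i : measurable ((E \o succn) i) by exact: mE.
have [q1 q2] := IH _ _ _ m1 m3 mES; have [q3 q4] := IH _ _ _ m2 m4 mES.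
have mm C C' : measurable C -> measurable C' ->
    measurable_fun [set: T] (fun w => ((npoints (Y w) C)%:R * (npoints (Y w) C')%:R : R)%:E).
  by move=> mC mC'; apply/measurable_EFinP; apply: measurable_funM; exact: measurable_npoints.
have d1 : (B `&` E 0%N) `&` (B' `&` ~` E 0%N) = set0.
  by rewrite -subset0 => x [[_ h] [_ h']].
have d2 : (B `&` ~` E 0%N) `&` (B' `&` E 0%N) = set0.
  by rewrite -subset0 => x [[_ h] [_ h']].
have eqS w : ((pair_sum B B' E k.+1 (Y w))%:E =
    ((npoints (Y w) (B `&` E 0%N))%:R * (npoints (Y w) (B' `&` ~` E 0%N))%:R)%:E +
    ((npoints (Y w) (B `&` ~` E 0%N))%:R * (npoints (Y w) (B' `&` E 0%N))%:R)%:E +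
    ((pair_sum (B `&` E 0%N) (B' `&` E 0%N) (E \o succn) k (Y w))%:E +
     (pair_sum (B `&` ~` E 0%N) (B' `&` ~` E 0%N) (E \o succn) k (Y w))%:E))%E.
  by rewrite pair_sumS !EFinD.
split.
  under [X in measurable_fun _ X]eq_fun do rewrite eqS.
  by apply: emeasurable_funD; apply: emeasurable_funD => //; exact: mm.
have n0 C C' w : (0 <= ((npoints (Y w) C)%:R * (npoints (Y w) C')%:R : R)%:E)%E.
  by rewrite lee_fin mulr_ge0.
have s0 C C' F w : (0 <= (pair_sum C C' F k (Y w))%:E)%E by rewrite lee_fin pair_sum_ge0.
have := ge0_integralD4 P (mm _ _ m1 m4) (mm _ _ m2 m3) q1 q3 (n0 _ _) (n0 _ _) (s0 _ _ _) (s0 _ _ _).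
rewrite (Y2 m1 m4 d1) (Y2 m2 m3 d2) => eqI.
rewrite (etrans (eq_integral _ _ (fun w _ => eqS w)) eqI).
rewrite (pair_mass_splitl mB mB' (mE 0%N)) (pair_mass_splitr m1 mB' (mE 0%N)) (pair_mass_splitr m2 mB' (mE 0%N)).
exact: (adde_rearrange _ _ q2 q4).
Qed.

(** [unpickle] enumerates the pairs of a coordinate and a rational; a number coding no pair gives
    the empty set, which separates nothing. *)
Definition half_space (i : nat) : set V :=
  if unpickle i is Some (j, q) then [set x | x (j : 'I_d) ord0 < ratr (q : rat)] else set0.

Lemma measurable_half_space i : measurable (half_space i).
Proof.
rewrite /half_space; case: unpickle => [[j q]|]//.
by apply: measurable_set_lt => //; exact: measurable_coord.
Qed.

Lemma half_space_separates (y z : V) : y != z ->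
  exists i, (y \in half_space i) != (z \in half_space i).
Proof.
move=> yz; have [j yzj] : exists j, y j ord0 != z j ord0.
  apply/existsP; rewrite -negb_forall; apply: contraNN yz => /forallP h.
  by apply/eqP/matrixP => i k; rewrite ord1; exact/eqP.
wlog lt : y z yz yzj / y j ord0 < z j ord0 => [H|].
  have [h|h|h] := ltgtP (y j ord0) (z j ord0); last by rewrite h eqxx in yzj.
    exact: H.
  have [|||i hi] := H z y => //; first by rewrite eq_sym.
    by rewrite eq_sym.
  by exists i; rewrite eq_sym.
have [q] := rat_in_itvoo lt; rewrite in_itv/= => /andP[q1 q2].
exists (pickle (j, q)); rewrite /half_space pickleK.
by rewrite mem_set//= memNset//=; apply/negP; rewrite -leNgt ltW.
Qed.

Lemma separated_all (s : seq V) : exists K : nat, forall k y z, (K <= k)%N ->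
  y \in s -> z \in s -> separated half_space k y z = (y != z).
Proof.
have one (y z : V) : exists K : nat, forall k, (K <= k)%N ->
    separated half_space k y z = (y != z).
  have [->|yz] := eqVneq y z.
    by exists 0%N => k _; apply/negP => /separatedP[i _]; rewrite eqxx.
  have [i hi] := half_space_separates yz.
  by exists i.+1 => k ik; apply/separatedP; exists i.
have [f hf] := choice (fun p : V * V => one p.1 p.2).
exists (\max_(p <- [seq (y, z) | y <- s, z <- s]) f p) => k y z fk ys zs.
apply: (hf (y, z)); apply: leq_trans fk.
have yzs : (y, z) \in [seq (y, z) | y <- s, z <- s].
  by apply/allpairsP; exists (y, z).
by rewrite (big_rem _ yzs)/= leq_maxl.
Qed.

(** Simplicity enters here: in a list without repetition a pair of equal points is a single point of
    the intersection. All pairs of different points are separated from some index on, the list being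
    finite. *)
Lemma pair_sum_limit (B B' : set V) (s : seq V) : uniq s ->
  exists K : nat, forall k, (K <= k)%N ->
  (npoints s B)%:R * (npoints s B')%:R = (npoints s (B `&` B'))%:R + pair_sum B B' half_space k s.
Proof.
move=> us; have [K hK] := separated_all s; exists K => k Kk.
rewrite !npointsE mulr_suml /pair_sum -big_split/= big_seq [RHS]big_seq.
apply: eq_bigr => y ys; rewrite mulr_sumr.
rewrite [X in _ = X + _](_ : _ = \sum_(z <- s) \1_B y * \1_B' z * (y == z)%:R); last first.
  rewrite (bigD1_seq y)//= eqxx big1 ?addr0; last first.
    by move=> z /negbTE; rewrite eq_sym => ->; rewrite mulr0.
  by rewrite mulr1 !indicE in_setI; case: (y \in B); case: (y \in B'); rewrite ?mulr1 ?mulr0 ?mul0r.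
rewrite -big_split/= big_seq [RHS]big_seq; apply: eq_bigr => z zs.
by rewrite hK//; case: eqP => _; rewrite /= ?mulr0 ?mulr1 ?addr0 ?add0r.
Qed.

(** Almost surely the truncated pair sums increase to the sum over pairs of distinct points;
    monotone convergence carries the bound of [pair_sum_expect], uniform in k, to the limit. *)
Lemma second_moment B B' : measurable B -> measurable B' ->
  (\int[P]_w ((npoints (Y w) B)%:R * (npoints (Y w) B')%:R)%:E <=
   N%:E * m (B `&` B') + pair_mass B B')%E.
Proof.
move=> mB mB'.
pose f k w := (pair_sum B B' half_space k (Y w))%:E.
have pe k := pair_sum_expect k mB mB' measurable_half_space.
have mf k : measurable_fun [set: T] (f k) by exact: (pe k).1.
have f0 k w : (0 <= f k w)%E by rewrite lee_fin pair_sum_ge0.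
have fnd w : {homo f^~ w : k l / (k <= l)%N >-> (k <= l)%E}.
  move=> k l kl; rewrite lee_fin; apply: ler_sum => y _; apply: ler_sum => z _.
  apply: ler_wpM2l; first by rewrite mulr_ge0.
  rewrite ler_nat; case: (boolP (separated _ k y z)) => // /separatedP[i ik h].
  by rewrite (_ : separated _ l y z)//; apply/separatedP; exists i => //; exact: leq_trans kl.
have mBB : measurable (B `&` B') by exact: measurableI.
have cvgf w : cvgn (f^~ w) by exact: ereal_nondecreasing_is_cvgn.
have mlim : measurable_fun [set: T] (fun w => limn (f^~ w)).
  under [X in measurable_fun _ X]eq_fun do rewrite -is_cvg_limn_esupE//.
  exact: measurable_fun_limn_esup.
have lim0 w : (0 <= limn (f^~ w))%E by apply: lime_ge => //; apply: nearW => k; exact: f0.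
have mint : measurable_fun [set: T] (fun w => (npoints (Y w) (B `&` B'))%:R%:E : \bar R).
  by apply/measurable_EFinP; exact: measurable_npoints.
apply: (@le_trans _ _ (\int[P]_w ((npoints (Y w) (B `&` B'))%:R%:E + limn (f^~ w)))%E).
  apply: ae_ge0_le_integral => //.
  - by apply/measurable_EFinP; apply: measurable_funM; exact: measurable_npoints.
  - by move=> w _; rewrite adde_ge0// lee_fin.
  - exact: emeasurable_funD.
  apply: filterS uY => w us _.
  have [K hK] := pair_sum_limit B B' us.
  rewrite (hK K)// EFinD leeD2l//.
  have -> : limn (f^~ w) = f K w; last by [].
  apply: cvg_lim => //; apply: cvg_near_cst; exists K => // k /= Kk.
  by congr EFin; apply: (addrI (npoints (Y w) (B `&` B'))%:R); rewrite -!hK.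
rewrite ge0_integralD// Y1//; apply: leeD2l.
rewrite monotone_convergence//.
apply: lime_le.
  apply: ereal_nondecreasing_is_cvgn => k l kl.
  by apply: ge0_le_integral => // w _; exact: fnd.
by apply: nearW => k; exact: (pe k).2.
Qed.

End second_moment.

(* X is the variance, S the second moment and c the squared mean of a linear
   statistic, F = N int f^2, and J1, J2 are the integrals of f(a) f(b) against
   N^2 - |K|^2 and |K|^2.  Neither S nor F is known to be finite. *)
Lemma le_cancel_variance (R : realType) (X S F J1 J2 H : \bar R) (c : R) :
  (X + (2 * c)%:E = S + c%:E)%E -> (S <= F + J1)%E -> (J1 + J2 = c%:E)%E ->
  (H + J2 = F)%E -> (0 <= J1)%E -> (0 <= J2)%E -> (X <= H)%E.
Proof.
move=> E1 SF E2 E3 J10 J20.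
(* Only [J2] has to be finite to be cancelled, and it is bounded by [c]. *)
have J2f : J2 \is a fin_num.
  rewrite ge0_fin_numE//; apply: (@le_lt_trans _ _ c%:E); last exact: ltry.
  by rewrite -E2 leeDr.
rewrite -(leeD2rE _ _ J2f) E3 -(@leeD2rE _ (2 * c)%:E)// addeAC E1.
apply: (@le_trans _ _ (F + J1 + c%:E + J2)%E).
  by apply: leeD => //; apply: leeD => //.
rewrite -!addeA; apply: leeD => //.
by rewrite addeCA E2 -EFinD lee_fin; lra.
Qed.

(** * Variance of a linear statistic *)

Section linear_statistic.
Context {R : realType} {d : nat} {disp : measure_display} {T : measurableType disp}.
Variables (P : probability T R) (Y : T -> seq 'cV[R]_d).
Variables (m : {sigma_finite_measure set 'cV[R]_d -> \bar R}).
Variables (N : R) (kap : 'cV[R]_d -> 'cV[R]_d -> R).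
Local Notation V := 'cV[R]_d.
Hypothesis N0 : 0 <= N.
Hypothesis mkap : measurable_fun [set: V * V] (fun p => kap p.1 p.2).
Hypothesis kap0 : forall a b, 0 <= kap a b.
Hypothesis kapN : forall a b, kap a b <= N ^+ 2.
Hypothesis ikap1 : forall a, (\int[m]_b (kap a b)%:E = N%:E)%E.
Hypothesis ikap2 : forall b, (\int[m]_a (kap a b)%:E = N%:E)%E.
Hypothesis mY : forall B, measurable B -> measurable_fun [set: T] (fun w => npoints (Y w) B).
Hypothesis uY : {ae P, forall w, uniq (Y w)}.
Hypothesis Y1 : forall B, measurable B ->
  (\int[P]_w (npoints (Y w) B)%:R%:E = N%:E * m B)%E.
Hypothesis Y2 : forall B B', measurable B -> measurable B' -> B `&` B' = set0 ->
  (\int[P]_w ((npoints (Y w) B)%:R * (npoints (Y w) B')%:R)%:E =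
   \int[m]_a \int[m]_b (\1_B a * \1_B' b * (N ^+ 2 - kap a b))%:E)%E.

Variables (I : Type) (s : seq I) (B : I -> set V).
Hypothesis mB : forall i, measurable (B i).

(** A finite sum of indicators, so that moments reduce to counts of sets; the function p(x - y) of y
    will have this form. *)
Let f (y : V) : R := \sum_(i <- s) \1_(B i) y.
Let F (w : T) : R := \sum_(y <- Y w) f y.

Lemma statisticE w : F w = \sum_(i <- s) (npoints (Y w) (B i))%:R.
Proof. by rewrite /F /f exchange_big; apply: eq_bigr => i _; rewrite npointsE. Qed.

Let f0 y : 0 <= f y. Proof. exact: sumr_ge0. Qed.
Let F0 w : 0 <= F w. Proof. exact: sumr_ge0. Qed.

Let mf : measurable_fun [set: V] f.
Proof. by apply: measurable_sumR => i; exact: measurable_indic. Qed.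

Let mF : measurable_fun [set: T] F.
Proof.
rewrite (_ : F = fun w => \sum_(i <- s) (npoints (Y w) (B i))%:R); last first.
  by apply/funext => w; exact: statisticE.
by apply: measurable_sumR => i; exact: measurable_npoints.
Qed.

Let mf1 : measurable_fun [set: V * V] (fun p => f p.1).
Proof. exact: measurableT_comp. Qed.

Let mf2 : measurable_fun [set: V * V] (fun p => f p.2).
Proof. exact: measurableT_comp. Qed.

Lemma statistic_mean (c : R) : (c%:E = N%:E * \int[m]_y (f y)%:E)%E ->
  (\int[P]_w (F w)%:E = c%:E)%E.
Proof.
move=> ->.
transitivity (\int[P]_w \sum_(i <- s) (npoints (Y w) (B i))%:R%:E)%E.
  by apply: eq_integral => w _; rewrite statisticE sumEFin.
rewrite ge0_integral_sum//; last first.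
  by move=> i; apply/measurable_EFinP; exact: measurable_npoints.
transitivity (N%:E * \int[m]_y \sum_(i <- s) (\1_(B i) y : R)%:E)%E; last first.
  by congr (_ * _)%E; apply: eq_integral => y _; rewrite sumEFin.
rewrite ge0_integral_sum//; last by move=> i; apply: measurable_indicE.
rewrite ge0_sume_distrr; last by move=> i _; apply: integral_ge0 => y _; rewrite lee_fin.
by apply: eq_bigr => i _; rewrite Y1// integral_indic// setIT.
Qed.

Let rho0 a b : 0 <= N ^+ 2 - kap a b. Proof. by rewrite subr_ge0. Qed.
Let mrho : measurable_fun [set: V * V] (fun p => N ^+ 2 - kap p.1 p.2).
Proof. exact: measurable_funB. Qed.

Lemma statistic_second_moment :
  (\int[P]_w (F w ^+ 2)%:E <= N%:E * \int[m]_y (f y ^+ 2)%:E +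
   \int[m]_a \int[m]_b (f a * f b * (N ^+ 2 - kap a b))%:E)%E.
Proof.
pose q : seq (I * I) := [seq (i, j) | i <- s, j <- s].
have mn i := measurable_npoints mY (mB i).
have allpairsE (u v : I -> R) : (\sum_(i <- s) u i) * (\sum_(j <- s) v j) =
    \sum_(p <- q) u p.1 * v p.2.
  rewrite /q big_allpairs_dep/= mulr_suml; apply: eq_bigr => i _.
  by rewrite mulr_sumr.
pose g p w := ((npoints (Y w) (B p.1))%:R * (npoints (Y w) (B p.2))%:R : R)%:E.
have mg p : measurable_fun [set: T] (g p).
  by apply/measurable_EFinP; apply: measurable_funM; exact: mn.
have g0 p w : (0 <= g p w)%E by rewrite lee_fin mulr_ge0.
pose h p y := (\1_(B p.1) y * \1_(B p.2) y : R)%:E.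
have mh p : measurable_fun [set: V] (h p).
  by apply/measurable_EFinP; apply: measurable_funM; exact: measurable_indic.
have h0 p y : (0 <= h p y)%E by rewrite lee_fin mulr_ge0.
pose k p a b := (\1_(B p.1) a * \1_(B p.2) b * (N ^+ 2 - kap a b))%:E.
have mk p : measurable_fun [set: V * V] (fun u => k p u.1 u.2).
  exact: (@measurable_pair _ _ (fun a b => N ^+ 2 - kap a b) mrho _ _ (mB p.1) (mB p.2)).
have k0 p a b : (0 <= k p a b)%E by rewrite lee_fin !mulr_ge0.
have -> : (\int[P]_w (F w ^+ 2)%:E = \sum_(p <- q) \int[P]_w g p w)%E.
  rewrite -ge0_integral_sum//; apply: eq_integral => w _.
  by rewrite sumEFin; congr EFin; rewrite expr2 statisticE allpairsE.
have -> : (\int[m]_y (f y ^+ 2)%:E = \sum_(p <- q) \int[m]_y h p y)%E.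
  rewrite -ge0_integral_sum//; apply: eq_integral => y _.
  by rewrite sumEFin; congr EFin; rewrite expr2 /f allpairsE.
have -> : (\int[m]_a \int[m]_b (f a * f b * (N ^+ 2 - kap a b))%:E =
    \sum_(p <- q) \int[m]_a \int[m]_b k p a b)%E.
  rewrite -ge0_integral_sum//; first last.
  - by move=> p a _; exact: integral_ge0.
  - by move=> p; exact: (measurable_fun_fubini_tonelli_F (fun u : V * V => k p u.1 u.2) (mk p)).
  apply: eq_integral => a _; rewrite -ge0_integral_sum//; last first.
    by move=> p; exact: (measurable_fun_pair2 a (mk p)).
  apply: eq_integral => b _; rewrite sumEFin; congr EFin.
  by rewrite /f allpairsE mulr_suml.
rewrite ge0_sume_distrr; last by move=> p _; exact: integral_ge0.
rewrite -big_split/=; apply: lee_sum => p _.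
have -> : (\int[m]_y h p y = m (B p.1 `&` B p.2))%E.
  transitivity (\int[m]_y (\1_(B p.1 `&` B p.2) y : R)%:E)%E.
    by apply: eq_integral => y _; rewrite /h indicI.
  by rewrite integral_indic ?setIT//; exact: measurableI.
exact: (@second_moment _ _ _ _ P Y m N (fun a b => N ^+ 2 - kap a b) mrho rho0 mY uY Y1 Y2 _ _ (mB p.1) (mB p.2)).
Qed.

(** The variance is at most N int f^2 minus the double integral of f(a) f(b) [kap]. Both marginals
    of [kap] integrate to [N], so N int f^2 is the double integral of (f(a)^2 + f(b)^2) / 2 against
    [kap], and the square is completed. [E1], [E2] and [E3] are these identities written without
    subtraction of integrals. *)
Lemma statistic_variance (c : R) : m setT = 1%E ->
  (c%:E = N%:E * \int[m]_y (f y)%:E)%E ->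
  (\int[P]_w ((F w - c) ^+ 2)%:E <=
   (2^-1)%:E * \int[m]_a \int[m]_b ((f a - f b) ^+ 2 * kap a b)%:E)%E.
Proof.
move=> m1 cE.
have c0 : 0 <= c.
  by rewrite -lee_fin cE mule_ge0 ?lee_fin//; apply: integral_ge0 => y _; rewrite lee_fin.
have cst (b : R) : (\int[P]_w b%:E = b%:E)%E.
  rewrite integral_cst// [X in (_ * X)%E](_ : _ = 1%E) ?mule1//.
  exact: probability_setT.
have mFE : measurable_fun [set: T] (fun w => (F w)%:E) by exact/measurable_EFinP.
have mF2 : measurable_fun [set: T] (fun w => (F w ^+ 2)%:E).
  by apply/measurable_EFinP; exact: measurable_funX.
have mFc : measurable_fun [set: T] (fun w => ((F w - c) ^+ 2)%:E).
  by apply/measurable_EFinP; apply: measurable_funX; exact: measurable_funB.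
have E1 : (\int[P]_w ((F w - c) ^+ 2)%:E + (2 * c ^+ 2)%:E =
    \int[P]_w (F w ^+ 2)%:E + (c ^+ 2)%:E)%E.
  have -> : ((2 * c ^+ 2)%:E = \int[P]_w ((2 * c)%:E * (F w)%:E))%E.
    rewrite ge0_integralZl_EFin ?mulr_ge0//; last by move=> w _; rewrite lee_fin.
    by rewrite (statistic_mean cE) -EFinM; congr EFin; ring.
  have g0 w : (0 <= ((F w - c) ^+ 2)%:E)%E by rewrite lee_fin sqr_ge0.
  have g1 w : (0 <= (2 * c)%:E * (F w)%:E)%E by rewrite -EFinM lee_fin !mulr_ge0.
  have g2 w : (0 <= (F w ^+ 2)%:E)%E by rewrite lee_fin sqr_ge0.
  have g3 : (0 <= (c ^+ 2)%:E)%E by rewrite lee_fin sqr_ge0.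
  have mg1 : measurable_fun [set: T] (fun w => (2 * c)%:E * (F w)%:E)%E.
    exact: emeasurable_funM.
  rewrite -[in RHS](cst (c ^+ 2)) -!ge0_integralD//.
  by apply: eq_integral => w _; rewrite -EFinM -!EFinD; congr EFin; ring.
have mJ1 : measurable_fun [set: V * V] (fun u => (f u.1 * f u.2 * (N ^+ 2 - kap u.1 u.2))%:E).
  by apply/measurable_EFinP; do 2 (apply: measurable_funM => //).
have mJ2 : measurable_fun [set: V * V] (fun u => (f u.1 * f u.2 * kap u.1 u.2)%:E).
  by apply/measurable_EFinP; do 2 (apply: measurable_funM => //).
have mJ3 : measurable_fun [set: V * V] (fun u => ((f u.1 - f u.2) ^+ 2 * kap u.1 u.2)%:E).
  apply/measurable_EFinP; apply: measurable_funM => //; apply: measurable_funX.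
  exact: measurable_funB.
pose J1 := (\int[m]_a \int[m]_b (f a * f b * (N ^+ 2 - kap a b))%:E)%E.
pose J2 := (\int[m]_a \int[m]_b (f a * f b * kap a b)%:E)%E.
pose J3 := (\int[m]_a \int[m]_b ((f a - f b) ^+ 2 * kap a b)%:E)%E.
have D2 (u v : V -> V -> \bar R) :
    measurable_fun [set: V * V] (fun p => u p.1 p.2) ->
    measurable_fun [set: V * V] (fun p => v p.1 p.2) ->
    (forall a b, 0 <= u a b)%E -> (forall a b, 0 <= v a b)%E ->
    (\int[m]_a \int[m]_b (u a b + v a b) =
     \int[m]_a \int[m]_b u a b + \int[m]_a \int[m]_b v a b)%E.
  move=> mu mv u0 v0; rewrite -ge0_integralD//; first last.
  - exact: (measurable_fun_fubini_tonelli_F (fun p : V * V => v p.1 p.2) mv).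
  - by move=> a _; exact: integral_ge0.
  - exact: (measurable_fun_fubini_tonelli_F (fun p : V * V => u p.1 p.2) mu).
  - by move=> a _; exact: integral_ge0.
  apply: eq_integral => a _; rewrite -ge0_integralD//.
  - exact: (measurable_fun_pair2 a mu).
  - exact: (measurable_fun_pair2 a mv).
have q1 a b : (0 <= (f a * f b * (N ^+ 2 - kap a b))%:E)%E by rewrite lee_fin !mulr_ge0.
have q2 a b : (0 <= (f a * f b * kap a b)%:E)%E by rewrite lee_fin !mulr_ge0.
have mfE : measurable_fun [set: V] (fun a => (f a)%:E) by exact/measurable_EFinP.
have fE0 a : (0 <= (f a)%:E)%E by rewrite lee_fin.
have E2 : (J1 + J2 = (c ^+ 2)%:E)%E.
  rewrite -(D2 _ _ mJ1 mJ2 q1 q2).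
  transitivity (\int[m]_a ((N * f a)%:E * (N%:E * \int[m]_b (f b)%:E)))%E.
    apply: eq_integral => a _; rewrite muleA -EFinM -ge0_integralZl_EFin ?mulr_ge0//.
    by apply: eq_integral => b _; rewrite -EFinM -EFinD; congr EFin; ring.
  rewrite -cE.
  transitivity (\int[m]_a ((c * N)%:E * (f a)%:E))%E.
    by apply: eq_integral => a _; rewrite -!EFinM; congr EFin; ring.
  by rewrite ge0_integralZl_EFin ?mulr_ge0// EFinM -muleA -cE -EFinM expr2.
pose h a b := ((2^-1 * f a ^+ 2) * kap a b)%:E.
have mh : measurable_fun [set: V * V] (fun u => h u.1 u.2).
  by apply/measurable_EFinP; do 2 (apply: measurable_funM => //); exact: measurable_funX.
pose h' a b := ((2^-1 * f b ^+ 2) * kap a b)%:E.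
have mh' : measurable_fun [set: V * V] (fun u => h' u.1 u.2).
  by apply/measurable_EFinP; do 2 (apply: measurable_funM => //); exact: measurable_funX.
have h0 a b : (0 <= h a b)%E by rewrite lee_fin !mulr_ge0 ?sqr_ge0.
have h'0 a b : (0 <= h' a b)%E by rewrite lee_fin !mulr_ge0 ?sqr_ge0.
have mf2h : measurable_fun [set: V] (fun a => (2^-1 * f a ^+ 2 : R)%:E).
  by apply/measurable_EFinP; apply: measurable_funM => //; exact: measurable_funX.
have hI : (\int[m]_a (2^-1 * f a ^+ 2 * N)%:E = (2^-1)%:E * (N%:E * \int[m]_a (f a ^+ 2)%:E))%E.
  rewrite muleA -EFinM -ge0_integralZl_EFin ?mulr_ge0//; first last.
  - by apply/measurable_EFinP; exact: measurable_funX.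
  - by move=> a _; rewrite lee_fin sqr_ge0.
  by apply: eq_integral => a _; rewrite -EFinM; congr EFin; ring.
have mkE : measurable_fun [set: V * V] (fun p => (kap p.1 p.2)%:E) by exact/measurable_EFinP.
have mk1 a : measurable_fun [set: V] (fun b => (kap a b)%:E) by exact: (measurable_fun_pair2 a mkE).
have mk2 b : measurable_fun [set: V] (fun a => (kap a b)%:E) by exact: (measurable_fun_pair1 b mkE).
have kE0 a b : (0 <= (kap a b)%:E)%E by rewrite lee_fin.
have sq0 a : 0 <= 2^-1 * f a ^+ 2 by rewrite mulr_ge0 ?sqr_ge0.
have hE : (\int[m]_a \int[m]_b h a b = (2^-1)%:E * (N%:E * \int[m]_a (f a ^+ 2)%:E))%E.
  by rewrite -hI; apply: eq_integral => a _; rewrite EFinM -(ikap1 a) -ge0_integralZl_EFin.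
have h'E : (\int[m]_a \int[m]_b h' a b = (2^-1)%:E * (N%:E * \int[m]_a (f a ^+ 2)%:E))%E.
  rewrite tonelli// -hI; apply: eq_integral => b _.
  by rewrite EFinM -(ikap2 b) -ge0_integralZl_EFin.
have J30 a b : (0 <= ((f a - f b) ^+ 2 * kap a b)%:E)%E by rewrite lee_fin mulr_ge0 ?sqr_ge0.
have halfJ3 : ((2^-1)%:E * J3 = \int[m]_a \int[m]_b ((2^-1)%:E * ((f a - f b) ^+ 2 * kap a b)%:E))%E.
  have mI3 : measurable_fun [set: V] (fun a => \int[m]_b ((f a - f b) ^+ 2 * kap a b)%:E)%E.
    exact: (measurable_fun_fubini_tonelli_F (fun p : V * V => ((f p.1 - f p.2) ^+ 2 * kap p.1 p.2)%:E) mJ3).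
  have I30 a : (0 <= \int[m]_b ((f a - f b) ^+ 2 * kap a b)%:E)%E by exact: integral_ge0.
  rewrite /J3 -ge0_integralZl_EFin//.
  apply: eq_integral => a _; rewrite -ge0_integralZl_EFin//.
  exact: (measurable_fun_pair2 a mJ3).
have E3 : ((2^-1)%:E * J3 + J2 = N%:E * \int[m]_a (f a ^+ 2)%:E)%E.
  have -> : (N%:E * \int[m]_a (f a ^+ 2)%:E = \int[m]_a \int[m]_b h a b + \int[m]_a \int[m]_b h' a b)%E.
    rewrite hE h'E -ge0_muleDl//.
    by rewrite -EFinD (_ : 2^-1 + 2^-1 = 1 :> R) ?mul1e//; field.
  have mJ3h : measurable_fun [set: V * V] (fun u => ((2^-1)%:E * ((f u.1 - f u.2) ^+ 2 * kap u.1 u.2)%:E)%E).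
    exact: emeasurable_funM.
  have J30h a b : (0 <= (2^-1)%:E * ((f a - f b) ^+ 2 * kap a b)%:E)%E by rewrite mule_ge0.
  rewrite halfJ3 -(D2 _ _ mJ3h mJ2 J30h q2) -(D2 _ _ mh mh' h0 h'0).
  apply: eq_integral => a _; apply: eq_integral => b _.
  by rewrite -EFinM -!EFinD; congr EFin; field.
have J20 : (0 <= J2)%E.
  by apply: integral_ge0 => a _; apply: integral_ge0 => b _; rewrite lee_fin !mulr_ge0.
have J10 : (0 <= J1)%E.
  by apply: integral_ge0 => a _; apply: integral_ge0 => b _; rewrite lee_fin !mulr_ge0.
exact: (le_cancel_variance E1 statistic_second_moment E2 E3 J10 J20).
Qed.

End linear_statistic.

(** * Variance over a random translate *)

Section joint_measurability.
Context {R : realType} {d : nat} {disp : measure_display} {T : measurableType disp}.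
Variable Y : T -> seq 'cV[R]_d.
Local Notation V := 'cV[R]_d.
Hypothesis mY : forall B, measurable B -> measurable_fun [set: T] (fun w => npoints (Y w) B).

Lemma trivIset_partial_sums (F : nat -> set (V * V)) (u : V * V) : trivIset setT F ->
  exists K : nat, forall k, (K <= k)%N ->
  \sum_(i < k) \1_(F i) u = \1_(\bigcup_i F i) u :> R.
Proof.
move=> tF; have [uF|uF] := boolP (u \in \bigcup_i F i); last first.
  exists 0%N => k _; rewrite big1.
    by rewrite indicE (negbTE uF).
  move=> i _; rewrite indicE memNset// => ui; move/negP: uF; apply.
  by rewrite inE; exists i.
have [i _ ui] := set_mem uF; exists i.+1 => k ik.
rewrite (bigD1 (Ordinal ik))//= big1 ?addr0; first by rewrite !indicE uF mem_set.
move=> j /eqP ji; rewrite indicE memNset// => uj.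
apply: ji; apply/val_inj => /=; apply: (tF _ _ Logic.I Logic.I).
by exists u.
Qed.

(** Only counts of fixed sets are known to be measurable. On a rectangle the sum is an indicator
    times such a count, and Dynkin's theorem extends this to all measurable sets of the product. *)
Lemma measurable_point_count (E : set (V * V)) : measurable E ->
  measurable_fun [set: T * V] (fun q => \sum_(y <- Y q.1) \1_E (q.2, y) : R).
Proof.
pose cnt (E : set (V * V)) (q : T * V) : R := \sum_(y <- Y q.1) \1_E (q.2, y).
move=> mE; pose G := [set X | exists2 A : set V, measurable A &
  exists2 B : set V, measurable B & A `*` B = X].
have GE : @measurable _ (V * V)%type = <<s G >>.
  exact: measurable_prod_measurableType.
have {mE} : <<s G >> E by rewrite -GE.
move: E; apply: (@dynkin_induction _ (V * V)%type G
  (fun E => measurable_fun [set: T * V] (cnt E)) GE).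
- move=> _ _ [A1 mA1 [A2 mA2 <-]] [B1 mB1 [B2 mB2 <-]].
  exists (A1 `&` B1); first exact: measurableI.
  by exists (A2 `&` B2); [exact: measurableI|rewrite setXI].
- rewrite (_ : cnt _ = fun q => (npoints (Y q.1) setT)%:R).
    by apply: (measurableT_comp (measurable_npoints mY measurableT)).
  by apply/funext => q; rewrite npointsE; apply: eq_bigr => y _; rewrite !indicT.
- move=> _ [A1 mA1 [A2 mA2 <-]].
  rewrite (_ : cnt _ = fun q => \1_A1 q.2 * (npoints (Y q.1) A2)%:R).
    apply: measurable_funM; last exact: (measurableT_comp (measurable_npoints mY mA2)).
    by apply: (@measurableT_comp _ _ _ _ _ _ (\1_A1 : V -> R)) => //; exact: measurable_indic.
  apply/funext => q; rewrite npointsE mulr_sumr; apply: eq_bigr => y _.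
  by rewrite !indicE in_setX; case: (_ \in A1); case: (_ \in A2); rewrite ?mulr0 ?mul0r ?mulr1.
- move=> S mS hS.
  rewrite (_ : cnt _ = fun q => (npoints (Y q.1) setT)%:R - cnt S q).
    apply: measurable_funB => //.
    by apply: (measurableT_comp (measurable_npoints mY measurableT)).
  apply/funext => q; rewrite npointsE -sumrB; apply: eq_bigr => y _.
  by rewrite !indicE in_setC in_setT; case: (_ \in S); rewrite ?subrr ?subr0.
- move=> F mF tF hF.
  apply: (@measurable_fun_cvg _ _ _ _ (fun k q => \sum_(i < k) cnt (F i) q)).
    by move=> k; apply: measurable_sumR => i; exact: hF.
  move=> q _; apply: cvg_near_cst.
  have [K hK] : exists K : nat, forall k, (K <= k)%N -> forall y, y \in Y q.1 ->
      \sum_(i < k) \1_(F i) (q.2, y) = \1_(\bigcup_i F i) (q.2, y) :> R.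
    elim: (Y q.1) => [|y s [K hK]]; first by exists 0%N.
    have [K' hK'] := trivIset_partial_sums (q.2, y) tF.
    exists (maxn K K') => k; rewrite geq_max => /andP[Kk K'k] z.
    by rewrite inE => /orP[/eqP ->|]; [exact: hK'|exact: hK].
  exists K => // k /= Kk; rewrite /cnt exchange_big/= big_seq [RHS]big_seq.
  by apply: eq_bigr => y yY; exact: hK.
Qed.

End joint_measurability.

Section triple_integrals.
Context {R : realType} {d1 d2 d3 : measure_display}.
Context {T1 : measurableType d1} {T2 : measurableType d2} {T3 : measurableType d3}.
Variables (m1 : {sigma_finite_measure set T1 -> \bar R}).
Variables (m2 : {sigma_finite_measure set T2 -> \bar R}).
Variables (m3 : {sigma_finite_measure set T3 -> \bar R}).
Variable g : T1 -> T2 -> T3 -> \bar R.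
Hypothesis mg : measurable_fun [set: T1 * T2 * T3] (fun p => g p.1.1 p.1.2 p.2).
Hypothesis g0 : forall x y z, (0 <= g x y z)%E.

Lemma measurable_integral1 :
  measurable_fun [set: T1 * T2] (fun p => \int[m3]_z g p.1 p.2 z)%E.
Proof. exact: (measurable_fun_fubini_tonelli_F _ mg). Qed.

Lemma measurable_integral2 : measurable_fun setT (fun x => \int[m2]_y \int[m3]_z g x y z)%E.
Proof.
apply: (measurable_fun_fubini_tonelli_F _ measurable_integral1) => p.
exact: integral_ge0.
Qed.

Lemma tonelli3 : (\int[m1]_x \int[m2]_y \int[m3]_z g x y z =
  \int[m2]_y \int[m3]_z \int[m1]_x g x y z)%E.
Proof.
rewrite (tonelli _ _ measurable_integral1); last by move=> x y; exact: integral_ge0.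
apply: eq_integral => y _; apply: (tonelli m1 m3 (f := fun x z => g x y z)) => //.
have mu : measurable_fun [set: T1 * T3] (fun q => (q.1, y, q.2)).
  by apply: measurable_fun_pair => //; apply: measurable_fun_pair.
exact: (measurableT_comp mg mu).
Qed.

End triple_integrals.

Section variance_bound.
Context {R : realType} {n : nat} {disp : measure_display} {T : measurableType disp}.
Local Notation V := 'cV[R]_n.+1.
Variables (P : probability T R) (Y : T -> seq V) (A : 'M[R]_n.+1) (S : seq 'cV[int]_n.+1).
Hypothesis uA : A \in unitmx.
Hypothesis uS : uniq S.
Let N : R := (size S)%:R.
Let kap (a b : V) : R := ksq S (a - b).
Hypothesis cY : forall w y, y \in Y w -> cube 0 1 y.
Hypothesis mY : forall B, measurable B -> measurable_fun [set: T] (fun w => npoints (Y w) B).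
Hypothesis uY : {ae P, forall w, uniq (Y w)}.
Hypothesis Y1 : forall B, measurable B ->
  (\int[P]_w (npoints (Y w) B)%:R%:E = N%:E * nu n.+1 B)%E.
Hypothesis Y2 : forall B B', measurable B -> measurable B' -> B `&` B' = set0 ->
  (\int[P]_w ((npoints (Y w) B)%:R * (npoints (Y w) B')%:R)%:E =
   \int[nu n.+1]_a \int[nu n.+1]_b (\1_B a * \1_B' b * (N ^+ 2 - kap a b))%:E)%E.

Lemma measurable_ksq_comp d' (U : measurableType d') (u : U -> V) :
  measurable_fun setT u -> measurable_fun setT (fun t => ksq S (u t)).
Proof. by move=> mu; apply: (measurableT_comp (measurable_ksq S) mu). Qed.

Lemma measurable_pcount_comp r d' (U : measurableType d') (u : U -> V) :
  measurable_fun setT u -> measurable_fun setT (fun t => pcount A r (u t)).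
Proof. by move=> mu; apply: (measurableT_comp (measurable_pcount uA r) mu). Qed.

(** The function H of the overview. *)
Definition translation_energy (r : R) (h : V) : \bar R :=
  (\int[nu n.+1]_x ((pcount A r (x - h)%R - pcount A r x) ^+ 2)%:E)%E.

Lemma translation_energy_ge0 r h : (0 <= translation_energy r h)%E.
Proof. by apply: integral_ge0 => x _; rewrite lee_fin sqr_ge0. Qed.

Lemma measurable_translation_energy r : measurable_fun setT (translation_energy r).
Proof.
apply: (measurable_fun_fubini_tonelli_F (fun p : V * V =>
  ((pcount A r (p.2 - p.1)%R - pcount A r p.2) ^+ 2)%:E)).
  apply/measurable_EFinP; apply: measurable_funX; apply: measurable_funB.
    by apply: measurable_pcount_comp; exact: measurable_cVB.
  exact: measurable_pcount_comp.
by move=> p; rewrite lee_fin sqr_ge0.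
Qed.

Lemma translation_energy_periodic r : periodic (translation_energy r).
Proof.
move=> h z; apply: eq_integral => x _.
have -> : pcount A r (x - (h + intv z)) = pcount A r (x - h).
  by rewrite opprD addrA -intvN (pcount_periodic uA).
by [].
Qed.

Lemma translation_energyE r (a b : V) :
  (\int[nu n.+1]_x ((pcount A r (x - a)%R - pcount A r (x - b)%R) ^+ 2)%:E =
   translation_energy r (a - b))%E.
Proof.
rewrite /translation_energy -[RHS](periodic_shift (- b)).
- apply: eq_integral => x _.
  have -> : x + - b - (a - b) = x - a by rewrite opprB addrA subrK.
  by [].
- apply/measurable_EFinP; apply: measurable_funX; apply: measurable_funB.
    by apply: measurable_pcount_comp; exact: measurable_cVB.
  exact: measurable_pcount_comp.
- by move=> x; rewrite lee_fin sqr_ge0.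
- move=> x z.
  have -> : pcount A r (x + intv z - (a - b)) = pcount A r (x - (a - b)).
    by rewrite addrAC (pcount_periodic uA).
  have -> : pcount A r (x + intv z) = pcount A r x by rewrite (pcount_periodic uA).
  by [].
Qed.

Lemma ge0_le_integral_nu2 (u v : V -> V -> \bar R) :
  measurable_fun [set: V * V] (fun p => u p.1 p.2) ->
  measurable_fun [set: V * V] (fun p => v p.1 p.2) ->
  (forall a b, 0 <= u a b)%E -> (forall a b, 0 <= v a b)%E ->
  (forall a b, cube 0 1 a -> cube 0 1 b -> u a b <= v a b)%E ->
  (\int[nu n.+1]_a \int[nu n.+1]_b u a b <= \int[nu n.+1]_a \int[nu n.+1]_b v a b)%E.
Proof.
move=> mu mv u0 v0 uv; apply: ge0_le_integral_nu.
- exact: (measurable_fun_fubini_tonelli_F (fun p : V * V => u p.1 p.2) mu).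
- exact: (measurable_fun_fubini_tonelli_F (fun p : V * V => v p.1 p.2) mv).
- by move=> a; exact: integral_ge0.
- by move=> a; exact: integral_ge0.
move=> a ac; apply: ge0_le_integral_nu => //.
- exact: (measurable_fun_pair2 a mu).
- exact: (measurable_fun_pair2 a mv).
- by move=> b bc; exact: uv.
Qed.

(** For each fixed centre x, [statistic_variance] is applied to y -> p(x - y). Integrating over x
    and exchanging integrals, the inner integral depends on a - b only, and translation invariance
    then removes one of the two remaining integrals. *)
Lemma torus_variance_le (r c : R) : 0 < r ->
  c = N * (`|\det A|^-1 * kappa n.+1 * r ^+ n.+1) ->
  (\int[P]_w \int[nu n.+1]_x ((\sum_(y <- Y w) pcount A r (x - y)%R - c) ^+ 2)%:E <=
   (2^-1)%:E * \int[nu n.+1]_h ((ksq S h)%:E * translation_energy r h))%E.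
Proof.
move=> r0 cE.
have [M hM] := box_covers uA r 1.
pose bx := int_box n.+1 M.
pose Bz (x : V) z : set V := [set y | ellipsoid A r (x - y + intv z)].
(* A sum over one fixed box, defined for all arguments and equal to p(x - y) for x and y in the unit
   cube, where all integrals live. *)
pose f x y : R := \sum_(z <- bx) \1_(Bz x z) y.
have fI x y : f x y = \sum_(z <- bx) \1_(ellipsoid A r) (x - y + intv z).
  by apply: eq_bigr => z _; exact: eq_indic.
have diff_bound (x y : V) : cube 0 1 x -> cube 0 1 y -> forall i, `|(x - y) i ord0| <= 1.
  move=> xc yc i; have := xc i; have := yc i; rewrite !mxE ler_norml.
  by move=> /andP[? ?] /andP[? ?]; apply/andP; split; lra.
have fE x y : cube 0 1 x -> cube 0 1 y -> f x y = pcount A r (x - y).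
  move=> xc yc; rewrite fI; apply/esym/pcountE; first exact: uniq_int_box.
  by apply: hM => //; exact: diff_bound.
have mf d' (U : measurableType d') (u v : U -> V) : measurable_fun setT u ->
    measurable_fun setT v -> measurable_fun setT (fun t => f (u t) (v t)).
  move=> mu mv; under [X in measurable_fun _ X]eq_fun do rewrite fI.
  apply: measurable_sumR => z.
  apply: (measurableT_comp (measurable_indic_shift A r (intv z)) (measurable_cVB mu mv)).
have c0 : 0 <= c by rewrite cE !mulr_ge0 ?invr_ge0 ?exprn_ge0 ?kappa_ge0 ?(ltW r0).
(* Unfolding the box by [tiling] turns the mean of p(x - y) into the volume of one full ellipsoid
   around x. *)
have mean x : cube 0 1 x -> (c%:E = N%:E * \int[nu n.+1]_y (f x y)%:E)%E.
  move=> xc; rewrite cE EFinM -(lam_ellipsoid uA r0); congr (_ * _)%E.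
  pose g (y : V) := (\1_[set y : V | enorm (A *m (y - x)) <= r] y : R)%:E.
  have mset : measurable [set y : V | enorm (A *m (y - x)) <= r].
    apply: measurable_set_le => //; apply: measurable_enorm; apply: measurable_mulmx_cV.
    exact: measurable_cVB.
  have mg : measurable_fun setT g by exact: measurable_indicE.
  pose s' := [seq - z | z <- bx].
  have us' : uniq s' by rewrite map_inj_uniq ?uniq_int_box//; exact: oppr_inj.
  have <- : (\int[lam n.+1]_y g y = lam n.+1 [set y : V | (enorm (A *m y) <= r)%R])%E.
    rewrite -lam_indic//.
    exact: (lam_shift_preimage (- x) (measurable_enorm_le A r)).
  rewrite -(tiling us' mg); first last.
  - move=> y; apply: contraNeq; rewrite /g indicE; case: (boolP (_ \in _)); last by rewrite eqxx.
    move=> /set_mem/= yr _; apply/mapP; exists (- floorv y); last by rewrite opprK.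
    apply: (hM M r (x - (y - intv (floorv y)))) => //.
      by apply: diff_bound => //; exact/cube_floorv.
    rewrite /ellipsoid/= intvN (_ : x - _ - _ = - (y - x)); last first.
      by apply/matrixP => i j; rewrite !mxE; ring.
    by rewrite mulmxN enormN.
  - by move=> y; rewrite lee_fin.
  apply: eq_integral => y _; rewrite /s' big_map /f -sumEFin; apply: eq_bigr => z _.
  congr EFin; apply: eq_indic; rewrite /Bz /ellipsoid/=.
  rewrite (_ : x - y + intv z = - (y + intv (- z) - x)) ?mulmxN ?enormN//.
  by rewrite intvN; apply/matrixP => i j; rewrite !mxE; ring.
have m1 : @nu R n.+1 setT = 1%E by exact: nu_setT.
have kap0 a b : 0 <= kap a b by exact: ksq_ge0.
have kapN a b : kap a b <= N ^+ 2 by exact: ksq_le.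
have mkap : measurable_fun [set: V * V] (fun p => kap p.1 p.2).
  by apply: measurable_ksq_comp; exact: measurable_cVB.
have mksqE : measurable_fun setT (fun a : V => (ksq S a)%:E).
  by apply/measurable_EFinP; exact: measurable_ksq.
have ikap2 b : (\int[nu n.+1]_a (kap a b)%:E = N%:E)%E.
  rewrite -(integral_ksq uS).
  apply: (@periodic_shift _ _ (fun a : V => (ksq S a)%:E) (- b)) => //.
    by move=> a; rewrite lee_fin ksq_ge0.
  by move=> a z; rewrite ksq_periodic.
(* Exchanging [a] and [b] fixes the cosine sum and changes the sign of the sine sum, which is
   squared. *)
have ikap1 a : (\int[nu n.+1]_b (kap a b)%:E = N%:E)%E.
  rewrite -(ikap2 a); apply: eq_integral => b _; congr EFin.
  rewrite /kap !ksqE; congr (_ ^+ 2 + _).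
    apply: eq_bigr => u _; rewrite -cosN -mulrN; congr (cos (_ * _)).
    by rewrite -opprB dotC dotNl opprK dotC.
  rewrite -sqrrN -sumrN; congr (_ ^+ 2); apply: eq_bigr => u _.
  rewrite -sinN -mulrN; congr (sin (_ * _)).
  by rewrite -opprB dotC dotNl opprK dotC.
pose F (w : T) (x : V) : R := \sum_(y <- Y w) f x y.
have mE z : measurable [set p : V * V | ellipsoid A r (p.1 - p.2 + intv z)].
  apply: measurable_set_le => //; apply: measurable_enorm; apply: measurable_mulmx_cV.
  by apply: measurable_cVD => //; exact: measurable_cVB.
(* Joint measurability in the sample and the centre, which the exchange of expectation and integral
   requires. *)
have mF : measurable_fun [set: T * V] (fun q => F q.1 q.2).
  rewrite (_ : (fun q => _) = fun q : T * V => \sum_(z <- bx)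
      \sum_(y <- Y q.1) \1_[set p : V * V | ellipsoid A r (p.1 - p.2 + intv z)] (q.2, y)).
    by apply: measurable_sumR => z; exact: (measurable_point_count mY (mE z)).
  apply/funext => q; rewrite exchange_big; apply: eq_bigr => y _; apply: eq_bigr => z _.
  exact: eq_indic.
have mFc : measurable_fun [set: T * V] (fun q => ((F q.1 q.2 - c) ^+ 2)%:E).
  by apply/measurable_EFinP; apply: measurable_funX; exact: measurable_funB.
have Fc0 w x : (0 <= ((F w x - c) ^+ 2)%:E)%E by rewrite lee_fin sqr_ge0.
have mpc (w : T) : measurable_fun [set: V] (fun x => ((\sum_(y <- Y w) pcount A r (x - y)%R - c) ^+ 2)%:E).
  apply/measurable_EFinP; apply: measurable_funX; apply: measurable_funB => //.
  by apply: measurable_sumR => y; apply: measurable_pcount_comp; exact: measurable_cVB.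
pose G x a b := ((f x a - f x b) ^+ 2 * kap a b)%:E.
have G0 x a b : (0 <= G x a b)%E by rewrite lee_fin mulr_ge0 ?sqr_ge0.
have mG d' (U : measurableType d') (x a b : U -> V) : measurable_fun setT x ->
    measurable_fun setT a -> measurable_fun setT b ->
    measurable_fun setT (fun t => G (x t) (a t) (b t)).
  move=> mx ma mb; apply/measurable_EFinP; apply: measurable_funM.
    by apply: measurable_funX; apply: measurable_funB; exact: mf.
  by apply: measurable_ksq_comp; exact: measurable_cVB.
have mBz x z : measurable (Bz x z).
  apply: measurable_set_le => //; apply: measurable_enorm; apply: measurable_mulmx_cV.
  by apply: measurable_cVD => //; exact: measurable_cVB.
have step1 : (\int[P]_w \int[nu n.+1]_x ((\sum_(y <- Y w) pcount A r (x - y)%R - c) ^+ 2)%:E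
    = \int[P]_w \int[nu n.+1]_x ((F w x - c) ^+ 2)%:E)%E.
  apply: eq_integral => w _; apply: ge0_eq_integral_nu.
  - exact: mpc.
  - exact: (measurable_fun_pair2 w mFc).
  - by move=> x; rewrite lee_fin sqr_ge0.
  - by move=> x; exact: Fc0.
  move=> x xc; rewrite /F (_ : \sum_(y <- Y w) pcount A r (x - y) = \sum_(y <- Y w) f x y)//.
  rewrite big_seq [RHS]big_seq; apply: eq_bigr => y yY.
  by rewrite fE//; exact: cY yY.
have step2 : (\int[P]_w \int[nu n.+1]_x ((F w x - c) ^+ 2)%:E =
    \int[nu n.+1]_x \int[P]_w ((F w x - c) ^+ 2)%:E)%E by exact: tonelli.
have mG3 : measurable_fun [set: V * V * V] (fun p => G p.1.1 p.1.2 p.2).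
  apply: mG; last exact: measurable_snd.
  - exact: (measurableT_comp measurable_fst measurable_fst).
  - exact: (measurableT_comp measurable_snd measurable_fst).
have mG3' : measurable_fun [set: V * V * V] (fun p => G p.2 p.1.1 p.1.2).
  apply: mG; first exact: measurable_snd.
  - exact: (measurableT_comp measurable_fst measurable_fst).
  - exact: (measurableT_comp measurable_snd measurable_fst).
have mI2 := measurable_integral2 (nu n.+1) (nu n.+1) mG3 G0.
have I20 x : (0 <= \int[nu n.+1]_a \int[nu n.+1]_b G x a b)%E.
  by apply: integral_ge0 => a _; exact: integral_ge0.
have step3 : (\int[nu n.+1]_x \int[P]_w ((F w x - c) ^+ 2)%:E <=
    \int[nu n.+1]_x ((2^-1)%:E * \int[nu n.+1]_a \int[nu n.+1]_b G x a b))%E.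
  apply: ge0_le_integral_nu.
  - by apply: (measurable_fun_fubini_tonelli_G (fun q : T * V => ((F q.1 q.2 - c) ^+ 2)%:E)).
  - exact: emeasurable_funM.
  - by move=> x; apply: integral_ge0.
  - by move=> x; rewrite mule_ge0.
  move=> x xc.
  exact: (@statistic_variance R n.+1 disp T P Y (nu n.+1) N kap (ler0n _ _) mkap kap0 kapN
    ikap1 ikap2 mY uY Y1 Y2 _ bx (Bz x) (mBz x) c m1 (mean x xc)).
have G3 a b x : (0 <= G x a b)%E by exact: G0.
have step4 : (\int[nu n.+1]_x ((2^-1)%:E * \int[nu n.+1]_a \int[nu n.+1]_b G x a b) =
   (2^-1)%:E * \int[nu n.+1]_a \int[nu n.+1]_b \int[nu n.+1]_x G x a b)%E.
  have h0 : (0 : R) <= 2^-1 by rewrite invr_ge0.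
  have e1 := @ge0_integralZl_EFin _ _ _ (nu n.+1) _ measurableT _ (fun x _ => I20 x) mI2 _ h0.
  have e2 := tonelli3 (nu n.+1) (nu n.+1) (nu n.+1) mG3 G0.
  by rewrite e2 in e1.
pose Phi (h : V) : \bar R := ((ksq S h)%:E * translation_energy r h)%E.
have mPhi : measurable_fun setT Phi.
  by exact: (emeasurable_funM mksqE (measurable_translation_energy r)).
have Phi0 h : (0 <= Phi h)%E.
  by rewrite mule_ge0 ?lee_fin ?ksq_ge0 ?translation_energy_ge0.
have pPhi : periodic Phi.
  move=> h z; exact: (f_equal2 (fun (u : R) v => u%:E * v)%E (ksq_periodic S h z)
    (translation_energy_periodic r h z)).
have mPhi2 : measurable_fun [set: V * V] (fun q => Phi (q.1 - q.2)).
  by apply: (measurableT_comp mPhi); exact: measurable_cVB.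
have step5 : (\int[nu n.+1]_a \int[nu n.+1]_b \int[nu n.+1]_x G x a b <=
   \int[nu n.+1]_a \int[nu n.+1]_b Phi (a - b)%R)%E.
  apply: ge0_le_integral_nu2.
  - exact: (measurable_integral1 (nu n.+1) mG3' (fun a b x => G0 x a b)).
  - exact: mPhi2.
  - by move=> a b; exact: integral_ge0.
  - by move=> a b; exact: Phi0.
  move=> a b ac bc; rewrite /Phi -translation_energyE.
  have mp : measurable_fun [set: V] (fun x => ((pcount A r (x - a)%R - pcount A r (x - b)%R) ^+ 2)%:E).
    apply/measurable_EFinP; apply: measurable_funX; apply: measurable_funB;
      by apply: measurable_pcount_comp; exact: measurable_cVB.
  have p0 x : (0 <= ((pcount A r (x - a)%R - pcount A r (x - b)%R) ^+ 2)%:E)%E.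
    by rewrite lee_fin sqr_ge0.
  rewrite -ge0_integralZl_EFin ?ksq_ge0//.
  apply: ge0_le_integral_nu.
  - by apply: mG => //; exact: measurable_cst.
  - exact: emeasurable_funM.
  - by move=> x; exact: G0.
  - by move=> x; rewrite mule_ge0// lee_fin ksq_ge0.
  by move=> x xc; rewrite /G !fE// -EFinM lee_fin mulrC.
have step6 : (\int[nu n.+1]_a \int[nu n.+1]_b Phi (a - b)%R = \int[nu n.+1]_h Phi h)%E.
  rewrite (tonelli (nu n.+1) (nu n.+1) mPhi2 (fun a b => Phi0 (a - b))).
  set Z := RHS.
  have inner b : (\int[nu n.+1]_a Phi (a - b)%R = Z)%E.
    exact: (periodic_shift (- b) mPhi Phi0 pPhi).
  rewrite (eq_integral (fun=> Z)); last by move=> b _; exact: inner.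
  exact: integral_nu_cst.
rewrite step1 step2; apply: le_trans step3 _; rewrite step4.
by apply: lee_wpmul2l => //; rewrite -step6.
Qed.

End variance_bound.

(** * From the torus to the unit cube *)

Section power_measure_integrals.
Context d (T : measurableType d) (R : realType).
Variable mu : {sigma_finite_measure set T -> \bar R}.

Lemma ge0_integral_power_measure_recl n (f : n.+1.-tuple T -> \bar R) :
  measurable_fun setT f -> (forall t, 0 <= f t)%E ->
  (\int[power_measure mu n.+1]_t f t =
   \int[mu]_x \int[power_measure mu n]_t f [tuple of x :: t])%E.
Proof.
move=> mf f0; have [m mE] := power_measure_bundle mu n; rewrite /= -mE.
rewrite (ge0_integral_pushforwardT (@measurable_tuple_cons _ _ _))//.
by rewrite fubini_tonelli1//; exact: (measurableT_comp mf (@measurable_tuple_cons _ _ _)).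
Qed.

Lemma measurable_cons_tuple n (x : T) :
  measurable_fun [set: n.-tuple T] (fun t : n.-tuple T => [tuple of x :: t]).
Proof.
have mp : measurable_fun [set: n.-tuple T] (fun t : n.-tuple T => (x, t)).
  by apply: measurable_fun_pair.
exact: (measurableT_comp (@measurable_tuple_cons _ T n) mp).
Qed.

Lemma ge0_integral_power_measure1 (f : 1.-tuple T -> \bar R) :
  measurable_fun setT f -> (forall t, 0 <= f t)%E ->
  (\int[power_measure mu 1]_t f t = \int[mu]_x f [tuple x])%E.
Proof.
move=> mf f0; rewrite ge0_integral_power_measure_recl//; apply: eq_integral => x _ /=.
rewrite integral_dirac// ?diracT ?mul1e; first by congr f; exact/val_inj.
exact: (measurableT_comp mf (measurable_cons_tuple x)).
Qed.

Lemma ge0_integral_power_measure2 (f : 2.-tuple T -> \bar R) :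
  measurable_fun setT f -> (forall t, 0 <= f t)%E ->
  (\int[power_measure mu 2]_t f t = \int[mu]_x \int[mu]_y f [tuple x; y])%E.
Proof.
move=> mf f0; rewrite ge0_integral_power_measure_recl//; apply: eq_integral => x _.
have mfx := measurableT_comp mf (@measurable_cons_tuple 1 x).
rewrite (ge0_integral_power_measure1 mfx) => [|t]; last exact: f0.
by apply: eq_integral => y _ /=; congr f; exact/val_inj.
Qed.

End power_measure_integrals.

Section torus_measure.
Context {R : realType} {n : nat}.
Local Notation V := 'cV[R]_n.
Variable A : 'M[R]_n.
Hypothesis uA : A \in unitmx.

Lemma fund_domainE (y : V) : fund_domain A y <-> cube 0 1 (invmx A *m y).
Proof.
have sumE (a : V) : \sum_(j < n) a j ord0 *: col j A = A *m a.
  apply/matrixP => i k; rewrite (ord1 k) summxE mxE; apply: eq_bigr => j _.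
  by rewrite [LHS]mxE [X in _ * X]mxE mulrC.
split=> [[a ac <-]|yc]; first by rewrite sumE mulKmx.
by exists (invmx A *m y) => //; rewrite sumE mulKVmx.
Qed.

Lemma fund_domain_mulmx (a : V) : fund_domain A (A *m a) <-> cube 0 1 a.
Proof. by rewrite fund_domainE mulKmx. Qed.

Lemma measurable_fund_domain : measurable (fund_domain A).
Proof.
rewrite (_ : fund_domain A = (mulmx (invmx A)) @^-1` (@cube R n 0 1)).
  rewrite -[X in measurable X]setTI.
  have mi := measurable_mulmx_cV (invmx A) (@measurable_id _ V setT).
  exact: (mi measurableT _ (@measurable_cube R n 0 1)).
by apply/seteqP; split=> y /fund_domainE.
Qed.

Let detA0 : 0 < `|\det A|. Proof. by rewrite normr_gt0 -unitfE -unitmxE. Qed.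

Lemma lam_fund_domain : lam n (fund_domain A) = `|\det A|%:E.
Proof.
rewrite -(lam_mulmx_preimage uA measurable_fund_domain).
rewrite (_ : [set x | fund_domain A (A *m x)] = cube 0 1).
  by rewrite lam_cube// subr0 expr1n mule1.
by apply/seteqP; split=> y /fund_domain_mulmx.
Qed.

Let detV0 : 0 <= `|\det A|^-1. Proof. by rewrite invr_ge0 (ltW detA0). Qed.

Lemma torus_measureE : torus_measure A =
  mscale (NngNum detV0) (mrestr (lam n) measurable_fund_domain).
Proof. by apply/funext => B; rewrite /torus_measure -lamE lam_fund_domain. Qed.

Lemma torus_measure_bundle : exists m : {sigma_finite_measure set V -> \bar R},
  (m : set V -> \bar R) = torus_measure A.
Proof.
rewrite torus_measureE; apply: sigma_finite_bundle.
apply: fin_num_fun_sigma_finite; first by rewrite measure0.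
move=> S mS; rewrite /= /mscale/= fin_numM// ge0_fin_numE//.
apply: (@le_lt_trans _ _ (lam n (fund_domain A))); last by rewrite lam_fund_domain ltry.
apply: le_measure => //; rewrite inE; last exact: measurable_fund_domain.
by apply: measurableI => //; exact: measurable_fund_domain.
Qed.

(** The normalization |det A|^-1 cancels the Jacobian of a -> A a, which leaves the uniform
    probability on the unit cube. *)
Lemma ge0_integral_torus_measure (f : V -> \bar R) :
  measurable_fun setT f -> (forall y, 0 <= f y)%E ->
  (\int[torus_measure A]_y f y = \int[nu n]_a f (A *m a))%E.
Proof.
move=> mf f0; rewrite torus_measureE ge0_integral_mscale//.
have mfA : measurable_fun [set: V] (fun a => f (A *m a)).
  exact: (measurableT_comp mf (measurable_mulmx_cV A (@measurable_id _ V setT))).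
pose g y := ((\1_(fund_domain A) y : R)%:E * f y)%E.
have mg : measurable_fun [set: V] g.
  by apply: emeasurable_funM => //; exact: (measurable_indicE measurable_fund_domain).
have g0 y : (0 <= g y)%E by rewrite mule_ge0// lee_fin.
rewrite ge0_integral_mrestr// ge0_integral_nu//.
rewrite integral_mkcond (_ : (\int[lam n]_x (f \_ (fund_domain A)) x = \int[lam n]_x g x)%E); last first.
  by apply: eq_integral => x _; rewrite patchE /g indicE; case: ifP; rewrite ?mul1e ?mul0e.
rewrite -(ge0_integral_lam_mulmx uA mg g0) muleA -EFinM mulVf ?gt_eqF// mul1e.
apply: eq_integral => a _; rewrite /g; congr (EFin _ * _)%E.
by apply: eq_indic; exact: fund_domain_mulmx.
Qed.

End torus_measure.

(** * Dual lattice, kernel and balls in lattice coordinates *)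

Section lattice_coordinates.
Context {R : realType} {n : nat}.
Local Notation V := 'cV[R]_n.+1.
Variable A : 'M[R]_n.+1.
Hypothesis uA : A \in unitmx.
Let W := (invmx A)^T.

Lemma dot_mulmx (B : 'M[R]_n.+1) (x y : V) : dot (B *m x) y = dot x (B^T *m y).
Proof.
have dotE (u v : V) : dot u v = (u^T *m v) ord0 ord0.
  by rewrite mxE; apply: eq_bigr => i _; rewrite mxE.
by rewrite !dotE trmx_mul mulmxA.
Qed.

Lemma dot_dual (x y : V) : dot (A *m x) (W *m y) = dot x y.
Proof. by rewrite dot_mulmx mulmxA -trmx_mul mulVmx// trmx1 mul1mx. Qed.

Lemma intv_int (x : V) : (forall i, x i ord0 \is a Num.int) -> intv (floorv x) = x.
Proof.
by move=> xi; apply/matrixP => i k; rewrite !mxE (ord1 k) floorK.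
Qed.

Lemma floorv_intv (z : 'cV[int]_n.+1) : floorv (intv z : V) = z.
Proof. by apply/matrixP => i k; rewrite !mxE (ord1 k) intrKfloor. Qed.

(** The entries of A^T w are the pairings of w with the columns of [A], so w is dual exactly when
    A^T w is an integer vector; [W] inverts A^T. *)
Lemma dual_latticeE (w : V) :
  dual_lattice A w <-> exists m, w = W *m intv m.
Proof.
split=> [h|[m ->] _ [z _ <-]]; last first.
  by rewrite dotC dot_dual dot_intv intr_int.
exists (floorv (A^T *m w)); rewrite intv_int.
  by rewrite mulmxA -trmx_mul mulmxV// trmx1 mul1mx.
move=> i; rewrite (_ : _ i ord0 = dot w (A *m map_mx intr (delta_mx i ord0))).
  by apply: h; exists (delta_mx i ord0).
rewrite dotC dot_mulmx dotC /dot (bigD1 i)//= big1 => [|j ji].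
  by rewrite !mxE !eqxx mulr1 addr0.
by rewrite !mxE (negbTE ji) mulr0.
Qed.

Lemma dual_kernel_coordinates (D : set V) (N : nat) :
  (D `&` dual_lattice A #= `I_N)%card ->
  exists S : seq 'cV[int]_n.+1, [/\ uniq S, size S = N,
    forall m, m \in S <-> D (W *m intv m) &
    forall x y, dual_kernel A D x y = \sum_(m <- S) cexp_i (2 * pi * dot (x - y) (W *m intv m))].
Proof.
move=> cD; set E := D `&` _ in cD.
have fE : finite_set E by apply/finite_setP; exists N.
pose F : seq V := finmap.enum_fset (fset_set E).
have FE w : (w \in F) = (w \in E) by rewrite /F -in_fset_set.
have uF : uniq F by exact: finmap.fset_uniq.
pose S := [seq floorv (A^T *m w) | w <- F].
have WK w : w \in E -> W *m intv (floorv (A^T *m w)) = w.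
  rewrite inE => -[_ /dual_latticeE[m ->]].
  by rewrite mulmxA -trmx_mul mulVmx// trmx1 mul1mx floorv_intv.
have KW m : floorv (A^T *m (W *m intv m)) = m.
  by rewrite mulmxA -trmx_mul mulVmx// trmx1 mul1mx floorv_intv.
exists S; split.
- rewrite map_inj_in_uniq// => u v; rewrite !FE => uE vE uv.
  by rewrite -(WK _ uE) -(WK _ vE) uv.
- by rewrite size_map; exact: card_fset_set.
- move=> m; split=> [/mapP[w wF ->]|Dm].
    by rewrite FE in wF; rewrite WK//; move: wF; rewrite inE => -[].
  apply/mapP; exists (W *m intv m); rewrite ?KW// FE inE; split => //.
  by apply/dual_latticeE; exists m.
move=> x y; rewrite /dual_kernel setIC -/E big_map.
rewrite (fsbigE F)//; first last.
- by move=> i Ei; rewrite FE => /negP; case; rewrite inE.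
- by move=> i /=; rewrite FE inE.
rewrite big_seq_cond [RHS]big_seq; apply: eq_big => [w|w].
  by rewrite FE andbb.
by rewrite FE andbb => wE; rewrite WK.
Qed.

Lemma ball_indicator_mulmx r (a b : V) : ball_indicator A (A *m a) r (A *m b) = pcount A r (a - b).
Proof.
have [k ak] := exists_nat_bound (a - b).
have [M hM] := box_covers uA r k%:R.
pose s := [seq z <- int_box n.+1 M | a - b + intv z \in ellipsoid A r].
have us : uniq s by rewrite filter_uniq// uniq_int_box.
have sE z : ellipsoid A r (a - b + intv z) <-> z \in s.
  rewrite mem_filter; split=> [zr|/andP[/set_mem]//].
  by apply/andP; split; [exact/mem_set|exact: hM zr].
rewrite /pcount (card_fset_set_seq us sE) /ball_indicator; congr _%:R.
(* The sign changes because [ball_indicator] translates the point y, whereas [pcount] translates the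
   difference a - b. *)
pose f (z : 'cV[int]_n.+1) : V := A *m map_mx intr (- z).
have fI : injective f.
  move=> z z' /(congr1 (mulmx (invmx A))); rewrite !mulKmx// => h.
  apply: oppr_inj; rewrite -(floorv_intv (- z)) -(floorv_intv (- z')).
  by rewrite /intv h.
have fE z : enorm (A *m b + f z - A *m a) = enorm (A *m (a - b + intv z)).
  rewrite -[RHS]enormN -!mulmxN /f -!mulmxDr; congr (enorm (_ *m _)).
  by apply/matrixP => i j; rewrite !mxE; ring.
rewrite -(size_map f); apply: card_fset_set_seq; first by rewrite map_inj_uniq.
move=> v; split=> [[[z _ <-] zr]|/mapP[z /sE zr ->]].
  rewrite -[z]opprK; apply: map_f; apply/sE.
  by rewrite /ellipsoid/= -fE /f opprK.
by split; [exists (- z)|rewrite fE].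
Qed.

(** [kappa_Gamma] identifies the constant, and also shows that [Gamma] does not vanish there, since
    pi^(d/2) is positive. *)
Lemma ball_volumeE r : ball_volume A r = `|\det A|^-1 * kappa n.+1 * r ^+ n.+1.
Proof.
rewrite /ball_volume /covolume -(kappa_Gamma n.+1).
have G0 : Gamma (n.+1%:R / 2 + 1) != 0 :> R.
  apply/eqP => G0; have := kappa_Gamma (R := R) n.+1; rewrite G0 mulr0 => /esym/eqP.
  by rewrite gt_eqF// powR_gt0// pi_gt0.
by rewrite mulfK.
Qed.

End lattice_coordinates.

Section determinants.
Context {R : realType}.

Lemma det_mx22 (F : comRingType) (M : 'M[F]_2) :
  \det M = M ord0 ord0 * M ord_max ord_max - M ord0 ord_max * M ord_max ord0.
Proof.
have l0 : lift ord0 ord0 = ord_max :> 'I_2 by exact/val_inj.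
have l1 : lift ord_max ord0 = ord0 :> 'I_2 by exact/val_inj.
rewrite (expand_det_row _ ord0) !big_ord_recl big_ord0 addr0 l0 /cofactor !det_mx11 !mxE.
by rewrite !l0 l1 /= expr0 expr1 mul1r mulN1r mulrN.
Qed.

Lemma sum_cexp_i (I : Type) (s : seq I) (h : I -> R) :
  \sum_(i <- s) cexp_i (h i) = ((\sum_(i <- s) cos (h i)) +i* (\sum_(i <- s) sin (h i)))%C.
Proof. by elim: s => [|i s IH]; rewrite ?big_nil// !big_cons IH. Qed.

End determinants.

Section torus_power_integrals.
Context {R : realType} {n : nat}.
Local Notation V := 'cV[R]_n.+1.
Variable A : 'M[R]_n.+1.
Hypothesis uA : A \in unitmx.

Lemma ge0_integral_torus_power1 (f : V -> \bar R) :
  measurable_fun setT f -> (forall y, 0 <= f y)%E ->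
  (\int[power_measure (torus_measure A) 1]_t f (tnth t ord0) = \int[nu n.+1]_a f (A *m a))%E.
Proof.
move=> mf f0; have [m mE] := torus_measure_bundle uA.
rewrite -(ge0_integral_torus_measure uA mf f0) -mE.
exact: (ge0_integral_power_measure1 m (measurableT_comp mf (measurable_tnth ord0)) (fun t => f0 _)).
Qed.

Lemma ge0_integral_torus_power2 (f : V -> V -> \bar R) :
  measurable_fun [set: V * V] (fun p => f p.1 p.2) -> (forall y y', 0 <= f y y')%E ->
  (\int[power_measure (torus_measure A) 2]_t f (tnth t ord0) (tnth t ord_max) =
   \int[nu n.+1]_a \int[nu n.+1]_b f (A *m a) (A *m b))%E.
Proof.
move=> mf f0; have [m mE] := torus_measure_bundle uA.
have mf2 : measurable_fun [set: 2.-tuple V] (fun t => f (tnth t ord0) (tnth t ord_max)).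
  have mt : measurable_fun [set: 2.-tuple V] (fun t : 2.-tuple V => (tnth t ord0, tnth t ord_max)).
    by apply: measurable_fun_pair; exact: measurable_tnth.
  exact: (measurableT_comp mf mt).
have e1 := ge0_integral_power_measure2 m mf2 (fun t => f0 _ _).
rewrite -[in LHS]mE; apply: (etrans e1).
have mI : measurable_fun [set: V] (fun x => \int[m]_y f x y)%E.
  exact: (measurable_fun_fubini_tonelli_F (fun p : V * V => f p.1 p.2) mf).
have I0 x : (0 <= \int[m]_y f x y)%E by exact: integral_ge0.
have e2 := ge0_integral_torus_measure uA mI I0; rewrite -[in LHS]mE in e2.
apply: (etrans e2); apply: eq_integral => a _; rewrite mE.
exact: (ge0_integral_torus_measure uA (measurable_fun_pair2 (A *m a) mf)).
Qed.

Lemma ge0_eq_integral_nu2 (u v : V -> V -> \bar R) :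
  measurable_fun [set: V * V] (fun p => u p.1 p.2) ->
  measurable_fun [set: V * V] (fun p => v p.1 p.2) ->
  (forall a b, 0 <= u a b)%E -> (forall a b, 0 <= v a b)%E ->
  (forall a b, cube 0 1 a -> cube 0 1 b -> u a b = v a b) ->
  (\int[nu n.+1]_a \int[nu n.+1]_b u a b = \int[nu n.+1]_a \int[nu n.+1]_b v a b)%E.
Proof.
move=> mu mv u0 v0 uv; apply/le_anti/andP; split;
  by apply: ge0_le_integral_nu2 => // a b ac bc; rewrite uv.
Qed.

End torus_power_integrals.

Section process_coordinates.
Context {R : realType} {n : nat} {disp : measure_display} {T : measurableType disp}.
Local Notation V := 'cV[R]_n.+1.
Variables (P : probability T R) (X : T -> seq V) (A : 'M[R]_n.+1) (D : set V) (N : nat).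
Hypothesis uA : A \in unitmx.
Hypothesis detX : determinantal A (dual_kernel A D) P X.
Let W := (invmx A)^T.
Variable S : seq 'cV[int]_n.+1.
Hypothesis uS : uniq S.
Hypothesis sS : size S = N.
Hypothesis KS : forall x y,
  dual_kernel A D x y = \sum_(m <- S) cexp_i (2 * pi * dot (x - y) (W *m intv m)).

Definition coordinates (w : T) : seq V := [seq invmx A *m y | y <- X w].

Let XD w y : y \in X w -> fund_domain A y.
Proof. by case: detX => -[h _] _ _; exact: h. Qed.

Lemma coordinates_cube w a : a \in coordinates w -> cube 0 1 a.
Proof. by case/mapP => y /XD/(fund_domainE uA) yc ->. Qed.

(** Joint intensities are given for subsets of the fundamental domain, so a set of coordinates is
    pulled back inside it. *)
Let pre (B : set V) : set V := [set y | fund_domain A y /\ B (invmx A *m y)].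

Let measurable_pre B : measurable B -> measurable (pre B).
Proof.
move=> mB; apply: measurableI; first exact: (measurable_fund_domain uA).
have mi := measurable_mulmx_cV (invmx A) (@measurable_id _ V setT).
by have := mi measurableT _ mB; rewrite setTI.
Qed.

Lemma npoints_coordinates w B : npoints (coordinates w) B = npoints (X w) (pre B).
Proof.
rewrite /npoints /coordinates count_map; apply: eq_in_count => y yX /=.
apply/idP/idP; rewrite !inE; last by case.
by move=> yB; split => //; exact: XD yX.
Qed.

Lemma measurable_npoints_coordinates B : measurable B ->
  measurable_fun [set: T] (fun w => npoints (coordinates w) B).
Proof.
move=> mB; under [X in measurable_fun _ X]eq_fun do rewrite npoints_coordinates.
by case: detX => -[_ h] _ _; apply: h; exact: measurable_pre.
Qed.

Lemma uniq_coordinates : {ae P, forall w, uniq (coordinates w)}.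
Proof.
case: detX => _ uX _; apply: filterS uX => w; rewrite map_inj_uniq//.
by move=> y y' /(congr1 (mulmx A)); rewrite !mulKVmx.
Qed.

Lemma dual_kernel_mulmx a b : dual_kernel A D (A *m a) (A *m b) =
  ((\sum_(m <- S) cos (2 * pi * dot (intv m) (a - b))) +i*
   (\sum_(m <- S) sin (2 * pi * dot (intv m) (a - b))))%C.
Proof.
rewrite KS sum_cexp_i -mulmxBr; congr (Complex _ _); apply: eq_bigr => m _;
  by rewrite dot_dual// dotC.
Qed.

Lemma dual_kernel_diag y : dual_kernel A D y y = (N%:R +i* 0)%C.
Proof.
have dot0 (x : V) : 2 * pi * dot x 0 = 0 :> R.
  by rewrite /dot big1 ?mulr0// => i _; rewrite mxE mulr0.
rewrite -[y](mulKVmx uA) dual_kernel_mulmx subrr; congr (Complex _ _).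
  by rewrite -sS -sum1_size natr_sum; apply: eq_bigr => m _; rewrite dot0 cos0.
by rewrite big1// => m _; rewrite dot0 sin0.
Qed.

(** The kernel is Hermitian, so the product of the off-diagonal entries is a squared modulus. *)
Lemma dual_kernel_pair a b :
  dual_kernel A D (A *m a) (A *m b) * dual_kernel A D (A *m b) (A *m a) =
  (ksq S (a - b) +i* 0)%C.
Proof.
rewrite !dual_kernel_mulmx ksqE.
have -> : \sum_(m <- S) cos (2 * pi * dot (intv m) (b - a)) =
    \sum_(m <- S) cos (2 * pi * dot (intv m) (a - b)).
  apply: eq_bigr => m _; rewrite -cosN -mulrN; congr (cos (_ * _)).
  by rewrite -opprB dotC dotNl opprK dotC.
have -> : \sum_(m <- S) sin (2 * pi * dot (intv m) (b - a)) =
    - \sum_(m <- S) sin (2 * pi * dot (intv m) (a - b)).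
  rewrite -sumrN; apply: eq_bigr => m _; rewrite -sinN -mulrN; congr (sin (_ * _)).
  by rewrite -opprB dotC dotNl dotC.
by congr (Complex _ _); ring.
Qed.

Lemma mean_coordinates B : measurable B ->
  (\int[P]_w (npoints (coordinates w) B)%:R%:E = (N%:R : R)%:E * nu n.+1 B)%E.
Proof.
move=> mB; case: detX => _ _ /(_ 1%N isT)[rho [rhoE rhoI]].
have := rhoI (fun=> pre B) (fun=> measurable_pre mB) (fun=> @subIsetl _ _ _).
have tr : trivIset [set: 'I_1] (fun=> pre B) by apply/trivIsetP => i j; rewrite !ord1 eqxx.
move=> /(_ tr) h.
transitivity (\int[P]_w (\prod_(i < 1) (npoints (X w) (pre B))%:R)%:E)%E.
  by apply: eq_integral => w _; rewrite npoints_coordinates big_ord1.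
rewrite {}h.
(* The values of [rho] are known on the fundamental domain only; [f] equals it on the domain of
   integration and is measurable everywhere. *)
pose f y : \bar R := ((\1_(pre B) y : R)%:E * N%:R%:E)%E.
have mf : measurable_fun setT f.
  by apply: emeasurable_funM => //; exact: (measurable_indicE (measurable_pre mB)).
have f0 y : (0 <= f y)%E by rewrite mule_ge0 ?lee_fin.
have [m mE] := torus_measure_bundle uA.
have [m1 m1E] := power_measure_bundle m 1; rewrite {}mE in m1E.
transitivity (\int[power_measure (torus_measure A) 1]_t f (tnth t ord0))%E.
  rewrite -m1E integral_mkcond; apply: eq_integral => t _; rewrite patchE.
  case: ifPn => [/set_mem/= tB|tB].
    rewrite /f indicE mem_set ?mul1e//; congr EFin.
    have := rhoE t (fun i => (tB i).1); rewrite det_mx11 mxE dual_kernel_diag.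
    by case.
  rewrite /f indicE memNset ?mul0e// => tB'; apply/negP: tB; apply/negPn/mem_set => i /=.
  by rewrite ord1.
rewrite (ge0_integral_torus_power1 uA mf f0).
have mc : measurable_fun setT (fun a : V => ((\1_B a : R)%:E * N%:R%:E)%E).
  by apply: emeasurable_funM => //; exact: (measurable_indicE mB).
have mfA : measurable_fun setT (fun a : V => f (A *m a)).
  exact: (measurableT_comp mf (measurable_mulmx_cV A (@measurable_id _ V setT))).
have c0 (a : V) : (0 <= (\1_B a : R)%:E * N%:R%:E)%E by rewrite mule_ge0 ?lee_fin.
transitivity (\int[nu n.+1]_a ((\1_B a : R)%:E * N%:R%:E))%E.
  apply: (ge0_eq_integral_nu mfA mc (fun a => f0 _) c0) => a ac; rewrite /f; congr (EFin _ * _)%E; apply: eq_indic.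
  rewrite /pre/= mulKmx//; split=> [[]//|aB]; split=> //; exact/(fund_domain_mulmx uA).
rewrite ge0_integralZr//; last exact: (measurable_indicE mB).
by rewrite integral_indic// setIT muleC.
Qed.

(** The 2 x 2 determinant has diagonal entries N, so it is N^2 minus the squared modulus of the
    kernel. *)
Lemma pair_coordinates B B' : measurable B -> measurable B' -> B `&` B' = set0 ->
  (\int[P]_w ((npoints (coordinates w) B)%:R * (npoints (coordinates w) B')%:R)%:E =
   \int[nu n.+1]_a \int[nu n.+1]_b
     (\1_B a * \1_B' b * ((size S)%:R ^+ 2 - ksq S (a - b)))%:E)%E.
Proof.
move=> mB mB' BB'; case: detX => _ _ /(_ 2%N isT)[rho [rhoE rhoI]].
pose C (i : 'I_2) := if i == ord0 then pre B else pre B'.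
have mC i : measurable (C i) by rewrite /C; case: ifP => _; exact: measurable_pre.
have CD i : C i `<=` fund_domain A by rewrite /C; case: ifP => _ y [].
have i2 (i : 'I_2) : i = ord0 \/ i = ord_max.
  by case: i => -[|[|//]] p; [left|right]; exact/val_inj.
have tr : trivIset [set: 'I_2] C.
  have CC : C ord0 `&` C ord_max = set0.
    apply/seteqP; split=> // y [[_ yB] [_ yB']].
    by have : (B `&` B') (invmx A *m y) by []; rewrite BB'.
  apply/trivIsetP => i j _ _; case: (i2 i) (i2 j) => -> [] ->; rewrite ?eqxx// => _.
  by rewrite setIC.
have := rhoI C mC CD tr => h.
transitivity (\int[P]_w (\prod_(i < 2) (npoints (X w) (C i))%:R)%:E)%E.
  apply: eq_integral => w _; rewrite !npoints_coordinates !big_ord_recl big_ord0 mulr1.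
  by rewrite (_ : lift _ _ = ord_max)//; exact/val_inj.
rewrite {}h.
pose g (a b : V) : R := (size S)%:R ^+ 2 - ksq S (a - b).
have g0 a b : 0 <= g a b by rewrite subr_ge0 ksq_le.
pose f y y' : \bar R := (\1_(pre B) y * \1_(pre B') y' * g (invmx A *m y) (invmx A *m y'))%:E.
have mg d' (U : measurableType d') (u v : U -> V) : measurable_fun setT u ->
    measurable_fun setT v -> measurable_fun setT (fun t => g (u t) (v t)).
  move=> mu mv; apply: measurable_funB => //.
  exact: (measurableT_comp (measurable_ksq S) (measurable_cVB mu mv)).
have mI B1 B2 d' (U : measurableType d') (u v : U -> V) : measurable B1 -> measurable B2 ->
    measurable_fun setT u -> measurable_fun setT v ->
    measurable_fun setT (fun t => \1_B1 (u t) * \1_B2 (v t) : R).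
  move=> m1 m2 mu mv; apply: measurable_funM.
    exact: (measurableT_comp (measurable_indic m1) mu).
  exact: (measurableT_comp (measurable_indic m2) mv).
have mf : measurable_fun [set: V * V] (fun p => f p.1 p.2).
  apply/measurable_EFinP; apply: measurable_funM.
    by apply: mI => //; exact: measurable_pre.
  by apply: mg; apply: measurable_mulmx_cV.
have f0 y y' : (0 <= f y y')%E by rewrite lee_fin !mulr_ge0.
have [m mE] := torus_measure_bundle uA.
have [m2 m2E] := power_measure_bundle m 2; rewrite {}mE in m2E.
transitivity (\int[power_measure (torus_measure A) 2]_t f (tnth t ord0) (tnth t ord_max))%E.
  rewrite -m2E integral_mkcond; apply: eq_integral => t _; rewrite patchE.
  case: ifPn => [/set_mem/= tB|tB].
    have t0 : pre B (tnth t ord0) by have := tB ord0.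
    have t1 : pre B' (tnth t ord_max) by have := tB ord_max.
    rewrite /f !indicE !mem_set// !mul1r; congr EFin.
    have := rhoE t (fun i => CD i _ (tB i)); rewrite det_mx22 !mxE !dual_kernel_diag.
    rewrite -{1}[tnth t ord0](mulKVmx uA) -{1}[tnth t ord_max](mulKVmx uA).
    rewrite -{1}[X in _ = _ - _ * dual_kernel A D _ X](mulKVmx uA).
    rewrite -{1}[X in _ = _ - _ * dual_kernel A D X _](mulKVmx uA).
    rewrite dual_kernel_pair /g sS => -[-> _]; ring.
  have [t0|t0] := boolP (tnth t ord0 \in pre B); last first.
    by rewrite /f !indicE (negbTE t0) !mul0r.
  have [t1|t1] := boolP (tnth t ord_max \in pre B'); last first.
    by rewrite /f !indicE (negbTE t1) mulr0 mul0r.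
  case/negP: tB; apply/mem_set => i /=; case: (i2 i) => ->; exact/set_mem.
rewrite (ge0_integral_torus_power2 uA mf f0).
apply: ge0_eq_integral_nu2.
- have mA : measurable_fun [set: V * V] (fun p : V * V => (A *m p.1, A *m p.2)).
    by apply: measurable_fun_pair; apply: measurable_mulmx_cV.
  exact: (measurableT_comp mf mA).
- by apply/measurable_EFinP; apply: measurable_funM; [exact: mI|exact: mg].
- by move=> a b; exact: f0.
- by move=> a b; rewrite lee_fin; apply: mulr_ge0; [exact: mulr_ge0|exact: g0].
move=> a b ac bc; rewrite /f !mulKmx//; congr (EFin (_ * _ * _));
  apply: eq_indic; rewrite /pre/= mulKmx//;
  by split=> [[]//|h]; split=> //; exact/(fund_domain_mulmx uA).
Qed.

Lemma number_variance_le r : 0 < r ->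
  (number_variance A P X N r <=
   (2^-1)%:E * \int[nu n.+1]_h ((ksq S h)%:E * translation_energy A r h))%E.
Proof.
move=> r0; pose c : R := N%:R * ball_volume A r.
have cE : c = (size S)%:R * (`|\det A|^-1 * kappa n.+1 * r ^+ n.+1).
  by rewrite /c ball_volumeE sS.
have Y1 B : measurable B -> (\int[P]_w (npoints (coordinates w) B)%:R%:E =
    ((size S)%:R : R)%:E * nu n.+1 B)%E by move=> mB; rewrite sS mean_coordinates.
apply: le_trans (torus_variance_le uA uS coordinates_cube measurable_npoints_coordinates
  uniq_coordinates Y1 pair_coordinates r0 cE).
rewrite /number_variance le_eqVlt; apply/orP; left; apply/eqP.
apply: eq_integral => w _.
pose g (x : V) : \bar R := ((\sum_(y <- X w) pcount A r (invmx A *m x - invmx A *m y) - c) ^+ 2)%:E.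
have mg : measurable_fun setT g.
  apply/measurable_EFinP; apply: measurable_funX; apply: measurable_funB => //.
  apply: measurable_sumR => y; apply: (measurable_pcount_comp uA); apply: measurable_cVB => //.
  exact: measurable_mulmx_cV.
have g0 x : (0 <= g x)%E by rewrite lee_fin sqr_ge0.
pose ig (x : V) : \bar R := ((\1_(fund_domain A) x : R)%:E * g x)%E.
have mig : measurable_fun setT ig.
  by apply: emeasurable_funM => //; exact: (measurable_indicE (measurable_fund_domain uA)).
have ig0 x : (0 <= ig x)%E by rewrite mule_ge0// lee_fin.
transitivity (\int[torus_measure A]_x ig x)%E.
  have [m mE] := torus_measure_bundle uA.
  rewrite -mE integral_mkcond; apply: eq_integral => x _; rewrite patchE /ig indicE.
  case: ifPn => xD; rewrite ?mul0e// mul1e /g.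
  have -> : \sum_(y <- X w) ball_indicator A x r y =
      \sum_(y <- X w) pcount A r (invmx A *m x - invmx A *m y).
    by apply: eq_bigr => y _; rewrite -(ball_indicator_mulmx uA) !mulKVmx.
  by [].
rewrite (ge0_integral_torus_measure uA mig ig0).
have migA : measurable_fun setT (fun a : V => ig (A *m a)).
  exact: (measurableT_comp mig (measurable_mulmx_cV A (@measurable_id _ V setT))).
have mp : measurable_fun [set: V]
    (fun x => ((\sum_(y <- coordinates w) pcount A r (x - y)%R - c) ^+ 2)%:E).
  apply/measurable_EFinP; apply: measurable_funX; apply: measurable_funB => //.
  apply: measurable_sumR => y; apply: (measurable_pcount_comp uA).
  exact: measurable_cVB.
have p0 x : (0 <= ((\sum_(y <- coordinates w) pcount A r (x - y)%R - c) ^+ 2)%:E)%E.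
  by rewrite lee_fin sqr_ge0.
apply: (ge0_eq_integral_nu migA mp (fun a => ig0 _) p0) => a ac.
rewrite /ig indicE mem_set ?mul1e; last exact/(fund_domain_mulmx uA).
have e : \sum_(y <- X w) pcount A r (invmx A *m (A *m a) - invmx A *m y) =
    \sum_(y <- coordinates w) pcount A r (a - y).
  by rewrite /coordinates big_map mulKmx.
exact: (f_equal (fun s : R => ((s - c) ^+ 2)%:E) e).
Qed.

End process_coordinates.

(** * Growth of the number variance *)

Section variance_growth.
Context {R : realType} {n : nat}.
Local Notation V := 'cV[R]_n.+1.
Variable A : 'M[R]_n.+1.
Hypothesis uA : A \in unitmx.
Let W := (invmx A)^T.

(** [translation_defect] bounds H pointwise by minima of [r] and [tau], which are replaced by the
    trigonometric majorant and integrated against |k|^2 one coordinate at a time. The cut-off [J]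
    stays free until N is known. *)
Lemma energy_majorant (r0 : R) : exists2 C : R, 0 <= C &
  forall r (S : seq 'cV[int]_n.+1) (B : R) J, 0 < r -> r <= r0 -> uniq S ->
  (forall i, (defect S (delta_mx i ord0))%:R <= B) ->
  (\int[nu n.+1]_h ((ksq S h)%:E * translation_energy A r h) <=
    (C * r ^+ n * (B * (\sum_(j < J) Num.min r (2^-1 ^+ j.+1) * 2 ^+ j)
      + 2^-1 ^+ J.+1 * (size S)%:R))%:E)%E.
Proof.
have [C C0 hC] := translation_defect uA r0.
exists (C * n.+1%:R); first by rewrite mulr_ge0.
move=> r S B J rp rr uS dB.
have r0' : 0 <= r := ltW rp.
pose c := C * r ^+ n.
have c0 : 0 <= c by rewrite mulr_ge0 ?exprn_ge0.
pose g (i : 'I_n.+1) (h : V) := (ksq S h * trig_majorant r J (h i ord0))%:E.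
have g0 i h : (0 <= g i h)%E by rewrite lee_fin mulr_ge0 ?ksq_ge0 ?trig_majorant_ge0.
have mg i : measurable_fun setT (g i).
  apply/measurable_EFinP; apply: measurable_funM; first exact: measurable_ksq.
  exact: (measurableT_comp (measurable_trig_majorant r J) (measurable_coord i)).
have mG : measurable_fun setT (fun h => \sum_(i < n.+1) g i h)%E.
  exact: emeasurable_sum.
have G0 h : (0 <= \sum_(i < n.+1) g i h)%E by apply: sume_ge0.
have mPhi : measurable_fun setT (fun h : V => (ksq S h)%:E * translation_energy A r h)%E.
  have mk : measurable_fun setT (fun h : V => (ksq S h)%:E).
    by apply/measurable_EFinP; exact: measurable_ksq.
  exact: (emeasurable_funM mk (measurable_translation_energy uA r)).
have Phi0 h : (0 <= (ksq S h)%:E * translation_energy A r h)%E.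
  by rewrite mule_ge0 ?lee_fin ?ksq_ge0 ?translation_energy_ge0.
have cG0 h : (0 <= c%:E * \sum_(i < n.+1) g i h)%E by rewrite mule_ge0 ?lee_fin.
have mcG : measurable_fun setT (fun h => c%:E * \sum_(i < n.+1) g i h)%E.
  exact: emeasurable_funM.
have le1 : (\int[nu n.+1]_h ((ksq S h)%:E * translation_energy A r h) <=
    \int[nu n.+1]_h (c%:E * \sum_(i < n.+1) g i h))%E.
  apply: (ge0_le_integral_nu mPhi mcG Phi0 cG0) => h _.
  apply: (@le_trans _ _ ((ksq S h)%:E * (c * \sum_i Num.min r (tau (h i ord0)))%:E)%E).
    by apply: lee_wpmul2l; [rewrite lee_fin ksq_ge0|exact: hC].
  rewrite /g sumEFin -!EFinM lee_fin mulrCA; apply: ler_wpM2l => //.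
  rewrite mulr_sumr; apply: ler_sum => i _.
  by apply: ler_wpM2l; [exact: ksq_ge0|exact: min_tau_le].
apply: (le_trans le1).
have h1 := @ge0_integralZl_EFin _ _ _ (nu n.+1) _ measurableT _ (fun x _ => G0 x) mG _ c0.
rewrite {}h1.
rewrite ge0_integral_sum//.
set Z := B * _ + _.
rewrite (_ : C * n.+1%:R * r ^+ n * Z = c * \sum_(i < n.+1) Z); last first.
  by rewrite sumr_const card_ord -mulr_natl /c; ring.
have -> : (c * \sum_(i < n.+1) Z)%:E = (c%:E * \sum_(i < n.+1) Z%:E)%E.
  by rewrite sumEFin -EFinM.
apply: lee_wpmul2l => //; apply: lee_sum => i _.
apply: (le_trans (integral_ksq_majorant J uS r0' (leqnn _))).
rewrite lee_fin lerD2r mulr_sumr; apply: ler_sum => j _.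
rewrite mulrA mulrC; apply: ler_wpM2r => //.
by rewrite mulr_ge0 ?exprn_ge0// le_min r0' exprn_ge0.
Qed.

(** The constant is chosen before [D], [N], [r] and the process. This uniformity lets the radius
    vary with N in the small ball and threshold regimes. *)
Lemma number_variance_growth (c0 c1 r0 : R) : 0 < c0 -> 0 <= c1 ->
  exists2 C : R, 0 <= C & forall (disp : measure_display) (T : measurableType disp)
    (P : probability T R) (X : T -> seq V) (D : set V) (N : nat) (r : R),
  let q := N%:R `^ (n.+1%:R^-1) in
  (0 < N)%N -> 0 < r -> r <= r0 ->
  eball 0 (c0 * q) `<=` D -> D `<=` eball 0 (c0 * q + c1) ->
  (D `&` dual_lattice A #= `I_N)%card ->
  determinantal A (dual_kernel A D) P X ->
  (number_variance A P X N r <= (C * (r * q) ^+ n * (1 + ln (1 + 2 * (r * q))))%:E)%E.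
Proof.
move=> c00 c10; have [C1 C10 hC1] := energy_majorant r0.
have uW : W \in unitmx by rewrite unitmx_tr unitmx_inv.
have [C2 C20 hC2] := defect_bound uW c00 c10.
exists (C1 * (1 + 2 * C2 * c0 ^+ n)).
  by rewrite mulr_ge0// addr_ge0// !mulr_ge0// exprn_ge0// ltW.
move=> disp T P X D N r q N0 rp rr cD Dc cardD detX.
have [S [uS sS SD KS]] := dual_kernel_coordinates uA cardD.
have q1 : 1 <= q.
  have e : (1 : R) `^ n.+1%:R^-1 = 1 by rewrite powR1.
  rewrite -[X in X <= _]e; apply: ge0_ler_powR; rewrite ?nnegrE ?invr_ge0 ?ler0n//.
  by rewrite ler1n.
have q0 : 0 <= q by lra.
have qN : q ^+ n.+1 = N%:R.
  rewrite -powR_mulrn// /q -powRrM mulVf ?pnatr_eq0// powRr1//.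
have rho0 : c0 <= c0 * q by rewrite ler_peMr// ltW.
have dB i := hC2 _ D S rho0 cD Dc uS SD i.
(* The choice 2^J <= q < 2^(J+1): the first inequality bounds the argument of the logarithm by 1 + 2
   r q ([s1]), the second bounds the remainder 2^-(J+1) q^(n+1) by q^n ([s2]). *)
have [J /andP[J1 J2]] := dyadic_exponent q1.
set t := r * q; have t0 : 0 <= t by rewrite mulr_ge0// ltW.
have l0 : 0 <= ln (1 + 2 * t) by rewrite ln_ge0// lerDl mulr_ge0.
apply: (le_trans (number_variance_le uA detX uS sS KS rp)).
have h := hC1 r S _ J rp rr uS dB.
apply: (@le_trans _ _ (\int[nu n.+1]_h ((ksq S h)%:E * translation_energy A r h))%E).
  rewrite -[leRHS]mul1e; apply: lee_wpmul2r; last by rewrite lee_fin; lra.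
  by apply: integral_ge0 => x _; rewrite mule_ge0 ?lee_fin ?ksq_ge0 ?translation_energy_ge0.
apply: (le_trans h); rewrite lee_fin -!mulrA ler_wpM2l//.
set s := \sum_(j < J) _.
have s1 : s <= 2 * ln (1 + 2 * t).
  apply: (le_trans (dyadic_sum_le J (ltW rp))); rewrite ler_pM2l//.
  have rJ : 0 <= r * 2 ^+ J.+1 by rewrite mulr_ge0 ?exprn_ge0// ltW.
  rewrite ler_ln ?posrE; [|lra|lra].
  by rewrite lerD2l /t mulrCA exprS; apply: ler_wpM2l => //; first exact: ltW; rewrite ler_wpM2l.
have s2 : 2^-1 ^+ J.+1 * (size S)%:R <= q ^+ n.
  rewrite sS -qN (exprS q n) mulrA -[leRHS]mul1r; apply: ler_wpM2r; first exact: exprn_ge0.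
  by rewrite exprVn mulrC ler_pdivrMr ?exprn_gt0// mul1r ltW.
rewrite [X in _ <= X](_ : _ = r ^+ n * ((1 + 2 * C2 * c0 ^+ n) * q ^+ n * (1 + ln (1 + 2 * t)))); last first.
  by rewrite /t exprMn; ring.
apply: ler_wpM2l; first by rewrite exprn_ge0// ltW.
have s3 : C2 * (c0 * q) ^+ n * s <= C2 * (c0 * q) ^+ n * (2 * ln (1 + 2 * t)).
  by rewrite ler_wpM2l// mulr_ge0// exprn_ge0// mulr_ge0// ltW.
rewrite exprMn in s3 *; set Q := q ^+ n in s2 s3 *; set k := c0 ^+ n in s3 *.
have Q0 : 0 <= Q by rewrite exprn_ge0.
have k0 : 0 <= k by rewrite exprn_ge0// ltW.
have a1 : 0 <= C2 * k * Q by rewrite !mulr_ge0.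
have a2 : 0 <= Q * ln (1 + 2 * t) by rewrite mulr_ge0.
rewrite (_ : (1 + 2 * C2 * k) * Q * (1 + ln (1 + 2 * t)) =
  Q + C2 * (k * Q) * (2 * ln (1 + 2 * t)) + Q * ln (1 + 2 * t) + 2 * (C2 * k * Q)); last by ring.
lra.
Qed.

End variance_growth.

(** * Elementary estimates for the three regimes *)

Section real_estimates.
Context {R : realType}.

Lemma ln_sublinear (C eps : R) : 0 <= C -> 0 < eps ->
  exists2 M : R, 1 <= M & forall t, M <= t -> C * (1 + ln (1 + 2 * t)) <= eps * t.
Proof.
(* With s = sqrt(t) >= 1 one has 1 + ln(1 + 2 t) <= 5 s, so that eps s >= 5 C suffices; this fixes
   [m] as the threshold for s. *)
move=> C0 e0; pose m := Num.max 1 (5 * C / eps).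
have m1 : 1 <= m by rewrite le_max lexx.
exists (m ^+ 2); first by rewrite exprn_ege1.
move=> t mt; have t0 : 0 <= t by apply: le_trans mt; rewrite sqr_ge0.
pose s := Num.sqrt t.
have ms : m <= s by rewrite -(ger0_norm (_ : 0 <= m)) ?(le_trans ler01)// -sqrtr_sqr ler_wsqrtr.
have st : s ^+ 2 = t by rewrite sqr_sqrtr.
have s1 : 1 <= s by exact: le_trans ms.
have s2 : 5 * C <= eps * s.
  have : 5 * C / eps <= s by apply: le_trans ms; rewrite le_max lexx orbT.
  by rewrite ler_pdivrMr// [leRHS]mulrC.
have l : ln (1 + 2 * t) <= 4 * s.
  (* 1 + 2 t <= (1 + 2 s)^2 halves the growth inside the logarithm before ln(1 + y) <= y is used. *)
  apply: (@le_trans _ _ (ln ((1 + 2 * s) ^+ 2))).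
    rewrite ler_ln ?posrE; [rewrite -st; nra|lra|rewrite exprn_gt0//; lra].
  have h : ln (1 + 2 * s) <= 2 * s by apply: le_ln1Dx; lra.
  have s0 : 0 < 1 + 2 * s by lra.
  rewrite expr2 lnM ?posrE//; lra.
apply: (@le_trans _ _ (C * (5 * s))); first by rewrite ler_wpM2l//; lra.
by rewrite -st expr2 !mulrA ler_wpM2r//; lra.
Qed.

(** 1 <= ln t because t >= e, and 1 + 2 t <= t^2 because t >= 3. *)
Lemma ln_threshold (t : R) : 3 <= t -> expR 1 <= t -> 1 + ln (1 + 2 * t) <= 4 * ln t.
Proof.
move=> t3 te; have t0 : 0 < t by lra.
have h1 : 1 <= ln t by rewrite -(expRK (1 : R)) ler_ln ?posrE ?expR_gt0.
have h2 : ln (1 + 2 * t) <= ln (t ^+ 2) by rewrite ler_ln ?posrE; [nra|lra|rewrite exprn_gt0].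
by rewrite expr2 lnM ?posrE// in h2; lra.
Qed.

Lemma cvge0P (T : Type) (F : set_system T) (FF : Filter F) (u : T -> \bar R) :
  (forall x, 0 <= u x)%E ->
  (forall eps : R, 0 < eps -> \forall x \near F, (u x <= eps%:E)%E) ->
  u x @[x --> F] --> 0%E.
Proof.
move=> u0 ue; have fin x e : (u x <= e%:E)%E -> u x \is a fin_num.
  by move=> ux; rewrite ge0_fin_numE// (le_lt_trans ux)// ltry.
apply/fine_cvgP; split.
  by apply: filterS (ue 1 ltr01) => x; exact: fin.
apply/cvgr0Pnorm_le => eps e0; apply: filterS (ue eps e0) => x ux /=.
by rewrite ger0_norm ?fine_ge0// -lee_fin fineK// (fin _ _ ux).
Qed.

End real_estimates.

Lemma kappa_gt0 (R : realType) n : 0 < kappa n :> R.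
Proof.
rewrite lt_neqAle kappa_ge0 andbT eq_sym; apply/eqP => k0.
have := @kappa_Gamma R n; rewrite k0 mul0r => /esym/eqP.
by rewrite gt_eqF// powR_gt0// pi_gt0.
Qed.

Lemma number_variance_ge0 (R : realType) (n : nat) (A : 'M[R]_n)
    (disp : measure_display) (T : measurableType disp) (P : probability T R)
    (X : T -> seq 'cV[R]_n) N r : A \in unitmx -> (0 <= number_variance A P X N r)%E.
Proof.
move=> uA; have [m mE] := torus_measure_bundle uA.
apply: integral_ge0 => w _; rewrite -mE; apply: integral_ge0 => x _.
by rewrite lee_fin sqr_ge0.
Qed.

Theorem theorem6p3 (R : realType) (d : nat) (A : 'M[R]_d) (c0 c1 : R)
    (I : set nat) (D : nat -> set 'cV[R]_d)
    (disp : nat -> measure_display)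
    (T : forall N : nat, measurableType (disp N))
    (P : forall N : nat, probability (T N) R)
    (X : forall N : nat, T N -> seq 'cV[R]_d) :
  (0 < d)%N -> A \in unitmx -> 0 < c0 -> 0 < c1 ->
  infinite_set I ->
  (forall N, I N ->
     [/\ open (D N),
         (@lebesgue_cV R d).-negligible (closure (D N) `\` interior (D N)),
         eball 0 (c0 * N%:R `^ (d%:R^-1)) `<=` D N,
         D N `<=` eball 0 (c0 * N%:R `^ (d%:R^-1) + c1) &
         (D N `&` dual_lattice A #= `I_N)%card]) ->
  (forall N, I N -> determinantal A (dual_kernel A (D N)) (P N) (X N)) ->
  let V := fun (N : nat) (r : R) => number_variance A (P N) (X N) N r in
  [/\ hyperuniform_large A I V,
      hyperuniform_small A I V &
      threshold_bound d I V].
Proof.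
case: d A D X => [//|n] A D X _ uA c00 c10 _ hD hX V.
have V0 N r : (0 <= V N r)%E by exact: number_variance_ge0.
pose q (N : nat) : R := N%:R `^ (n.+1%:R^-1).
have qN N : q N ^+ n.+1 = N%:R.
  by rewrite -powR_mulrn ?powR_ge0// /q -powRrM mulVf ?pnatr_eq0// powRr1.
have growth r0 : exists2 C : R, 0 <= C & forall N r, I N -> (0 < N)%N -> 0 < r -> r <= r0 ->
    (V N r <= (C * (r * q N) ^+ n * (1 + ln (1 + 2 * (r * q N))))%:E)%E.
  have [C C0 hC] := number_variance_growth uA r0 c00 (ltW c10).
  exists C => // N r IN N0 rp rr; have [_ _ h1 h2 h3] := hD N IN.
  exact: (hC _ _ (P N) (X N) (D N) N r N0 rp rr h1 h2 h3 (hX N IN)).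
(* With t = r N^(1/d), the bound of [growth] has order t^(d-1) ln t and falls below eps t^d once t
   >= M. The condition is stated through t^d = r^d N, the quantity compared with in both
   hyperuniformity claims. *)
have decay r0 eps : 0 < eps -> exists2 M : R, 1 <= M & forall N r, I N -> (0 < N)%N ->
    0 < r -> r <= r0 -> M ^+ n.+1 <= r ^+ n.+1 * N%:R ->
    (V N r <= (eps * (r ^+ n.+1 * N%:R))%:E)%E.
  move=> e0; have [C C0 hC] := growth r0.
  have [M M1 hM] := ln_sublinear C0 e0.
  exists M => // N r IN N0 rp rr; rewrite -qN -exprMn => Mt.
  have t0 : 0 <= r * q N by rewrite mulr_ge0 ?powR_ge0// ltW.
  apply: (le_trans (hC N r IN N0 rp rr)); rewrite lee_fin mulrAC exprS [leRHS]mulrA.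
  apply: ler_wpM2r; first exact: exprn_ge0.
  apply: hM; rewrite -(@ler_pXn2r _ n.+1)// nnegrE.
  by apply: le_trans M1.
have nearI (Q : set nat) : (\forall N \near \oo, I N -> (0 < N)%N -> Q N) ->
    \forall N \near within I \oo, Q N.
  move=> h; rewrite near_withinE.
  by apply: filterS2 h (nbhs_infty_gt 0) => N hQ N0 IN; exact: hQ.
split.
- move=> r /andP[r0 _]; apply: cvge0P => [N|eps e0].
    by rewrite mule_ge0// lee_fin invr_ge0.
  have rn0 : 0 < r ^+ n.+1 by rewrite exprn_gt0.
  (* For a fixed radius r^d is a constant, absorbed into the tolerance. *)
  have [M M1 hM] := decay r (eps / r ^+ n.+1) (divr_gt0 e0 rn0).
  apply: nearI; apply: filterS (nbhs_infty_ger (M ^+ n.+1 / r ^+ n.+1)) => N MN IN N0.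
  have N0' : (0 : R) < N%:R by rewrite ltr0n.
  have h : (V N r <= (eps * N%:R)%:E)%E.
    have := hM N r IN N0 r0 (lexx r); rewrite mulrA divfK ?gt_eqF//; apply.
    by rewrite mulrC -ler_pdivrMr.
  apply: le_trans (lee_wpmul2r _ h) _; first by rewrite lee_fin invr_ge0.
  by rewrite -EFinM mulfK ?gt_eqF.
- move=> r rI r0 rN; pose v : R := `|\det A|^-1 * kappa n.+1.
  have v0 : 0 < v by rewrite mulr_gt0 ?kappa_gt0// invr_gt0 normr_gt0 -unitfE -unitmxE.
  have volE N s : N%:R * ball_volume A s = v * (s ^+ n.+1 * N%:R).
    by rewrite ball_volumeE /v; ring.
  have Fw : Filter (within I \oo) by exact: within_filter.
  have vol0 N s : 0 <= s -> 0 <= N%:R * ball_volume A s.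
    by move=> s0; rewrite volE mulr_ge0 ?(ltW v0)// mulr_ge0 ?exprn_ge0.
  (* Outside I, the radius may be negative. *)
  apply: (@cvg_trans _ ((V N (r N) * (`|N%:R * ball_volume A (r N)|^-1)%:E)%E @[N --> within I \oo])).
    apply: near_eq_cvg; apply: nearI; near=> N => IN N0.
    by rewrite ger0_norm; last exact/vol0/ltW/rI.
  apply: cvge0P => [N|eps e0]; first by rewrite mule_ge0// lee_fin invr_ge0.
  (* The claim divides by N Vol = v r^d N, hence the tolerance [eps * v]. The radii tend to 0, so
     they are eventually at most 1. *)
  have [M M1 hM] := decay 1 (eps * v) (mulr_gt0 e0 v0).
  have h1 : \forall N \near within I \oo, r N <= 1 by exact: (cvgr_le _ r0 _ ltr01).
  have h2 : \forall N \near within I \oo, v * M ^+ n.+1 <= N%:R * ball_volume A (r N).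
    by move/cvgryPge : rN; exact.
  rewrite !near_withinE in h1 h2.
  apply: nearI; apply: filterS2 h1 h2 => N h1 h2 IN N0.
  have rp := rI N IN; have {}h1 := h1 IN; have {}h2 := h2 IN.
  rewrite volE ler_pM2l// in h2.
  have t0 : 0 < r N ^+ n.+1 * N%:R by rewrite mulr_gt0 ?exprn_gt0// ltr0n.
  have h := hM N (r N) IN N0 rp h1 h2.
  rewrite volE ger0_norm; last by rewrite mulr_ge0 ?ltW.
  apply: le_trans (lee_wpmul2r _ h) _; first by rewrite lee_fin invr_ge0 mulr_ge0 ?ltW.
  by rewrite -EFinM -(mulrA eps) mulfK// gt_eqF// mulr_gt0.
(* The factor 4 is the one of [ln_threshold]. *)
have [C C0 hC] := growth 1; exists (4 * C).
near=> t.
have t3 : 3 <= t by near: t; exact: nbhs_pinfty_ge.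
have te : expR 1 <= t by near: t; exact: nbhs_pinfty_ge.
have t0 : 0 < t by lra.
(* On [B] the radius t N^(-1/d) is at most 1, as [growth 1] requires. [B] is a neighbourhood of
   infinity within [I], so the supremum over it bounds the upper limit. *)
pose B : set nat := [set N | [/\ I N, (0 < N)%N & t ^+ n.+1 <= N%:R]].
apply: (@le_trans _ _ (ereal_sup [set V N (t * N%:R `^ (- n.+1%:R^-1)) | N in B])).
  apply: ereal_inf_lbound; exists B => //; apply: nearI.
  by apply: filterS (nbhs_infty_ger (t ^+ n.+1)) => N tN IN N0.
apply: ge_ereal_sup => _ [N [IN N0 tN] <-].
have q0 : 0 < q N by rewrite powR_gt0// ltr0n.
have rqE : t * N%:R `^ (- n.+1%:R^-1) * q N = t.
  by rewrite powRN -mulrA mulVf ?mulr1// gt_eqF.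
apply: (le_trans (hC N _ IN N0 _ _)).
- by rewrite mulr_gt0// powR_gt0// ltr0n.
- rewrite -(ler_pM2r q0) rqE mul1r -(@ler_pXn2r _ n.+1)// ?nnegrE ?qN//; exact: ltW.
rewrite rqE lee_fin /= -(mulrA 4) -mulrA (mulrCA 4) ler_wpM2l// mulrCA ler_wpM2l//.
  by rewrite exprn_ge0// ltW.
exact: ln_threshold.
Unshelve. all: by end_near.
Qed.
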